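(* Let $l_1\ge L=L(\sqrt{A^TA},W_{\rm cell},l_2,\dots,l_d)$, let $a_\varepsilon>0$ with $a_\varepsilon/\sqrt\varepsilon\to a\in[0,\infty]$ as $\varepsilon\to0$, and let $$a_{\rm crit}=\sqrt{\frac{2\beta_A}{l_1\alpha_A}},\qquad \mathcal E_{\rm lim}(a)=\frac{\prod_{j=2}^dl_j}{\det A}\min\Big\{\tfrac12l_1\alpha_Aa^2,\beta_A\Big\}.$$ Then: (a) (subcritical case) If $a\le a_{\rm crit}$, the homogeneous deformations $y^{\rm el}_\varepsilon(x)=x+\bar F(a_\varepsilon)x$, $x\in\mathcal L_\varepsilon\cap\Omega$, have asymptotically optimal energy: $\lim_{\varepsilon\to0}\mathcal E_\varepsilon(y^{\rm el}_\varepsilon)=\mathcal E_{\rm lim}(a)$. (b) (supercritical case) If $a\ge a_{\rm crit}$, there are $\xi\in\mathcal P$ and $c\in\mathbb R$ such that the hyperplane $\Pi=\{x\in\mathbb R^d:x\cdot\xi=c\}$ satisfies $\Pi\cap\overline\Omega\subset\overline\Omega\setminus(B_1^\varepsilon\cup B_2^\varepsilon)$ for $\varepsilon$ small and the cleaved configurations $$y^{\rm cr}_\varepsilon(x)=\begin{cases}x,&x\cdot\xi\le c,\\ x+l_1a_\varepsilon\mathbf e_1,&x\cdot\xi>c,\end{cases}\qquad x\in\mathcal L_\varepsilon\cap\Omega,$$ have asymptotically optimal energy: $\lim_{\varepsilon\to0}\mathcal E_\varepsilon(y^{\rm cr}_\varepsilon)=\mathcal E_{\rm lim}(a)$.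
   Context: Lattice and cells. Let $d\ge2$, $\Omega=(0,l_1)\times\dots\times(0,l_d)$ with $l_j>0$. Let $v_1,\dots,v_d\in\mathbb R^d$ be linearly independent, $A=(v_1,\dots,v_d)$ with $\det A>0$, $\mathcal L=A\mathbb Z^d$, $\mathcal L_\varepsilon=\varepsilon\mathcal L$ for $\varepsilon>0$. Let $\mathcal L'_\varepsilon=\varepsilon A((\frac12,\dots,\frac12)^T+\mathbb Z^d)$ and, for $\bar x\in\mathcal L'_\varepsilon$, $Q_\varepsilon(\bar x)=\bar x+\varepsilon A[-\frac12,\frac12)^d$. Let $(\mathcal L'_\varepsilon(\Omega))^\circ=\{\bar x\in\mathcal L'_\varepsilon:\overline{Q_\varepsilon(\bar x)}\subset\Omega\}$. Let $z_1,\dots,z_{2^d}$ be an enumeration of $A\{-\frac12,\frac12\}^d$, $\mathcal Z=\{z_1,\dots,z_{2^d}\}$, $Z=(z_1,\dots,z_{2^d})\in\mathbb R^{d\times2^d}$, $\bar{SO}(d)=\{RZ:R\in SO(d)\}$. Energy. For $y:\mathcal L_\varepsilon\cap\Omega\to\mathbb R^d$ and $\bar x\in(\mathcal L'_\varepsilon(\Omega))^\circ$ put $y_i=y(\bar x+\varepsilon z_i)$, $\bar y=2^{-d}\sum_iy_i$, $\bar\nabla y(\bar x)=\varepsilon^{-1}(y_1-\bar y,\dots,y_{2^d}-\bar y)$, and $\mathcal E_\varepsilon(y)=\varepsilon^{d-1}\sum_{\bar x\in(\mathcal L'_\varepsilon(\Omega))^\circ}W_{\rm cell}(\bar\nabla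 y(\bar x))$. Assumptions on $W_{\rm cell}:\mathbb R^{d\times2^d}\to[0,\infty]$. For $G=(g_1,\dots,g_{2^d})$, $\tilde{\mathcal Z}\subset\mathcal Z$ let $G[\tilde{\mathcal Z}]=(g_j)_{z_j\in\tilde{\mathcal Z}}$, and $d(G;\mathcal Z_1,\mathcal Z_2)=\min\{|g_i-g_j|:z_i\in\mathcal Z_1,z_j\in\mathcal Z_2\}$. (i) $W_{\rm cell}(RG+(c,\dots,c))=W_{\rm cell}(G)$ for all $R\in SO(d)$, $c\in\mathbb R^d$. (ii) $W_{\rm cell}(G)=0$ iff $G=RZ+(c,\dots,c)$ for some $R\in SO(d)$, $c\in\mathbb R^d$. (iii) $W_{\rm cell}$ is continuous, and $C^2$ in a neighborhood of $\bar{SO}(d)$; the Hessian $Q_{\rm cell}=D^2W_{\rm cell}(Z)$ (viewed as a quadratic form) is positive definite on the complement of the subspace spanned by the translations $(c,\dots,c)$ and the infinitesimal rotations $HZ$, $H+H^T=0$. (iv) There are functions $W^{\tilde{\mathcal Z}}:\mathbb R^{d\times\#\tilde{\mathcal Z}}\to[0,\infty)$ and numbers $\beta(z_s,z_t)=\beta(z_t,z_s)\ge0$ ($z_s\ne z_t$ in $\mathcal Z$) such that for every partition $\mathcal Z=\mathcal Z_1\dot\cup\dots\dot\cup\mathcal Z_n$ $$W_{\rm cell}(G)=\sum_{i=1}^nW^{\mathcal Z_i}(G[\mathcal Z_i])+\frac12\sum_{i\ne j}\sum_{z_s\in\mathcal Z_i}\sum_{z_t\in\mathcal Z_j}\beta(z_s,z_t)+o(1)\quad\text{as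 }\min_{i<j}d(G;\mathcal Z_i,\mathcal Z_j)\to\infty,$$ where the triple sum is strictly positive unless $n=1$; moreover $W^{\mathcal Z_i}(H[\mathcal Z_i])\le C\,W_{\rm cell}(H)$ for $H$ in a neighborhood of $\bar{SO}(d)$. Normalization: let $\mathcal V=A\{-1,0,1\}^d\setminus\{0\}$ and $\mathcal V_k=\{At:t\in\{-1,0,1\}^d\text{ with exactly }k\text{ nonzero entries}\}$. It is assumed that for each $1\le k\le d$ and $\nu\in\mathcal V_k$ there is $\beta(\nu)\ge0$ with $\frac12\beta(z_s,z_t)=2^{k-d}\beta(\nu)$ for all $z_s,z_t\in\mathcal Z$ with $z_s-z_t=\nu$. Crystallographic normals: $\mathcal P=\{\xi\in S^{d-1}:\exists u_1,\dots,u_{d-1}\in\mathcal V,\ \mathrm{span}\{u_1,\dots,u_{d-1}\}=\xi^\perp\}$. Boundary strips: $l_A=\sum_{j=1}^d|v_j\cdot\mathbf e_1|$, $B_1^\varepsilon=\{x\in\overline\Omega:x_1\le2l_A\varepsilon\}$, $B_2^\varepsilon=\{x\in\overline\Omega:x_1\ge l_1-2l_A\varepsilon\}$. Constants. $\beta_A=\min_{\xi\in\mathbb R^d\setminus\{0\}}\frac{\sum_{\nu\in\mathcal V}\beta(\nu)|\nu\cdot\xi|}{|\mathbf e_1\cdot\xi|}$ (quotient $+\infty$ if $\mathbf e_1\cdot\xi=0$). $\alpha_A>0$ is the number with $\min\{Q_{\rm cell}(\frac12(G+G^T)Z):G\in\mathbb R^{d\times d},g_{11}=r\}=\alpha_Ar^2$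 for all $r\in\mathbb R$, and $\bar F(r)\in\mathbb R^{d\times d}_{\rm sym}$ is the unique symmetric matrix with $(\bar F(r))_{11}=r$ and $Q_{\rm cell}(\bar F(r)Z)=\alpha_Ar^2$. With $M_1=\min_{\xi\in S^{d-1}}\sum_{\nu\in\mathcal V}\beta(\nu)|\nu\cdot\xi|$ and $M_2=\max_{\xi\in S^{d-1}}\sum_{\nu\in\mathcal V}\beta(\nu)|\nu\cdot\xi|$, set $L=C_*\max\{l_2,\dots,l_d\}M_2/M_1$, where $C_*>0$ is a sufficiently large constant independent of $M_1,M_2,l_2,\dots,l_d$. *)

(* Defs.v *)
From HB Require Import structures.
From mathcomp Require Import all_boot all_order all_algebra.
From mathcomp Require Import all_classical all_reals all_analysis.

Set Implicit Arguments.
Unset Strict Implicit.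
Unset Printing Implicit Defensive.

Import Order.TTheory GRing.Theory Num.Theory.
Import numFieldNormedType.Exports.

Local Open Scope classical_set_scope.
Local Open Scope ring_scope.

(* The space dimension is n.+1, so that the first coordinate is [ord0].
   Vectors are columns; the norm and topology that the library puts on
   matrices come from the sup norm, hence the separate [dot] and [enorm]. *)

Definition dot (R : realType) (m : nat) (u v : 'cV[R]_m) : R :=
  \sum_i u i 0 * v i 0.

Definition enorm (R : realType) (m : nat) (u : 'cV[R]_m) : R :=
  Num.sqrt (dot u u).

Definition usphere (R : realType) (m : nat) : set 'cV[R]_m :=
  [set xi | enorm xi = 1].

Definition e1 (R : realType) (n : nat) : 'cV[R]_n.+1 := delta_mx ord0 ord0.

Definition SO (R : realType) (m : nat) : set 'M[R]_m :=
  [set T | T *m T^T = 1%:M /\ \det T = 1].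

Definition is_min (R : realType) (S : set R) (m : R) : Prop :=
  S m /\ forall x, S x -> m <= x.

Definition Omega (R : realType) (n : nat) (l : 'I_n.+1 -> R) :
    set 'cV[R]_n.+1 :=
  [set x | forall i, 0 < x i 0 < l i].

(* The midpoints eps A ((1/2, ..., 1/2) + Z^d). *)
Definition dual_lattice (R : realType) (n : nat) (A : 'M[R]_n.+1) (eps : R) :
    set 'cV[R]_n.+1 :=
  [set eps *: (A *m (const_mx 2^-1 + map_mx intr k)) | k in [set: 'cV[int]_n.+1]].

Definition cell (R : realType) (n : nat) (A : 'M[R]_n.+1) (eps : R)
    (xbar : 'cV[R]_n.+1) : set 'cV[R]_n.+1 :=
  [set xbar + eps *: (A *m t) |
    t in [set t : 'cV[R]_n.+1 | forall i, - 2^-1 <= t i 0 < 2^-1]].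

Definition inner_cells (R : realType) (n : nat) (A : 'M[R]_n.+1)
    (l : 'I_n.+1 -> R) (eps : R) : set 'cV[R]_n.+1 :=
  [set xbar | dual_lattice A eps xbar /\ closure (cell A eps xbar) `<=` Omega l].

Definition corner_enum (R : realType) (n : nat) (A : 'M[R]_n.+1)
    (z : 'I_(2 ^ n.+1) -> 'cV[R]_n.+1) : Prop :=
  injective z /\
  range z = [set A *m t |
    t in [set t : 'cV[R]_n.+1 | forall i, t i 0 \in [:: - 2^-1; 2^-1]]].

Definition corner_mx (R : realType) (n : nat)
    (z : 'I_(2 ^ n.+1) -> 'cV[R]_n.+1) : 'M[R]_(n.+1, 2 ^ n.+1) :=
  \matrix_(i, j) z j i 0.

(* The matrix (c, ..., c). *)
Definition shift_mx (R : realType) (n : nat) (c : 'cV[R]_n.+1) :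
    'M[R]_(n.+1, 2 ^ n.+1) :=
  \matrix_(i, j) c i 0.

Definition SObar (R : realType) (n : nat)
    (z : 'I_(2 ^ n.+1) -> 'cV[R]_n.+1) : set 'M[R]_(n.+1, 2 ^ n.+1) :=
  [set T *m corner_mx z | T in @SO R n.+1].

(* Deformations are total functions, of which the energy below only reads the
   values at corners of inner cells, i.e. at lattice points of Omega. *)
Definition discrete_grad (R : realType) (n : nat)
    (z : 'I_(2 ^ n.+1) -> 'cV[R]_n.+1) (eps : R)
    (y : 'cV[R]_n.+1 -> 'cV[R]_n.+1) (xbar : 'cV[R]_n.+1) :
    'M[R]_(n.+1, 2 ^ n.+1) :=
  let ybar := (2 ^+ n.+1)^-1 *: \sum_j y (xbar + eps *: z j) in
  \matrix_(i, j) (eps^-1 *: (y (xbar + eps *: z j) - ybar)) i 0.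

Definition energy (R : realType) (n : nat) (A : 'M[R]_n.+1) (l : 'I_n.+1 -> R)
    (z : 'I_(2 ^ n.+1) -> 'cV[R]_n.+1) (W : 'M[R]_(n.+1, 2 ^ n.+1) -> \bar R)
    (eps : R) (y : 'cV[R]_n.+1 -> 'cV[R]_n.+1) : \bar R :=
  ((eps ^+ n)%:E *
   \esum_(xbar in inner_cells A l eps) W (discrete_grad z eps y xbar))%E.

(* f is C^2 on the set U, meant to be open. *)
Definition C2_on (R : realType) (V : normedModType R) (f : V -> R)
    (U : set V) : Prop :=
  forall x, U x ->
    [/\ differentiable f x,
        forall v, differentiable ('D_v f : V -> R) x &
        forall u v, {for x, continuous ('D_u ('D_v f : V -> R) : V -> R)}].

Definition Qcell (R : realType) (n : nat)
    (z : 'I_(2 ^ n.+1) -> 'cV[R]_n.+1) (W : 'M[R]_(n.+1, 2 ^ n.+1) -> \bar R)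
    (G : 'M[R]_(n.+1, 2 ^ n.+1)) : R :=
  'D_G ('D_G (fine \o W) : 'M[R]_(n.+1, 2 ^ n.+1) -> R) (corner_mx z).

Definition frame_indifferent (R : realType) (n : nat)
    (W : 'M[R]_(n.+1, 2 ^ n.+1) -> \bar R) : Prop :=
  forall T c G, SO T -> W (T *m G + shift_mx c) = W G.

Definition zero_set_rigid (R : realType) (n : nat)
    (z : 'I_(2 ^ n.+1) -> 'cV[R]_n.+1)
    (W : 'M[R]_(n.+1, 2 ^ n.+1) -> \bar R) : Prop :=
  forall G, W G = 0%E <->
    exists T c, SO T /\ G = T *m corner_mx z + shift_mx c.

Definition smooth_near_rotations (R : realType) (n : nat)
    (z : 'I_(2 ^ n.+1) -> 'cV[R]_n.+1)
    (W : 'M[R]_(n.+1, 2 ^ n.+1) -> \bar R) : Prop :=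
  exists U : set 'M[R]_(n.+1, 2 ^ n.+1),
    [/\ open U, SObar z `<=` U, forall G, U G -> W G \is a fin_num &
        C2_on (fine \o W) U].

Definition infinitesimal_rigid (R : realType) (n : nat)
    (z : 'I_(2 ^ n.+1) -> 'cV[R]_n.+1) : set 'M[R]_(n.+1, 2 ^ n.+1) :=
  [set G | exists H c, H + H^T = 0 /\ G = H *m corner_mx z + shift_mx c].

Definition Qcell_positive (R : realType) (n : nat)
    (z : 'I_(2 ^ n.+1) -> 'cV[R]_n.+1)
    (W : 'M[R]_(n.+1, 2 ^ n.+1) -> \bar R) : Prop :=
  forall G, ~ infinitesimal_rigid z G -> 0 < Qcell z W G.

(* Subsets of {z_1, ..., z_(2^d)} are sets of indices. *)
Definition subcell (R : realType) (n : nat) (G : 'M[R]_(n.+1, 2 ^ n.+1))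
    (B : {set 'I_(2 ^ n.+1)}) : 'M[R]_(n.+1, #|B|) :=
  colsub (@enum_val _ (mem B)) G.

Definition corner_partition (n : nat) (P : {set {set 'I_(2 ^ n.+1)}}) : bool :=
  finset.partition P (finset.setTfor 'I_(2 ^ n.+1)).

(* The interaction term (1/2) sum_{i <> j} sum_{Z_i} sum_{Z_j} beta(z_s, z_t). *)
Definition cross_bonds (R : realType) (n : nat)
    (bond : 'I_(2 ^ n.+1) -> 'I_(2 ^ n.+1) -> R)
    (P : {set {set 'I_(2 ^ n.+1)}}) : R :=
  2^-1 * \sum_(B in P) \sum_(B' in P | B' != B)
           \sum_(s in B) \sum_(t in B') bond s t.

(* min_{i < j} d(G; Z_i, Z_j) >= M for the blocks Z_i of P. *)
Definition separated (R : realType) (n : nat) (P : {set {set 'I_(2 ^ n.+1)}})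
    (G : 'M[R]_(n.+1, 2 ^ n.+1)) (M : R) : Prop :=
  forall B B' : {set 'I_(2 ^ n.+1)}, B \in P -> B' \in P -> B != B' ->
  forall s t, s \in B -> t \in B' -> M <= enorm (col s G - col t G).

(* The trivial one-block partition has no pair of blocks to separate, and
   demanding W = Wsub there would make W finite everywhere. *)
Definition splits_at_infinity (R : realType) (n : nat)
    (W : 'M[R]_(n.+1, 2 ^ n.+1) -> \bar R)
    (Wsub : forall B : {set 'I_(2 ^ n.+1)}, 'M[R]_(n.+1, #|B|) -> R)
    (bond : 'I_(2 ^ n.+1) -> 'I_(2 ^ n.+1) -> R) : Prop :=
  forall P, corner_partition P -> (1 < #|P|)%N ->
    0 < cross_bonds bond P /\
    forall eta : R, 0 < eta -> exists M : R, forall G, separated P G M ->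
      (`|W G - (\sum_(B in P) Wsub B (subcell G B) + cross_bonds bond P)%:E|
        <= eta%:E)%E.

Definition subcell_dominated (R : realType) (n : nat)
    (z : 'I_(2 ^ n.+1) -> 'cV[R]_n.+1) (W : 'M[R]_(n.+1, 2 ^ n.+1) -> \bar R)
    (Wsub : forall B : {set 'I_(2 ^ n.+1)}, 'M[R]_(n.+1, #|B|) -> R) : Prop :=
  exists (C : R) (U : set 'M[R]_(n.+1, 2 ^ n.+1)),
    [/\ 0 < C, open U, SObar z `<=` U &
        forall P B H, corner_partition P -> B \in P -> U H ->
          ((Wsub B (subcell H B))%:E <= C%:E * W H)%E].

Definition bond_dirs (R : realType) (n : nat) (A : 'M[R]_n.+1) (k : nat) :
    set 'cV[R]_n.+1 :=
  [set A *m t | t in [set t : 'cV[R]_n.+1 |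
     (forall i, t i 0 \in [:: -1; 0; 1]) /\ #|[pred i | t i 0 != 0]| = k]].

Definition all_bond_dirs (R : realType) (n : nat) (A : 'M[R]_n.+1) :
    set 'cV[R]_n.+1 :=
  [set A *m t | t in [set t : 'cV[R]_n.+1 |
     forall i, t i 0 \in [:: -1; 0; 1]]] `\ 0.

Definition bonds_normalized (R : realType) (n : nat) (A : 'M[R]_n.+1)
    (z : 'I_(2 ^ n.+1) -> 'cV[R]_n.+1)
    (bond : 'I_(2 ^ n.+1) -> 'I_(2 ^ n.+1) -> R)
    (beta : 'cV[R]_n.+1 -> R) : Prop :=
  forall (k : nat) (nu : 'cV[R]_n.+1),
    (1 <= k <= n.+1)%N -> bond_dirs A k nu ->
    0 <= beta nu /\
    forall s t, z s - z t = nu ->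
      2^-1 * bond s t = 2 ^+ k / 2 ^+ n.+1 * beta nu.

(* All hypotheses on the cell energy W, the fragment energies Wsub and the
   bond strengths. *)
Record admissible (R : realType) (n : nat) (A : 'M[R]_n.+1)
    (z : 'I_(2 ^ n.+1) -> 'cV[R]_n.+1) (W : 'M[R]_(n.+1, 2 ^ n.+1) -> \bar R)
    (Wsub : forall B : {set 'I_(2 ^ n.+1)}, 'M[R]_(n.+1, #|B|) -> R)
    (bond : 'I_(2 ^ n.+1) -> 'I_(2 ^ n.+1) -> R)
    (beta : 'cV[R]_n.+1 -> R) : Prop := Admissible {
  adm_ge0 : forall G, (0 <= W G)%E ;
  adm_frame : frame_indifferent W ;
  adm_zero : zero_set_rigid z W ;
  adm_continuous : continuous W ;
  adm_C2 : smooth_near_rotations z W ;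
  adm_Qcell : Qcell_positive z W ;
  adm_sub_ge0 : forall B X, 0 <= Wsub B X ;
  adm_bond : forall s t, s != t -> bond s t = bond t s /\ 0 <= bond s t ;
  adm_split : splits_at_infinity W Wsub bond ;
  adm_dominated : subcell_dominated z W Wsub ;
  adm_normalized : bonds_normalized A z bond beta
}.

Definition crystallographic (R : realType) (n : nat) (A : 'M[R]_n.+1) :
    set 'cV[R]_n.+1 :=
  [set xi | usphere xi /\
    exists u : n.-tuple 'cV[R]_n.+1,
      (forall v, v \in u -> all_bond_dirs A v) /\
      forall x, (x \in <<u>>%VS) <-> dot x xi = 0].

Definition lA (R : realType) (n : nat) (A : 'M[R]_n.+1) : R :=
  \sum_j `|dot (col j A) (e1 R n)|.

Definition strip1 (R : realType) (n : nat) (A : 'M[R]_n.+1)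
    (l : 'I_n.+1 -> R) (eps : R) : set 'cV[R]_n.+1 :=
  [set x | closure (Omega l) x /\ x ord0 0 <= 2 * lA A * eps].

Definition strip2 (R : realType) (n : nat) (A : 'M[R]_n.+1)
    (l : 'I_n.+1 -> R) (eps : R) : set 'cV[R]_n.+1 :=
  [set x | closure (Omega l) x /\ l ord0 - 2 * lA A * eps <= x ord0 0].

(* sum_{nu in V} beta(nu) |nu . xi| *)
Definition surf (R : realType) (n : nat) (A : 'M[R]_n.+1)
    (beta : 'cV[R]_n.+1 -> R) (xi : 'cV[R]_n.+1) : R :=
  \sum_(nu \in all_bond_dirs A) beta nu * `|dot nu xi|.

(* The infima and the supremum below are attained, hence the minima and the
   maximum. *)
Definition betaA (R : realType) (n : nat) (A : 'M[R]_n.+1)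
    (beta : 'cV[R]_n.+1 -> R) : R :=
  fine (ereal_inf
    [set if dot (e1 R n) xi == 0 then +oo%E
         else (surf A beta xi / `|dot (e1 R n) xi|)%:E |
      xi in [set xi : 'cV[R]_n.+1 | xi != 0]]).

Definition M1 (R : realType) (n : nat) (A : 'M[R]_n.+1)
    (beta : 'cV[R]_n.+1 -> R) : R :=
  inf [set surf A beta xi | xi in @usphere R n.+1].

Definition M2 (R : realType) (n : nat) (A : 'M[R]_n.+1)
    (beta : 'cV[R]_n.+1 -> R) : R :=
  sup [set surf A beta xi | xi in @usphere R n.+1].

(* [xget x0 P] is an element of P when there is one. *)
Definition alphaA (R : realType) (n : nat)
    (z : 'I_(2 ^ n.+1) -> 'cV[R]_n.+1)
    (W : 'M[R]_(n.+1, 2 ^ n.+1) -> \bar R) : R :=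
  xget 0 [set alpha : R | 0 < alpha /\
    forall r, is_min
      [set Qcell z W ((2^-1 *: (G + G^T)) *m corner_mx z) |
        G in [set G : 'M[R]_n.+1 | G ord0 ord0 = r]]
      (alpha * r ^+ 2)].

Definition Fbar (R : realType) (n : nat)
    (z : 'I_(2 ^ n.+1) -> 'cV[R]_n.+1)
    (W : 'M[R]_(n.+1, 2 ^ n.+1) -> \bar R) (r : R) : 'M[R]_n.+1 :=
  xget 0 [set F : 'M[R]_n.+1 |
    [/\ F^T = F, F ord0 ord0 = r &
        Qcell z W (F *m corner_mx z) = alphaA z W * r ^+ 2]].

Definition Lmin (R : realType) (n : nat) (A : 'M[R]_n.+1)
    (l : 'I_n.+1 -> R) (beta : 'cV[R]_n.+1 -> R) (Cstar : R) : R :=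
  Cstar * \big[Num.max/0]_(j | j != ord0) l j * M2 A beta / M1 A beta.

Definition acrit (R : realType) (n : nat) (A : 'M[R]_n.+1)
    (l : 'I_n.+1 -> R) (z : 'I_(2 ^ n.+1) -> 'cV[R]_n.+1)
    (W : 'M[R]_(n.+1, 2 ^ n.+1) -> \bar R) (beta : 'cV[R]_n.+1 -> R) : R :=
  Num.sqrt (2 * betaA A beta / (l ord0 * alphaA z W)).

Definition Elim (R : realType) (n : nat) (A : 'M[R]_n.+1)
    (l : 'I_n.+1 -> R) (z : 'I_(2 ^ n.+1) -> 'cV[R]_n.+1)
    (W : 'M[R]_(n.+1, 2 ^ n.+1) -> \bar R) (beta : 'cV[R]_n.+1 -> R)
    (a : \bar R) : \bar R :=
  (((\prod_(j | j != ord0) l j) / \det A)%:E *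
   mine ((2^-1 * l ord0 * alphaA z W)%:E * (a * a)) (betaA A beta)%:E)%E.

Definition y_el (R : realType) (n : nat)
    (z : 'I_(2 ^ n.+1) -> 'cV[R]_n.+1)
    (W : 'M[R]_(n.+1, 2 ^ n.+1) -> \bar R) (r : R) (x : 'cV[R]_n.+1) :
    'cV[R]_n.+1 :=
  x + Fbar z W r *m x.

Definition hyperplane (R : realType) (n : nat) (xi : 'cV[R]_n.+1) (c : R) :
    set 'cV[R]_n.+1 :=
  [set x | dot x xi = c].

Definition y_cr (R : realType) (n : nat) (l : 'I_n.+1 -> R)
    (xi : 'cV[R]_n.+1) (c : R) (r : R) (x : 'cV[R]_n.+1) : 'cV[R]_n.+1 :=
  if dot x xi <= c then x else x + (l ord0 * r) *: e1 R n.

(* Main.v *)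
(** Counting cells reduces both limits to densities of lattice points.  Writing a
    matrix as a product of elementary ones, and comparing the two grids cut out on
    each line when one row is changed, shows that the points of an invertible image
    of the lattice in a box have density 1 / |det|.

    (a) All cells carry the same energy W(Z + a_eps F Z), with F the unit optimal
    strain, and a second-order expansion of W at Z gives its limit.

    (b) Only cells cut by the hyperplane matter.  In such a cell the two fragments
    separate by l_1 a_eps / eps -> oo, and the splitting of W leaves the energy of
    the broken bonds, because the fragment energies vanish.  The cells whose bond
    (s, t) is cut are counted by stacking translates along z_t - z_s into a slab of
    fixed thickness, so the total is the surface energy times the area of the cut.
    Among the minimisers of surf(xi) / |xi_1| one that annihilates the most bonds is
    crystallographic, and |xi_1| >= M_1 / M_2 for it, so that for l_1 >= L the
    hyperplane through the centre stays away from both ends of the box. *)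
Require Import Defs.
From HB Require Import structures.
From mathcomp Require Import all_boot all_order all_algebra fingroup perm.
From mathcomp Require Import all_classical all_reals all_analysis.
From mathcomp Require Import ring lra zify.

Set Implicit Arguments.
Unset Strict Implicit.
Unset Printing Implicit Defensive.

Import Order.TTheory GRing.Theory Num.Theory.
Import numFieldNormedType.Exports.

Local Open Scope classical_set_scope.
Local Open Scope ring_scope.

(** * Density of lattice points in boxes *)

(** The cut cells fill a layer of thickness of order [eps], the same order as the error in the
    density of lattice points; this is why the layer is thickened before it is counted. Its lateral
    bounds are imposed on the projection along the bond onto the hyperplane, which all translates
    share, so the stack is exact and not merely approximate. The density comparison is kept as a
    two-sided inequality, uniform over boxes of bounded size: the faces of the boxes that occur move
    with [eps], and such an inequality passes through a product of matrices. The splitting of W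
    gives the energy of a cut cell up to an absolute error only. Since the cut bonds have strictly
    positive total strength, this error can be made relative, and relative errors add up over the
    cells without any bound on the number of cut cells. Even at the critical value the jump is large
    on the scale of a cell: [acrit] is positive, so a_eps is at least a multiple of sqrt eps and
    a_eps / eps diverges. *)

Lemma ge0_esumZl (R : realType) (T : choiceType) (S : set T) (a : T -> \bar R)
    (c : R) :
  0 <= c -> (forall x, 0 <= a x)%E ->
  (c%:E * (\esum_(x in S) a x) = \esum_(x in S) (c%:E * a x))%E.
Proof.
move=> c0 a0; rewrite /esum -ereal_supZl//; last first.
  by apply/set0P; exists (\sum_(x \in set0) a x)%E, set0 => //; exact: fsets_set0.
congr ereal_sup; apply/seteqP; split => [_ [_ [X XS <-] <-]|_ [X XS <-]] /=.
  by exists X => //; rewrite ge0_mule_fsumr.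
exists (\sum_(x \in X) a x)%E; first by exists X.
by rewrite ge0_mule_fsumr.
Qed.

(** With values in [\bar R] no finiteness has to be proved in advance: counts are compared by
    inclusions and bijections, and finiteness comes out of the limits. *)
Definition cnt (R : realType) (T : choiceType) (S : set T) : \bar R :=
  \esum_(x in S) 1%E.

Lemma cnt_ge0 (R : realType) (T : choiceType) (S : set T) : (0 <= cnt R S)%E.
Proof. by apply: esum_ge0 => x _; rewrite lee01. Qed.

Lemma cnt_set0 (R : realType) (T : choiceType) : cnt R (@set0 T) = 0%E.
Proof. exact: esum_set0. Qed.

Lemma le_cnt (R : realType) (T : choiceType) (S S' : set T) :
  S `<=` S' -> (cnt R S <= cnt R S')%E.
Proof.
move=> sub; rewrite /cnt (esum_mkcond S) (esum_mkcond S'); apply: le_esum => x _.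
case: ifPn => [/[!inE] /sub Sx|_]; first by rewrite ifT// inE.
by case: ifP; rewrite ?lee01.
Qed.

Lemma cnt_bij (R : realType) (T T' : choiceType) (S : set T) (S' : set T')
    (e : T -> T') : set_bij S S' e -> cnt R S' = cnt R S.
Proof. by move=> be; rewrite /cnt (reindex_esum _ _ _ _ be). Qed.

Lemma cnt_finType (R : realType) (T : finType) :
  cnt R [set: T] = (#|T|%:R)%:E.
Proof.
rewrite /cnt esum_fset//; last exact: finite_finset.
rewrite (fsbigE (enum T)) ?enum_uniq//; last by move=> x _; rewrite mem_enum.
under eq_bigl do rewrite in_setT.
rewrite sumEFin big_enum /= sumr_const //.
Qed.

Lemma cnt_box (R : realType) (m : nat) (p q : 'I_m -> int) :
  (forall i, p i <= q i) ->
  cnt R [set k : 'cV[int]_m | forall i, p i < k i 0 <= q i] =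
  (\prod_i (q i - p i)%:~R)%:E.
Proof.
move=> pq.
pose N i := `|q i - p i|%N.
(* The interval excludes its left end, so its first integer is [p i + 1]. *)
pose e (f : {dffun forall i : 'I_m, 'I_(N i)}) : 'cV[int]_m :=
  \col_i (p i + (f i : nat)%:Z + 1).
rewrite (@cnt_bij R {dffun forall i : 'I_m, 'I_(N i)} _ setT _ e); last first.
  split=> [f _ i /=|f g _ _ fg|k /= kP].
  - rewrite mxE; have : (f i < `|q i - p i|)%N := ltn_ord (f i); move: (pq i).
    by move: (nat_of_ord (f i)) (p i) (q i) => a b c; lia.
  - apply/ffunP => i; apply/val_inj/eqP => /=.
    by move/colP: fg => /(_ i); rewrite !mxE => h; apply/eqP; lia.
  - have H i : (`|(k i 0 - p i - 1)%R| < N i)%N.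
      by have := kP i; rewrite /N; move: (k i 0) (p i) (q i) => a b c; lia.
    exists [ffun i => Ordinal (H i)] => //.
    by apply/colP => i; rewrite mxE ffunE /=; have := kP i; lia.
rewrite cnt_finType card_dep_ffun; congr EFin.
rewrite foldrE big_map big_enum /= natr_prod; apply: eq_bigr => i _.
by rewrite card_ord /N natr_absz ger0_norm// subr_ge0.
Qed.

Lemma cnt_int_itv (R : realType) (p q : int) : p <= q ->
  cnt R [set t : int | p < t <= q] = ((q - p)%:~R)%:E.
Proof.
move=> pq; have := @cnt_box R 1 (fun=> p) (fun=> q) (fun=> pq).
rewrite big_ord1 => <-; symmetry.
apply: (@cnt_bij R _ _ _ _ (fun t => const_mx t : 'cV[int]_1)).
split=> [t tP i|t u _ _ /colP/(_ 0)|k kP]; rewrite ?mxE//.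
by exists (k 0 0); [exact: (kP 0)|apply/colP => i; rewrite mxE ord1].
Qed.
(** Every line in direction [i] meets the hyperplane [k i 0 = 0] exactly once, so this hyperplane
    indexes the lines. *)
Lemma cnt_fibre (R : realType) (m : nat) (i : 'I_m) (S : set 'cV[int]_m) :
  cnt R S = \esum_(k in [set k : 'cV[int]_m | k i 0 = 0])
              cnt R [set t : int | S (k + t *: delta_mx i 0)].
Proof.
rewrite /cnt esum_esum; last by move=> *; rewrite lee01.
apply: (@cnt_bij R _ _ _ _ (fun kt : 'cV[int]_m * int =>
                           kt.1 + kt.2 *: delta_mx i 0)).
split=> [[k t] [] //|[k t] [k' t']|k Sk] /=.
  rewrite !inE /= => -[k0 _] [k'0 _] /colP E.
  have tt' : t = t'.
    by have := E i; rewrite !mxE k0 k'0 !add0r eqxx /= !mulr1.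
  by rewrite -tt' in E *; congr pair; apply/colP => j; move: (E j); rewrite !mxE => /addIr.
exists (k - k i 0 *: delta_mx i 0, k i 0); rewrite /= ?subrK//.
by split=> //=; rewrite !mxE eqxx /= mulr1 subrr.
Qed.

Lemma cnt_oppz (R : realType) (S : set int) : cnt R [set t | S (- t)] = cnt R S.
Proof.
apply/esym/(@cnt_bij R _ _ _ _ -%R); split=> [//|t u _ _ /oppr_inj//|t St].
by exists (- t); rewrite /= ?opprK.
Qed.

Lemma exists_int_max (S : set int) (b : int) :
  S !=set0 -> (forall k, S k -> k <= b) ->
  exists j, S j /\ forall k, S k -> k <= j.
Proof.
move=> [k0 Sk0] Sb.
have [||j [Sj jmin]] := @int_lbound_has_minimum [set t | S (- t)] (- b).
- by exists (- k0); rewrite /= opprK.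
- by move=> k /= /Sb; lia.
- by exists (- j); split => // k Sk; have := jmin (- k); rewrite /= opprK => /(_ Sk); lia.
Qed.

Definition grid (R : realType) (J : set R) (r s : R) : set int :=
  [set t | J (r * t%:~R + s)].

(** Step times number of points measures the length of an interval up to one step. Comparing two
    grids directly gives the error [r1 + r2] and never mentions the length of [J]. *)
Lemma cnt_grid_pos (R : realType) (J : set R) (M r1 s1 r2 s2 : R) :
  (forall x y t, J x -> J y -> x <= t <= y -> J t) ->
  (forall x, J x -> `|x| <= M) -> 0 < r1 -> 0 < r2 ->
  grid J r1 s1 !=set0 ->
  (r1%:E * cnt R (grid J r1 s1) <=
   r2%:E * cnt R (grid J r2 s2) + (r1 + r2)%:E)%E.
Proof.
move=> Jc JM r10 r20 K0.
set K := grid J r1 s1 in K0 *.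
have KM t : K t -> `|t%:~R| <= (M + `|s1|) / r1 :> R.
  move=> /JM h; rewrite ler_pdivlMr// -{1}(gtr0_norm r10) -normrM mulrC.
  by rewrite -[_ * _](addrK s1) (le_trans (ler_normB _ _))// lerD2r.
set b := Num.floor ((M + `|s1|) / r1).
have Kb t : K t -> t <= b /\ - t <= b.
  move=> /KM; rewrite /b !floor_ge_int mulrNz ler_norml => /andP[h1 h2].
  by split=> //; rewrite lerNl.
(* [q] and [p] are the extreme points of the first grid; by convexity everything between them lies
   in [J]. *)
have [q [Kq qmax]] := @exists_int_max K b K0 (fun t h => (Kb t h).1).
have [p [Kp pmin]] : exists j, K j /\ forall k, K k -> j <= k.
  by apply: (@int_lbound_has_minimum K (- b) K0) => t /Kb[_]; rewrite lerNl.
have pq : p <= q := pmin _ Kq.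
have K1 : (cnt R K <= ((q - p + 1)%:~R)%:E)%E.
  rewrite (_ : q - p + 1 = q - (p - 1)); last by lia.
  rewrite -cnt_int_itv; last by lia.
  by apply: le_cnt => t Kt /=; have := pmin _ Kt; have := qmax _ Kt; lia.
(* The indices in ]u, v] are those of the points of the second grid that lie in ]r1 p + s1, r1 q +
   s1]. *)
set u := Num.floor ((r1 * p%:~R + s1 - s2) / r2).
set v := Num.floor ((r1 * q%:~R + s1 - s2) / r2).
have pqR : p%:~R <= q%:~R :> R by rewrite ler_int.
have uv : u <= v.
  apply: le_floor; rewrite ler_pM2r ?invr_gt0// lerD2r lerD2r.
  by rewrite ler_pM2l.
have K2 : (((v - u)%:~R)%:E <= cnt R (grid J r2 s2))%E.
  rewrite -cnt_int_itv//; apply: le_cnt => t /= /andP[ut tv].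
  apply: (Jc _ _ _ Kp Kq).
  move: ut tv; rewrite /u /v floor_lt_int floor_ge_int.
  rewrite ltr_pdivrMr// ler_pdivlMr// => h1 h2.
  by apply/andP; split; [apply: ltW|]; lra.
apply: (@le_trans _ _ (r1 * (q - p + 1)%:~R)%:E).
  by rewrite EFinM lee_pmul2l.
apply: (@le_trans _ _ (r2 * (v - u)%:~R + (r1 + r2))%:E); last first.
  by rewrite EFinD EFinM leeD2r// lee_pmul2l.
rewrite lee_fin !intrD !intrN.
have := floor_le ((r1 * p%:~R + s1 - s2) / r2); rewrite -/u.
have := floorD1_gt ((r1 * q%:~R + s1 - s2) / r2); rewrite -/v.
rewrite intrD ltr_pdivrMr// ler_pdivlMr// => h1 h2.
nra.
Qed.

Lemma cnt_grid_abs (R : realType) (J : set R) (r s : R) :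
  cnt R (grid J `|r| s) = cnt R (grid J r s).
Proof.
case: (ger0P r) => // _; rewrite -cnt_oppz; congr cnt.
by apply/seteqP; split => t; rewrite /grid /= mulrNz mulrNN.
Qed.

Lemma cnt_grid (R : realType) (J : set R) (M r1 s1 r2 s2 : R) :
  (forall x y t, J x -> J y -> x <= t <= y -> J t) ->
  (forall x, J x -> `|x| <= M) -> r1 != 0 -> r2 != 0 ->
  grid J r1 s1 !=set0 ->
  (`|r1|%:E * cnt R (grid J r1 s1) <=
   `|r2|%:E * cnt R (grid J r2 s2) + (`|r1| + `|r2|)%:E)%E.
Proof.
move=> Jc JM r10 r20 [t K0]; rewrite -(cnt_grid_abs _ r1) -(cnt_grid_abs _ r2).
apply: (@cnt_grid_pos _ _ M) => //; rewrite ?normr_gt0//.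
move: K0; rewrite /grid /=; case: (ger0P r1) => _ h; first by exists t.
by exists (- t); rewrite /= mulrNz mulrNN.
Qed.

(** Half-open, so that for the identity matrix the count is an exact product of differences of
    floors. *)
Definition lattice_box (R : realType) (m : nat) (B : 'M[R]_m) (eps : R)
    (lo hi : 'I_m -> R) : set 'cV[int]_m :=
  [set k | forall i, lo i < eps * (B *m map_mx intr k) i 0 <= hi i].

(** [k] is the inverse of [B] applied to a vector whose entries are at most [rho / eps]. *)
Lemma lattice_box_bounded (R : realType) (m : nat) (B : 'M[R]_m) (rho : R) :
  B \in unitmx -> exists K : R, 0 <= K /\
  forall (eps : R) lo hi k, 0 < eps -> (forall i, `|lo i| <= rho /\ `|hi i| <= rho) ->
    lattice_box B eps lo hi k -> forall j, `|k j 0|%:~R <= K / eps.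
Proof.
move=> Bu; pose S : R := \sum_i \sum_j `|invmx B i j|.
exists (S * `|rho|).
have S0 i : \sum_j `|invmx B i j| <= S.
  rewrite [leRHS](bigD1 i)//= lerDl; apply: sumr_ge0 => ? _.
  by apply: sumr_ge0 => ? _.
split; first by rewrite mulr_ge0//; do 2! (apply: sumr_ge0 => ? _).
move=> eps lo hi k eps0 lohi kbox j.
rewrite intr_norm ler_pdivlMr// -{1}(gtr0_norm eps0) -normrM.
have -> : (k j 0)%:~R = (invmx B *m (B *m map_mx intr k)) j 0 :> R.
  by rewrite mulKmx// mxE.
rewrite mxE mulr_suml (le_trans (ler_norm_sum _ _ _))//.
apply: (@le_trans _ _ (\sum_i `|invmx B j i| * `|rho|)); last first.
  by rewrite -mulr_suml ler_wpM2r.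
apply: ler_sum => i _; rewrite -mulrA normrM ler_wpM2l// mulrC.
have /andP[h1 h2] := kbox i; have [h3 h4] := lohi i.
apply: (le_trans _ (ler_norm rho)); move: h3 h4; rewrite !ler_norml.
by move=> /andP[h3 _] /andP[_ h4]; apply/andP; split; lra.
Qed.

(** A line meeting the box is fixed by n coordinates, each with at most 2 K / eps + 1 <= (2 K + 1) /
    eps values. There are thus O(eps^-n) lines against eps^-(n+1) points, and a bounded error per
    line is negligible. *)
Lemma cnt_lines (R : realType) (n : nat) (B : 'M[R]_n.+1) (i : 'I_n.+1) (rho : R) :
  B \in unitmx -> exists K : R, 0 <= K /\
  forall (eps : R) lo hi, 0 < eps <= 1 -> (forall i, `|lo i| <= rho /\ `|hi i| <= rho) ->
  ((eps ^+ n.+1)%:E * cnt R [set k : 'cV[int]_n.+1 | (k i 0 = 0 /\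
     exists t : int, lattice_box B eps lo hi (k + t *: delta_mx i 0))%R] <= (K * eps)%:E)%E.
Proof.
move=> Bu; have [K [K0 KP]] := lattice_box_bounded rho Bu.
exists ((2 * K + 1) ^+ n); split; first by apply: exprn_ge0; lra.
move=> eps lo hi /andP[eps0 eps1] lohi.
pose N := Num.floor (K / eps).
have N0 : 0 <= N by rewrite floor_ge0 divr_ge0// ltW.
(* Coordinate [i] is pinned to ]-1, 0], which contains only 0; the others range over the 2 N + 1
   integers of ]-N - 1, N]. *)
pose p (j : 'I_n.+1) := if j == i then -1 else - N - 1.
pose q (j : 'I_n.+1) := if j == i then 0 else N.
have pq j : p j <= q j by rewrite /p /q; case: ifP => _; lia.
apply: (@le_trans _ _ ((eps ^+ n.+1)%:E * (\prod_j (q j - p j)%:~R)%:E))%E.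
  rewrite lee_pmul2l ?lte_fin ?exprn_gt0//.
  rewrite -cnt_box//; apply: le_cnt => k /= [ki0 [t kt]] j.
  rewrite /p /q; case: eqP => [->|/eqP ji]; first by rewrite ki0.
  have := KP _ _ _ _ eps0 lohi kt j.
  rewrite !mxE (negPf ji) /= mulr0 addr0 -floor_ge_int -/N; lia.
rewrite -EFinM lee_fin (bigD1 i)//= {1}/p {1}/q eqxx sub0r opprK mul1r.
rewrite (eq_bigr (fun=> (2 * N + 1)%:~R)); last first.
  by move=> j /negPf ji; rewrite /p /q ji; congr (_%:~R); lia.
rewrite prodr_const cardC1 card_ord /= exprSr -mulrA [eps * _]mulrC mulrA.
rewrite ler_wpM2r ?(ltW eps0)// -exprMn lerXn2r ?nnegrE//.
- by rewrite mulr_ge0// ?(ltW eps0)// ler0z; lia.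
- lra.
have := floor_le (K / eps); rewrite -/N ler_pdivlMr// => h.
by rewrite intrD intrM; lra.
Qed.

(** [T] alters coordinate [i] only, so [B *m T] and [B] run along the same line in direction
    [col i B]. They differ in the grid they cut out on it: step [r i] and an offset, against step
    1. *)
Lemma lattice_box_col (R : realType) (m : nat) (B T : 'M[R]_m) (i : 'I_m) (r : 'I_m -> R)
    (k : 'cV[int]_m) (t : int) :
  T = \matrix_(a, b) (if a == i then r b else (a == b)%:R) -> k i 0 = 0 ->
  B *m T *m map_mx intr (k + t *: delta_mx i 0) =
  B *m map_mx intr k + (r i * t%:~R + \sum_b r b * (k b 0)%:~R) *: col i B.
Proof.
move=> TE ki0; rewrite -mulmxA.
have -> : T *m map_mx intr (k + t *: delta_mx i 0) =
    map_mx intr k + (r i * t%:~R + \sum_b r b * (k b 0)%:~R) *: delta_mx i 0.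
  apply/colP => a; rewrite TE !mxE.
  under eq_bigr do rewrite !mxE intrD intrM.
  case: (eqVneq a i) => [->|ai] /=.
    rewrite ki0 add0r mulr1 addrC.
    under eq_bigr do rewrite mulrDr.
    rewrite big_split /=; congr (_ + _).
    rewrite (bigD1 i)//= eqxx mulr1 big1 ?addr0// => b /negPf bi.
    by rewrite bi /= !mulr0.
  rewrite mulr0 addr0 (bigD1 a)//= eqxx mul1r (negPf ai) mulr0 addr0.
  by rewrite big1 ?addr0// => b /negPf ba; rewrite eq_sym ba mul0r.
by rewrite mulmxDr -scalemxAr -colE.
Qed.

Section lines.
Variables (R : realType) (n : nat) (B : 'M[R]_n.+1) (i : 'I_n.+1).
Variables (eps rho : R) (lo hi : 'I_n.+1 -> R) (k : 'cV[int]_n.+1).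
Hypotheses (eps0 : 0 < eps) (Bu : B \in unitmx).
Hypothesis lohi : forall i, `|lo i| <= rho /\ `|hi i| <= rho.

Definition line_box : set R :=
  [set x | forall a, lo a < eps * (B *m map_mx intr k + x *: col i B) a 0 <= hi a].

Lemma line_box_convex x y t :
  line_box x -> line_box y -> x <= t <= y -> line_box t.
Proof.
move=> Jx Jy /andP[xt ty] a; have := Jx a; have := Jy a; rewrite !mxE.
rewrite !mulrDr ![eps * (_ * _)]mulrCA.
move: (eps * \sum_j _) (eps * B a i) => p b /andP[h1 h2] /andP[h3 h4].
by apply/andP; split; case: (leP 0 b) => b0; nra.
Qed.

Lemma line_box_bounded : exists M, forall x, line_box x -> `|x| <= M.
Proof.
have [a Ba] : exists a, B a i != 0.
  apply/not_existsP => B0.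
  have Bi0 : B *m delta_mx i (0 : 'I_1) = 0.
    rewrite -colE; apply/colP => a; rewrite !mxE.
    by have /negP := B0 a; rewrite negbK => /eqP.
  have /matrixP/(_ i 0) := mulKmx Bu (delta_mx i (0 : 'I_1)).
  by rewrite Bi0 mulmx0 !mxE !eqxx /= => /esym/eqP; rewrite oner_eq0.
pose p := (B *m map_mx intr k) a 0.
exists ((`|rho| / eps + `|p|) / `|B a i|) => x /(_ a).
have -> : (B *m map_mx intr k + x *: col i B) a 0 = p + x * B a i by rewrite /p !mxE.
move=> /andP[h1 h2]; rewrite ler_pdivlMr ?normr_gt0// -normrM.
rewrite (_ : x * B a i = (p + x * B a i) - p); last by rewrite addrAC subrr add0r.
rewrite (le_trans (ler_normB _ _))// lerD2r ler_pdivlMr// -{1}(gtr0_norm eps0) -normrM mulrC.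
rewrite (le_trans _ (ler_norm rho)) //.
have [h3 h4] := lohi a.
by move: h3 h4; rewrite !ler_norml => /andP[h3 _] /andP[_ h4]; apply/andP; split; lra.
Qed.
End lines.

Section covolume.
Variables (R : realType) (n : nat).
Implicit Types (B T U : 'M[R]_n.+1).

(** An inequality with error O(eps), with [c] in the role of the absolute determinant. [K] depends
    on [rho] but not on the box, which later allows faces that move with [eps]. *)
Definition has_covolume B (c : R) : Prop := [/\ B \in unitmx, 0 <= c & forall rho : R,
  exists K : R, 0 <= K /\ forall (eps : R) lo hi, 0 < eps <= 1 ->
  (forall i, `|lo i| <= rho /\ `|hi i| <= rho) ->
  ((eps ^+ n.+1 * c)%:E * cnt R (lattice_box B eps lo hi) <=
   (eps ^+ n.+1)%:E * cnt R (lattice_box 1%:M eps lo hi) + (K * eps)%:E)%E /\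
  ((eps ^+ n.+1)%:E * cnt R (lattice_box 1%:M eps lo hi) <=
   (eps ^+ n.+1 * c)%:E * cnt R (lattice_box B eps lo hi) + (K * eps)%:E)%E].

Lemma has_covolume1 : has_covolume 1%:M 1.
Proof.
split; [exact: unitmx1 | exact: ler01 |].
move=> rho; exists 0; split=> // eps lo hi _ _.
by rewrite mulr1 mul0r adde0.
Qed.

(** Quantified over all [B], so that the property is closed under products. *)
Definition scales_covolume T (d : R) :=
  forall B c, has_covolume B c -> has_covolume (B *m T) (c * d).

Lemma scales_covolumeM T1 T2 d1 d2 : scales_covolume T1 d1 ->
  scales_covolume T2 d2 -> scales_covolume (T1 *m T2) (d1 * d2).
Proof. by move=> h1 h2 B c h; rewrite mulmxA mulrA; apply/h2/h1. Qed.

Lemma scales_covolume_perm (s : {perm 'I_n.+1}) : scales_covolume (perm_mx s) 1.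
Proof.
move=> B c [Bu c0 Bc]; split; [by rewrite unitmx_mul Bu unitmx_perm|by rewrite mulr1|].
move=> rho; have [K [K0 KP]] := Bc rho; exists K; split=> // eps lo hi eps01 lohi.
rewrite mulr1.
suff -> : cnt R (lattice_box (B *m perm_mx s) eps lo hi) = cnt R (lattice_box B eps lo hi).
  exact: KP.
apply/esym/(@cnt_bij R _ _ _ _ (row_perm s)); split.
- by move=> k kP a; rewrite map_row_perm row_permE mulmxA; exact: kP.
- by move=> k k' _ _ /(congr1 (row_perm s^-1)); rewrite -!row_permM mulVg !row_perm1.
- move=> k kP; exists (row_perm s^-1 k); last by rewrite -row_permM mulgV row_perm1.
  move=> a; rewrite -mulmxA -row_permE -map_row_perm -row_permM mulgV row_perm1.
  exact: kP.
Qed.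

(** [cnt_grid] summed over the lines in direction [i]. Its error is charged only to lines that meet
    the box, since the count on any other line is zero; [cnt_lines] bounds the number of those that
    do. *)
Lemma cnt_lattice_box_lines B T i (r : 'I_n.+1 -> R) (eps rho : R) lo hi :
  0 < eps -> B \in unitmx -> r i != 0 ->
  T = \matrix_(a, b) (if a == i then r b else (a == b)%:R) ->
  (forall i, `|lo i| <= rho /\ `|hi i| <= rho) ->
  let L C := [set k : 'cV[int]_n.+1 | k i 0 = 0 /\
     exists t : int, lattice_box C eps lo hi (k + t *: delta_mx i 0)] in
  (`|r i|%:E * cnt R (lattice_box (B *m T) eps lo hi) <=
    cnt R (lattice_box B eps lo hi) + (`|r i| + 1)%:E * cnt R (L (B *m T)))%E /\
  (cnt R (lattice_box B eps lo hi) <=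
   `|r i|%:E * cnt R (lattice_box (B *m T) eps lo hi) + (`|r i| + 1)%:E * cnt R (L B))%E.
Proof.
move=> eps0 Bu ri0 TE lohi L.
pose D := [set k : 'cV[int]_n.+1 | k i 0 = 0].
pose J (k : 'cV[int]_n.+1) := line_box B i eps lo hi k.
pose sft (k : 'cV[int]_n.+1) : R := \sum_b r b * (k b 0)%:~R.
have gT k : D k -> [set t | lattice_box (B *m T) eps lo hi (k + t *: delta_mx i 0)]
    = grid (J k) (r i) (sft k).
  move=> Dk; apply/seteqP; split => t h a; have := h a;
    by rewrite (lattice_box_col _ _ TE Dk).
have gB k : D k -> [set t | lattice_box B eps lo hi (k + t *: delta_mx i 0)]
    = grid (J k) 1 0.
  move=> Dk.
  have E t : B *m map_mx intr (k + t *: delta_mx i 0) =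
      B *m map_mx intr k + (1 * t%:~R + 0) *: col i B.
    rewrite map_mxD map_mxZ mulmxDr -scalemxAr mul1r addr0 colE.
    congr (_ + _ *: (_ *m _)); apply/matrixP => a b; rewrite !mxE.
    by case: (_ && _).
  by apply/seteqP; split => t h a; have := h a; rewrite E.
have LD C : cnt R (L C) = \esum_(k in D) (if k \in L C then 1%E else 0%E).
  rewrite -esum_mkcondr /cnt; congr esum.
  by apply/seteqP; split => k /=; [move=> [? ?]; split|move=> [_ []]].
have pt C C' r1 s1 r2 s2 (r10 : r1 != 0) (r20 : r2 != 0) :
    (forall k, D k -> [set t | lattice_box C eps lo hi (k + t *: delta_mx i 0)]
    = grid (J k) r1 (s1 k)) ->
    (forall k, D k -> [set t | lattice_box C' eps lo hi (k + t *: delta_mx i 0)]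
    = grid (J k) r2 (s2 k)) ->
    (`|r1|%:E * cnt R (lattice_box C eps lo hi) <=
      `|r2|%:E * cnt R (lattice_box C' eps lo hi) + (`|r1| + `|r2|)%:E * cnt R (L C))%E.
  move=> gC gC'; rewrite (cnt_fibre R i (lattice_box C eps lo hi)).
  rewrite (cnt_fibre R i (lattice_box C' eps lo hi)) LD.
  rewrite !ge0_esumZl//; last 3 first.
  - by move=> k; case: ifP; rewrite ?lee01.
  - by move=> k; exact: cnt_ge0.
  - by move=> k; exact: cnt_ge0.
  rewrite -esumD; last 2 first.
  - by move=> k _; rewrite mule_ge0// ?lee_fin// cnt_ge0.
  - by move=> k _; rewrite mule_ge0// ?lee_fin// ?addr_ge0//; case: ifP; rewrite ?lee01.
  apply: le_esum => k Dk; rewrite gC// gC'//.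
  case: ifPn => [/set_mem[_ [t Lt]]|/negP nL].
    have [M JM] := line_box_bounded i k eps0 Bu lohi.
    rewrite mule1; apply: (@cnt_grid _ _ M) => //.
    - by move=> x y u; apply: line_box_convex.
    - by exists t; rewrite -gC.
  rewrite (_ : grid (J k) r1 (s1 k) = set0) ?cnt_set0 ?mule0 ?adde0//.
    by rewrite mule_ge0// ?lee_fin// cnt_ge0.
  rewrite -gC//; apply/seteqP; split=> t // Lt; apply: nL; apply/mem_set.
  by split=> //; exists t.
have := pt (B *m T) B (r i) sft 1 (fun=> 0) ri0 (oner_neq0 _) gT gB.
have := pt B (B *m T) 1 (fun=> 0) (r i) sft (oner_neq0 _) ri0 gB gT.
by rewrite normr1 !mul1e [1 + _]addrC.
Qed.

Lemma scales_covolume_row T i (r : 'I_n.+1 -> R) :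
  T = \matrix_(a, b) (if a == i then r b else (a == b)%:R) ->
  r i != 0 -> T \in unitmx -> scales_covolume T `|r i|.
Proof.
move=> TE ri0 Tu B c [Bu c0 Bc]; split; [by rewrite unitmx_mul Bu|by rewrite mulr_ge0|].
move=> rho; have [K [K0 KP]] := Bc rho.
have [K1 [K10 K1P]] := cnt_lines i rho Bu.
have [K2 [K20 K2P]] : exists K : R, 0 <= K /\
  forall (eps : R) lo hi, 0 < eps <= 1 -> (forall i, `|lo i| <= rho /\ `|hi i| <= rho) ->
  ((eps ^+ n.+1)%:E * cnt R [set k : 'cV[int]_n.+1 | (k i 0 = 0 /\
     exists t : int, lattice_box (B *m T) eps lo hi (k + t *: delta_mx i 0))%R] <= (K * eps)%:E)%E.
  by apply: cnt_lines; rewrite unitmx_mul Bu.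
pose d := c * (`|r i| + 1).
have d0 : 0 <= d by rewrite mulr_ge0// addr_ge0.
exists (K + d * K1 + d * K2); split; first by rewrite !addr_ge0// mulr_ge0.
move=> eps lo hi eps01 lohi; have /andP[eps0 eps1] := eps01.
have [H1 H2] := KP _ _ _ eps01 lohi.
have [I1 I2] := cnt_lattice_box_lines eps0 Bu ri0 TE lohi.
have e0 : 0 <= eps ^+ n.+1 by rewrite exprn_ge0// ltW.
have step x y z k : (0 <= x)%E -> (0 <= y)%E -> (0 <= z)%E ->
    (x <= y + (`|r i| + 1)%:E * z)%E -> ((eps ^+ n.+1)%:E * z <= (k * eps)%:E)%E ->
    ((eps ^+ n.+1 * c)%:E * x <= (eps ^+ n.+1 * c)%:E * y + (d * k * eps)%:E)%E.
  move=> x0 y0 z0 xyz zk.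
  apply: (le_trans (lee_wpmul2l _ xyz)); first by rewrite lee_fin mulr_ge0.
  rewrite ge0_muleDr ?mule_ge0// ?lee_fin ?addr_ge0// leeD2l//.
  have -> : ((eps ^+ n.+1 * c)%:E * ((`|r i| + 1)%:E * z) =
      d%:E * ((eps ^+ n.+1)%:E * z))%E.
    by rewrite !muleA -!EFinM /d; congr (_%:E * _)%E; ring.
  by rewrite -[d * k * eps]mulrA (EFinM d) lee_wpmul2l.
have S1 := step _ _ _ _ _ _ _ I1 (K2P _ _ _ eps01 lohi).
have S2 := step _ _ _ _ _ _ _ I2 (K1P _ _ _ eps01 lohi).
have E : ((eps ^+ n.+1 * (c * `|r i|))%:E * cnt R (lattice_box (B *m T) eps lo hi) =
  (eps ^+ n.+1 * c)%:E * (`|r i|%:E * cnt R (lattice_box (B *m T) eps lo hi)))%E.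
  by rewrite muleA -EFinM mulrA.
have K1e : 0 <= d * K1 * eps by rewrite !mulr_ge0// ltW.
have K2e : 0 <= d * K2 * eps by rewrite !mulr_ge0// ltW.
rewrite E; split.
  apply: le_trans (S1 _ _ _) _; rewrite ?mule_ge0 ?lee_fin ?cnt_ge0//.
  apply: le_trans (leeD2r _ H1) _; rewrite -addeA leeD2l// -EFinD lee_fin.
  by lra.
apply: le_trans H2 _.
apply: le_trans (leeD2r _ (S2 _ _ _)) _; rewrite ?mule_ge0 ?lee_fin ?cnt_ge0//.
by rewrite -addeA leeD2l// -EFinD lee_fin; lra.
Qed.

(** Interpolates between the identity and [U], so that a triangular [U] can be built up one row at a
    time. *)
Definition mixed_rows U (S : {set 'I_n.+1}) : 'M[R]_n.+1 :=
  \matrix_(a, b) (if a \in S then U a b else (a == b)%:R).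

(** Row [i] of the left factor combines only rows of the right factor outside [S], and those are
    still rows of the identity. *)
Lemma mixed_rowsU1 U i (S : {set 'I_n.+1}) : i \notin S -> (forall b, b \in S -> U i b = 0) ->
  mixed_rows U (i |: S)%SET = mixed_rows U [set i]%SET *m mixed_rows U S.
Proof.
move=> iS Ui; apply/matrixP => a c; rewrite !mxE !inE.
under eq_bigr do rewrite !mxE !inE.
case: eqVneq => [->|ai] /=.
  rewrite (bigD1 c)//= eqxx big1 ?addr0 => [|b /negPf bc].
    by case: ifP => [/Ui ->|]; rewrite ?mul0r ?mulr1.
  by rewrite bc; case: ifP => [/Ui ->|]; rewrite ?mul0r ?mulr0.
rewrite (bigD1 a)//= eqxx mul1r big1 ?addr0// => b /negPf.
by rewrite eq_sym => ->; rewrite mul0r.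
Qed.

(** The order of [s] matters: a row is split off only if it vanishes at the indices that follow it.
    Lower triangular matrices therefore need the ascending order and upper triangular ones the
    descending order. *)
Lemma scales_covolume_mixed U (s : seq 'I_n.+1) : uniq s ->
  pairwise (fun i b => U i b == 0) s -> (forall i, U i i != 0) ->
  (forall i, mixed_rows U [set i]%SET \in unitmx) ->
  scales_covolume (mixed_rows U [set i in s]%SET) (\prod_(i <- s) `|U i i|).
Proof.
move=> us ps Ud Uu; elim: s us ps => [_ _|i s IH] /=.
  rewrite big_nil (_ : mixed_rows _ _ = 1%:M).
    by move=> B c; rewrite mulmx1 mulr1.
  by apply/matrixP => a b; rewrite !mxE !inE.
move=> /andP[i_s us] /andP[/allP Ui ps]; rewrite big_cons set_cons.
rewrite mixed_rowsU1 ?inE//; last by move=> b; rewrite inE => /Ui/eqP.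
apply: scales_covolumeM; last exact: IH.
apply: (@scales_covolume_row _ i (U i)) => //.
by apply/matrixP => a b; rewrite !mxE inE; case: eqP => // ->.
Qed.

Lemma pairwise_enum_ord : pairwise (fun i j : 'I_n.+1 => (i < j)%N) (enum 'I_n.+1).
Proof.
rewrite -(pairwise_map val ltn) val_enum_ord -sorted_pairwise; last exact: ltn_trans.
exact: iota_ltn_sorted.
Qed.

Lemma pairwise_rev_enum_ord :
  pairwise (fun i j : 'I_n.+1 => (j < i)%N) (rev (enum 'I_n.+1)).
Proof.
rewrite -(pairwise_map val (fun i j => (j < i)%N)) map_rev val_enum_ord.
rewrite -sorted_pairwise; last by move=> a b c /= h1 h2; exact: ltn_trans h1.
by rewrite rev_sorted; exact: iota_ltn_sorted.
Qed.

Lemma mixed_rowsT U (s : seq 'I_n.+1) : s =i 'I_n.+1 -> mixed_rows U [set i in s]%SET = U.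
Proof. by move=> sT; apply/matrixP => a b; rewrite !mxE inE sT. Qed.

Lemma scales_covolume_lower U : (forall i j : 'I_n.+1, (i < j)%N -> U i j = 0) ->
  (forall i, U i i != 0) -> scales_covolume U (\prod_i `|U i i|).
Proof.
move=> Ul Ud; rewrite -{1}(@mixed_rowsT U (enum 'I_n.+1)); last by move=> i; rewrite mem_enum.
rewrite -big_enum; apply: scales_covolume_mixed => //.
- exact: enum_uniq.
- by apply: sub_pairwise pairwise_enum_ord => i j /Ul ->.
- move=> i; rewrite unitmxE det_trig; last first.
    apply/is_trig_mxP => a b ab; rewrite !mxE; case: ifP => _; first exact: Ul.
    by rewrite -val_eqE ltn_eqF.
  rewrite unitfE; apply/prodf_neq0 => a _; rewrite mxE; case: ifP => _ //.
  by rewrite eqxx oner_neq0.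
Qed.

Lemma scales_covolume_upper U : (forall i j : 'I_n.+1, (j < i)%N -> U i j = 0) ->
  (forall i, U i i != 0) -> scales_covolume U (\prod_i `|U i i|).
Proof.
move=> Ul Ud.
rewrite -{1}(@mixed_rowsT U (rev (enum 'I_n.+1))); last by move=> i; rewrite mem_rev mem_enum.
rewrite -big_enum -(perm_big _ (permEl (perm_rev _))) /=.
apply: scales_covolume_mixed => //.
- by rewrite rev_uniq enum_uniq.
- by apply: sub_pairwise pairwise_rev_enum_ord => i j /Ul ->.
- move=> i; rewrite -unitmx_tr unitmxE det_trig; last first.
    apply/is_trig_mxP => a b ab; rewrite !mxE; case: ifP => _; first exact: Ul.
    by rewrite -val_eqE gtn_eqF.
  rewrite unitfE; apply/prodf_neq0 => a _; rewrite !mxE; case: ifP => _ //.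
  by rewrite eqxx oner_neq0.
Qed.

(** The factors come from the LUP decomposition. The sign of the permutation disappears in the
    absolute value, [L] has unit diagonal, and the diagonal of [U] carries the determinant. *)
Lemma has_covolume_det B : B \in unitmx -> has_covolume B `|\det B|.
Proof.
move=> Bu.
have := cormen_lup_perm B; have := cormen_lup_correct B; have := cormen_lup_detL B.
have := @cormen_lup_lower _ n B; have := @cormen_lup_upper _ n B.
case: cormen_lup => [[P L] U] /= Uu Ll dL PB /is_perm_mxP[s PE].
have BE : B = perm_mx s^-1 *m (L *m U).
  by rewrite mulmxE -PB -mulmxE PE mulmxA -perm_mxM mulVg perm_mx1 mul1mx.
have dU : \det U = \prod_i U i i.
  rewrite -det_tr det_trig; first by apply: eq_bigr => i _; rewrite mxE.
  by apply/is_trig_mxP => i j ij; rewrite mxE Uu.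
have dB : \det B = (-1) ^+ (s^-1)%g * \det U.
  by rewrite BE !det_mulmx dL mul1r det_perm.
have Ud i : U i i != 0.
  move: Bu; rewrite unitmxE unitfE dB mulf_eq0 signr_eq0 /= dU.
  by move/prodf_neq0; exact.
have -> : `|\det B| = 1 * (1 * (\prod_i `|L i i| * \prod_i `|U i i|)).
  rewrite dB normrM normrX normrN1 expr1n !mul1r dU normr_prod.
  by rewrite [X in X * _]big1 ?mul1r// => i _; rewrite Ll// eqxx normr1.
rewrite BE -[perm_mx _ *m _]mul1mx.
apply: (scales_covolumeM (scales_covolume_perm _) (scales_covolumeM _ _) has_covolume1).
  apply: scales_covolume_lower => [i j ij|i]; last by rewrite Ll// eqxx oner_neq0.
  by rewrite Ll 1?ltnW// -val_eqE ltn_eqF.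
by apply: scales_covolume_upper => // i j; exact: Uu.
Qed.
End covolume.

Lemma cnt_lattice_box1 (R : realType) (n : nat) (eps : R) (lo hi : 'I_n.+1 -> R) :
  0 < eps -> (forall i, lo i <= hi i) ->
  cnt R (lattice_box 1%:M eps lo hi) =
  (\prod_i (Num.floor (hi i / eps) - Num.floor (lo i / eps))%:~R)%:E.
Proof.
move=> eps0 lohi; rewrite -cnt_box; last first.
  by move=> i; apply: le_floor; rewrite ler_pM2r ?invr_gt0.
congr cnt; apply/seteqP; split=> k h i; move: (h i);
  by rewrite mul1mx mxE floor_lt_int floor_ge_int ltr_pdivrMr// ler_pdivlMr// mulrC.
Qed.

Lemma cvg_prod_ord (R : realType) (T : Type) (F : set_system T) {FF : ProperFilter F} (m : nat)
    (f : 'I_m -> T -> R) (a : 'I_m -> R) :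
  (forall i, f i x @[x --> F] --> a i) ->
  \prod_i f i x @[x --> F] --> \prod_i a i.
Proof.
move=> fa; have [s sE] : exists s, s = index_enum (ordinal m) by eexists.
rewrite -!sE; elim: s {sE} => [|i s IH].
  by under eq_fun do rewrite big_nil; rewrite big_nil; exact: cvg_cst.
by under eq_fun do rewrite big_cons; rewrite big_cons; exact: cvgM.
Qed.

Lemma floor_scaled_cvg (R : realType) (g : R -> R) (g0 : R) :
  g eps @[eps --> 0^'+] --> g0 ->
  eps * (Num.floor (g eps / eps))%:~R @[eps --> 0^'+] --> g0.
Proof.
move=> gg0.
have h : g eps - eps @[eps --> 0^'+] --> g0.
  rewrite -[g0]subr0; apply: cvgB => //; apply: cvg_at_right_filter; exact: cvg_id.
apply: (squeeze_cvgr _ h gg0); near=> eps.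
have eps0 : 0 < eps by near: eps; exact: nbhs_right_gt.
have := floor_le (g eps / eps); have := floorD1_gt (g eps / eps).
rewrite intrD ler_pdivlMr// ltr_pdivrMr// => h1 h2.
by apply/andP; split; lra.
Unshelve. all: by end_near. Qed.

Theorem cnt_lattice_box_cvg (R : realType) (n : nat) (B : 'M[R]_n.+1)
    (lo hi : R -> 'I_n.+1 -> R) (lo0 hi0 : 'I_n.+1 -> R) :
  B \in unitmx -> (forall i, lo0 i < hi0 i) ->
  (forall i, lo eps i @[eps --> 0^'+] --> lo0 i) ->
  (forall i, hi eps i @[eps --> 0^'+] --> hi0 i) ->
  ((eps ^+ n.+1)%:E * cnt R (lattice_box B eps (lo eps) (hi eps)))%E @[eps --> 0^'+]
  --> (\prod_i (hi0 i - lo0 i) / `|\det B|)%:E.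
Proof.
move=> Bu lohi0 lolim hilim.
(* The summand 1 leaves room for the moving faces, which lie within [rho] once [eps] is small. *)
pose rho := \sum_i (`|lo0 i| + `|hi0 i|) + 1.
have [_ _ /(_ rho)[K [K0 KP]]] := has_covolume_det Bu.
have d0 : 0 < `|\det B| by rewrite normr_gt0 -unitfE -unitmxE.
have fl : \prod_i (eps * (Num.floor (hi eps i / eps))%:~R -
                   eps * (Num.floor (lo eps i / eps))%:~R) @[eps --> 0^'+]
    --> \prod_i (hi0 i - lo0 i).
  by apply: cvg_prod_ord => i; apply: cvgB; apply: floor_scaled_cvg.
have Keps : K * eps @[eps --> 0^'+] --> (0 : R).
  rewrite -[X in _ --> X](mulr0 K); apply: cvgM; [exact: cvg_cst|].
  by apply: cvg_at_right_filter; exact: cvg_id.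
set p := fun eps => \prod_i _ in fl.
have l1 : ((p eps - K * eps) / `|\det B|)%:E @[eps --> 0^'+]
    --> (\prod_i (hi0 i - lo0 i) / `|\det B|)%:E.
  apply: cvg_EFin; first exact: nearW.
  by apply: cvgM; [rewrite -[X in _ --> X]subr0; exact: cvgB|exact: cvg_cst].
have l2 : ((p eps + K * eps) / `|\det B|)%:E @[eps --> 0^'+]
    --> (\prod_i (hi0 i - lo0 i) / `|\det B|)%:E.
  apply: cvg_EFin; first exact: nearW.
  by apply: cvgM; [rewrite -[X in _ --> X]addr0; exact: cvgD|exact: cvg_cst].
have rhoP i : `|lo0 i| + `|hi0 i| < rho.
  rewrite /rho (bigD1 i)//= -addrA ltrDl; apply: ltr_wpDl => //.
  by apply: sumr_ge0 => j _; exact: addr_ge0.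
have bnd : \forall eps \near 0^'+, forall i, `|lo eps i| <= rho /\ `|hi eps i| <= rho.
  apply: filter_forall => i; near=> eps; split; near: eps.
    apply: cvgr_le (cvg_norm (lolim i)) _ _.
    by apply: le_lt_trans (rhoP i); rewrite lerDl.
  apply: cvgr_le (cvg_norm (hilim i)) _ _.
  by apply: le_lt_trans (rhoP i); rewrite lerDr.
have lohi : \forall eps \near 0^'+, forall i, lo eps i <= hi eps i.
  apply: filter_forall => i; near=> eps; rewrite -subr_ge0; near: eps.
  by apply: cvgr_ge (cvgB (hilim i) (lolim i)) _ _; rewrite subr_gt0.
apply: (squeeze_cvge _ l1 l2).
near=> eps.
have eps0 : 0 < eps by near: eps; exact: nbhs_right_gt.
have eps1 : eps <= 1 by near: eps; exact: nbhs_right_le.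
have bndi i : `|lo eps i| <= rho /\ `|hi eps i| <= rho by move: i; near: eps.
have lohii i : lo eps i <= hi eps i by move: i; near: eps.
have eps01 : 0 < eps <= 1 by rewrite eps0.
have [h1 h2] := KP eps _ _ eps01 bndi.
have pE : ((eps ^+ n.+1)%:E * cnt R (lattice_box 1%:M eps (lo eps) (hi eps)))%E = (p eps)%:E.
  rewrite cnt_lattice_box1// -EFinM /p; congr EFin.
  under [RHS]eq_bigr do rewrite -mulrBr -intrB.
  by rewrite big_split /= prodr_const card_ord.
rewrite pE in h1 h2.
have eE : (eps ^+ n.+1 * `|\det B|)%:E = (`|\det B|%:E * (eps ^+ n.+1)%:E)%E.
  by rewrite mulrC EFinM.
rewrite eE -muleA in h1 h2.
apply/andP; split.
  rewrite mulrC EFinM lee_pdivrMl// EFinB leeBlDr//.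
rewrite [X in (_ <= X)%E](_ : _ = (`|\det B|^-1)%:E * (p eps + K * eps)%:E)%E; last by rewrite mulrC EFinM.
by rewrite lee_pdivlMl// EFinD.
Unshelve. all: by end_near. Qed.

(** * Bonds and surface energy *)

Lemma cvg_sum_ord (R : realType) (T : Type) (F : set_system T) {FF : Filter F}
    (I : finType) (f : I -> T -> R) (a : I -> R) :
  (forall i, f i x @[x --> F] --> a i) ->
  \sum_i f i x @[x --> F] --> \sum_i a i.
Proof.
move=> fa; have [s sE] : exists s, s = index_enum I by eexists.
rewrite -!sE; elim: s {sE} => [|i s IH].
  by under eq_fun do rewrite big_nil; rewrite big_nil; exact: cvg_cst.
by under eq_fun do rewrite big_cons; rewrite big_cons; exact: cvgD.
Qed.

Section dot.
Variables (R : realType) (m : nat).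
Implicit Types (u v w : 'cV[R]_m).

Lemma dotC u v : dot u v = dot v u.
Proof. by apply: eq_bigr => i _; rewrite mulrC. Qed.

Lemma dotDl u v w : dot (u + v) w = dot u w + dot v w.
Proof. by rewrite -big_split; apply: eq_bigr => i _; rewrite mxE mulrDl. Qed.

Lemma dotZl a u w : dot (a *: u) w = a * dot u w.
Proof. by rewrite /dot mulr_sumr; apply: eq_bigr => i _; rewrite mxE mulrA. Qed.

Lemma dotNl u w : dot (- u) w = - dot u w.
Proof. by rewrite -scaleN1r dotZl mulN1r. Qed.

Lemma dotBl u v w : dot (u - v) w = dot u w - dot v w.
Proof. by rewrite dotDl dotNl. Qed.

Lemma dot0l w : dot 0 w = 0.
Proof. by rewrite -(scale0r 0) dotZl mul0r. Qed.

Lemma dotDr u v w : dot w (u + v) = dot w u + dot w v.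
Proof. by rewrite !(dotC w) dotDl. Qed.

Lemma dotZr a u w : dot w (a *: u) = a * dot w u.
Proof. by rewrite !(dotC w) dotZl. Qed.

Lemma dotBr u v w : dot w (u - v) = dot w u - dot w v.
Proof. by rewrite !(dotC w) dotBl. Qed.

Lemma dot_delta i v : dot (delta_mx i 0) v = v i 0.
Proof.
rewrite /dot (bigD1 i)//= mxE !eqxx mul1r big1 ?addr0// => j /negPf ji.
by rewrite mxE ji mul0r.
Qed.

Lemma dot_ge0 v : 0 <= dot v v.
Proof. by apply: sumr_ge0 => i _; rewrite -expr2 sqr_ge0. Qed.

Lemma dot_eq0 v : (dot v v == 0) = (v == 0).
Proof.
apply/eqP/eqP => [v0|->]; last exact: dot0l.
apply/colP => i; rewrite mxE; apply/eqP; rewrite -sqrf_eq0 expr2.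
move: v0 => /eqP; rewrite psumr_eq0 => [/allP/(_ i)|j _]; last by rewrite -expr2 sqr_ge0.
by rewrite mem_index_enum; apply.
Qed.

Lemma usphereE v : usphere v = (dot v v = 1).
Proof.
rewrite /usphere /enorm /=; apply/propext; split=> [h|->]; last exact: sqrtr1.
by rewrite -(sqr_sqrtr (dot_ge0 v)) h expr1n.
Qed.

Lemma usphere_normalize v : v != 0 -> usphere ((Num.sqrt (dot v v))^-1 *: v).
Proof.
move=> v0; rewrite usphereE dotZl dotZr mulrA -invfM -expr2 sqr_sqrtr ?dot_ge0//.
by rewrite mulVf// dot_eq0.
Qed.

Lemma usphere_coord v i : usphere v -> `|v i 0| <= 1.
Proof.
rewrite usphereE => v1; rewrite -(@ler_pXn2r _ 2)// ?nnegrE// expr1n.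
rewrite real_normK ?num_real// -v1 /dot (bigD1 i)//= expr2 lerDl.
by apply: sumr_ge0 => j _; rewrite -expr2 sqr_ge0.
Qed.
End dot.

Section corners.
Variables (R : realType) (n : nat) (A : 'M[R]_n.+1).
Variable z : 'I_(2 ^ n.+1) -> 'cV[R]_n.+1.
Hypotheses (Au : A \in unitmx) (zA : corner_enum A z).

Definition half_vec (f : {ffun 'I_n.+1 -> bool}) : 'cV[R]_n.+1 :=
  \col_i (if f i then 2^-1 else - 2^-1).

(** The enumeration [z] is arbitrary; the signs of the coordinates of A^-1 z_s identify the indices
    with the vertices of a cube. *)
Definition corner_signs (s : 'I_(2 ^ n.+1)) : {ffun 'I_n.+1 -> bool} :=
  [ffun i => 0 < (invmx A *m z s) i 0].

Lemma corner_signsK s : z s = A *m half_vec (corner_signs s).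
Proof.
have [_ zr] := zA; have : range z (z s) by exists s.
rewrite zr => -[t th tz]; rewrite -tz; congr (_ *m _).
apply/colP => i; rewrite !mxE !ffunE -tz mulKmx//.
by have := th i; rewrite !inE => /orP[] /eqP ->; case: ltP => //; lra.
Qed.

Lemma corner_signs_bij : bijective corner_signs.
Proof.
have inj : injective corner_signs.
  by move=> s t st; apply: zA.1; rewrite corner_signsK st -corner_signsK.
apply: inj_card_bij => //.
by rewrite card_ffun card_bool !card_ord.
Qed.

Lemma exists_corner f : exists s, z s = A *m half_vec f.
Proof.
have [g _ gK] := corner_signs_bij.
by exists (g f); rewrite corner_signsK gK.
Qed.

(** The elements 0, 1, 2 of ['I_3] stand for -1, 0, 1, so bond directions range over a finite
    type. *)
Definition dir_vec (tau : {ffun 'I_n.+1 -> 'I_3}) : 'cV[R]_n.+1 :=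
  \col_i ((tau i)%:R - 1).

Definition sign_pair_dir (b : bool * bool) : 'I_3 :=
  if b.1 == b.2 then inord 1 else if b.1 then inord 2 else inord 0.

Lemma sign_pair_dirE b : (sign_pair_dir b)%:R - 1 =
  (if b.1 then 2^-1 else - 2^-1) - (if b.2 then 2^-1 else - 2^-1) :> R.
Proof.
by rewrite /sign_pair_dir; case: b => -[] [] /=; rewrite inordK//=; lra.
Qed.

Definition null_dir : {ffun 'I_n.+1 -> 'I_3} := [ffun=> inord 1].

Lemma dir_vec0 : dir_vec null_dir = 0.
Proof. by apply/colP => i; rewrite !mxE ffunE inordK// subrr. Qed.

Lemma dir_vec_inj : injective dir_vec.
Proof.
move=> f g /colP fg; apply/ffunP => i; have := fg i; rewrite !mxE.
by move=> /addIr/eqP; rewrite eqr_nat => /eqP/val_inj.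
Qed.

Lemma dir_vecP (t : 'cV[R]_n.+1) :
  (forall i, t i 0 \in [:: -1; 0; 1]) <-> exists tau, t = dir_vec tau.
Proof.
split=> [th|[tau ->] i]; last first.
  rewrite mxE !inE; case: (tau i) => -[|[|[|//]]] /= _.
  - by rewrite sub0r eqxx.
  - by rewrite subrr eqxx orbT.
  - by rewrite mulr2n addrK eqxx !orbT.
exists [ffun i => if t i 0 == -1 then 0 else if t i 0 == 0 then inord 1 else inord 2].
apply/colP => i; rewrite mxE ffunE.
have := th i; rewrite !inE; case: eqP => [-> _|_] /=; first by rewrite sub0r.
by case: eqP => [-> _|_ /= /eqP ->]; rewrite inordK//=; lra.
Qed.

Lemma all_bond_dirsE : all_bond_dirs A =
  (fun tau => A *m dir_vec tau) @` [set tau | tau != null_dir].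
Proof.
apply/seteqP; split => [_ [[t th <-] /eqP At0]|_ [tau tau0 <-]].
  have [tau tE] := (dir_vecP t).1 th; exists tau; rewrite ?tE//=.
  by apply: contra_neq At0 => tau0; rewrite tE tau0 dir_vec0 mulmx0.
split; first by exists (dir_vec tau) => //=; apply/dir_vecP; exists tau.
move=> /= /(congr1 (mulmx (invmx A))); rewrite mulKmx// mulmx0 -dir_vec0.
by move/dir_vec_inj => h; move: tau0; rewrite /= h eqxx.
Qed.

Definition pair_dir (s t : 'I_(2 ^ n.+1)) : {ffun 'I_n.+1 -> 'I_3} :=
  [ffun i => sign_pair_dir (corner_signs s i, corner_signs t i)].

Lemma pair_dirE s t : z s - z t = A *m dir_vec (pair_dir s t).
Proof.
rewrite !corner_signsK -mulmxBr; congr (_ *m _); apply/colP => i.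
by rewrite [RHS]mxE ffunE sign_pair_dirE !mxE.
Qed.

Lemma corner_diff_bond_dir s t : s != t -> all_bond_dirs A (z s - z t).
Proof.
move=> st; rewrite all_bond_dirsE pair_dirE; exists (pair_dir s t) => //=.
apply: contra_neq st => h; apply: zA.1; apply/eqP; rewrite -subr_eq0 pair_dirE h.
by rewrite dir_vec0 mulmx0.
Qed.

(** Coordinates are independent: a zero entry arises from two pairs of signs, a nonzero entry from
    exactly one. *)
Lemma card_pair_dir (tau : {ffun 'I_n.+1 -> 'I_3}) :
  #|[pred p | pair_dir p.1 p.2 == tau]| = (2 ^ #|[pred i | tau i == inord 1]|)%N.
Proof.
have [g gK Kg] := corner_signs_bij.
pose h (q : {ffun 'I_n.+1 -> bool * bool}) := (g [ffun i => (q i).1], g [ffun i => (q i).2]).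
have hb : bijective h.
  exists (fun p => [ffun i => (corner_signs p.1 i, corner_signs p.2 i)]) => [q|[s t]].
    by apply/ffunP => i; rewrite ffunE /= !Kg !ffunE -surjective_pairing.
  by rewrite /h /=; congr pair; rewrite -[RHS]gK; congr g; apply/ffunP => i; rewrite !ffunE.
rewrite -(on_card_preimset (f := h)); last exact: onW_bij.
transitivity #|family (fun i => [pred b | sign_pair_dir b == tau i])|.
  apply: eq_card => q.
  have -> : (q \in h @^-1: [pred p | pair_dir p.1 p.2 == tau])%SET =
    (pair_dir (h q).1 (h q).2 == tau) by rewrite inE.
  apply/eqP/familyP => [<- i|H].
    by rewrite inE ffunE !Kg !ffunE -surjective_pairing.
  apply/ffunP => i; rewrite ffunE !Kg !ffunE -surjective_pairing; apply/eqP.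
  by have := H i; rewrite inE.
rewrite card_family foldrE big_map big_enum /=.
have c1 (j : 'I_3) : #|[pred b | sign_pair_dir b == j]| = if j == inord 1 then 2 else 1.
  rewrite -sum1_card big_mkcond /= -(pair_bigA _ (fun a b => if sign_pair_dir (a, b) == j then 1 else 0)%N).
  rewrite !big_bool /sign_pair_dir /= -!val_eqE /= !inordK//.
  by case: j => -[|[|[|//]]].
under eq_bigr do rewrite c1.
by rewrite -big_mkcond /= prod_nat_const.
Qed.

(** A direction with k nonzero entries is the difference of 2^(d-k) ordered pairs of corners, which
    cancels the factor 2^(k-d) of the normalization. From here on the surface energy is handled as a
    sum over pairs of corners. *)
Lemma surf_pairs (bond : 'I_(2 ^ n.+1) -> 'I_(2 ^ n.+1) -> R) beta xi :
  bonds_normalized A z bond beta ->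
  surf A beta xi = \sum_s \sum_t 2^-1 * bond s t * `|dot (z s - z t) xi|.
Proof.
move=> bn; rewrite /surf all_bond_dirsE fsbig_image; last first.
  by move=> f g _ _ /(can_inj (mulKmx Au))/dir_vec_inj.
rewrite (fsbigE (enum [pred tau | tau != null_dir])) ?enum_uniq//; last 2 first.
- by move=> f /=; rewrite mem_enum.
- by move=> f /= f0; rewrite mem_enum inE f0.
rewrite big_enum_cond /= pair_bigA /=.
rewrite (partition_big (fun p => pair_dir p.1 p.2) xpredT)//= [RHS](bigD1 null_dir)//=.
rewrite [X in _ = X + _]big1 ?add0r => [|p /eqP pd]; last first.
  by rewrite pair_dirE pd dir_vec0 mulmx0 dot0l normr0 mulr0.
apply: eq_big => tau; first by apply/andP/idP => [[]//|h]; split=> //; exact: mem_set.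
rewrite inE => /andP[tau0 _].
pose k := #|[pred i | dir_vec tau i 0 != 0]|.
have kE : k = #|[predC [pred i | tau i == inord 1]]|.
  apply: eq_card => i; rewrite !inE mxE subr_eq0 -[1]/(1%:R) eqr_nat.
  by rewrite -val_eqE /= inordK.
have dk : (#|[pred i | tau i == inord 1%N]| + k = n.+1)%N.
  by rewrite kE cardC card_ord.
have k0 : (1 <= k)%N.
  rewrite lt0n; apply: contra_neq tau0 => /card0_eq k0; apply/ffunP => i; rewrite ffunE.
  have := k0 i; rewrite !inE mxE subr_eq0 => /negbFE; rewrite -[1]/(1%:R) eqr_nat => /eqP h.
  by apply/val_inj; rewrite /= inordK.
have nuk : bond_dirs A k (A *m dir_vec tau).
  by exists (dir_vec tau) => //=; split=> //; apply/dir_vecP; exists tau.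
have kn : (1 <= k <= n.+1)%N by rewrite k0 -dk leq_addl.
have [_ bE] := bn _ _ kn nuk.
rewrite (eq_bigr (fun=> 2 ^+ k / 2 ^+ n.+1 * beta (A *m dir_vec tau) *
    `|dot (A *m dir_vec tau) xi|)); last first.
  by move=> [s t] /= /eqP st; have st' := pair_dirE s t; rewrite st in st'; rewrite bE// st'.
rewrite sumr_const.
have -> : #|(fun i : 'I_(2 ^ n.+1) * 'I_(2 ^ n.+1) => pair_dir i.1 i.2 == tau)| =
  (2 ^ #|[pred i | tau i == inord 1]|)%N by exact: card_pair_dir.
have -> : 2 ^+ n.+1 = 2 ^+ #|[pred i | tau i == inord 1%N]| * 2 ^+ k :> R by rewrite -exprD dk.
rewrite -[RHS]mulr_natr natrX invfM.
have p2 j : (2 : R) ^+ j != 0 by rewrite expf_neq0// pnatr_eq0.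
by field; rewrite !p2.
Qed.

Lemma corner_add_col i : exists s t, z s - z t = col i A.
Proof.
have [s sE] := exists_corner [ffun=> true].
have [t tE] := exists_corner [ffun j => j != i].
exists s, t; rewrite sE tE -mulmxBr colE; congr (_ *m _).
apply/colP => j; rewrite !mxE !ffunE andbT.
by case: eqP => _ /=; rewrite ?subrr// opprK; lra.
Qed.

(** The differences of corners include the columns of [A], and only 0 is orthogonal to all of
    these. *)
Lemma corner_separate xi : xi != 0 -> exists s t, dot (z s) xi < dot (z t) xi.
Proof.
move=> xi0; apply/not_existsP => h.
have {}h s t : dot (z s) xi = dot (z t) xi.
  apply/eqP; rewrite eq_le !leNgt; apply/andP; split; apply/negP => st;
  [apply: (h t); exists s|apply: (h s); exists t]; exact: st.
case/negP: xi0; rewrite -trmx_eq0 -(mulmxK Au xi^T) (_ : xi^T *m A = 0) ?mul0mx//.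
apply/rowP => i; have [s [t st]] := corner_add_col i.
rewrite [RHS]mxE; have : dot (z s - z t) xi = 0 by rewrite dotBl (h s t) subrr.
by rewrite st => E; rewrite -[RHS]E mxE; apply: eq_bigr => j _; rewrite !mxE mulrC.
Qed.

Definition two_blocks (S : {set 'I_(2 ^ n.+1)}) := [set S; ~: S]%SET.

Lemma two_blocks_partition (S : {set 'I_(2 ^ n.+1)}) s t : s \in S -> t \notin S ->
  corner_partition (two_blocks S) /\ #|two_blocks S| = 2%N.
Proof.
move=> sS tS.
have S0 : (S != finset.set0) by apply/finset.set0Pn; exists s.
have S'0 : (~: S != finset.set0)%SET by apply/finset.set0Pn; exists t; rewrite inE.
have SS : (S != ~: S)%SET.
  by apply/eqP => /setP/(_ s); rewrite inE sS.
split; last by rewrite cards2 SS.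
rewrite /corner_partition /two_blocks; apply/and3P; split.
- by rewrite /finset.cover finset.bigcup_setU !finset.big_set1 finset.setUCr.
- apply/finset.trivIsetP => B C; rewrite !inE => /orP[] /eqP -> /orP[] /eqP -> //; rewrite ?eqxx// => _.
    by rewrite -finset.setI_eq0 finset.setICr.
  by rewrite -finset.setI_eq0 finset.setIC finset.setICr.
- by rewrite !inE negb_or eq_sym S0 eq_sym S'0.
Qed.

(** Both orders of the two blocks contribute the same sum, which absorbs the factor 1/2. *)
Lemma cross_bonds_two_blocks (bond : 'I_(2 ^ n.+1) -> 'I_(2 ^ n.+1) -> R)
    (S : {set 'I_(2 ^ n.+1)}) s0 t0 :
  s0 \in S -> t0 \notin S ->
  (forall s t, s != t -> bond s t = bond t s) ->
  cross_bonds bond (two_blocks S) = \sum_(s in S) \sum_(t in (~: S)%SET) bond s t.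
Proof.
move=> sS tS bs; have SS : (S != ~: S)%SET.
  by apply/eqP => /setP/(_ s0); rewrite inE sS.
rewrite /cross_bonds /two_blocks big_setU1 ?inE//= finset.big_set1.
rewrite (big_pred1 (~: S)%SET); last first.
  by move=> B; rewrite !inE; case: eqP => [->|_] /=; rewrite ?eqxx ?(negPf SS)//; case: eqP => // ->; rewrite eq_sym SS.
rewrite (big_pred1 S); last first.
  move=> B; rewrite !inE; case: eqP => [->|_] /=; first by rewrite SS.
  by case: eqP.
rewrite [X in _ + X]exchange_big /=.
rewrite [X in _ + X](eq_bigr (fun s => \sum_(t in (~: S)%SET) bond s t)); last first.
  move=> s sin; apply: eq_bigr => t; rewrite inE => tin; apply: bs.
  by apply: contraNneq tin => ->.
by move: (\sum_(s in S) _) => x; lra.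
Qed.

Section surface.
Variables (bond : 'I_(2 ^ n.+1) -> 'I_(2 ^ n.+1) -> R).
Variables (beta : 'cV[R]_n.+1 -> R).
Hypothesis bond_sym : forall s t, s != t -> bond s t = bond t s /\ 0 <= bond s t.
Hypothesis bondn : bonds_normalized A z bond beta.
Hypothesis cross0 : forall P, corner_partition P -> (1 < #|P|)%N -> 0 < cross_bonds bond P.

Lemma surfZ c xi : surf A beta (c *: xi) = `|c| * surf A beta xi.
Proof.
rewrite !(surf_pairs _ bondn) mulr_sumr; apply: eq_bigr => s _.
rewrite mulr_sumr; apply: eq_bigr => t _.
by rewrite dotZr normrM; ring.
Qed.

Lemma pair_term_ge0 xi s t : 0 <= 2^-1 * bond s t * `|dot (z s - z t) xi|.
Proof.
have [->|/bond_sym[_ b0]] := eqVneq s t; first by rewrite subrr dot0l normr0 mulr0.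
by rewrite !mulr_ge0// invr_ge0.
Qed.

(** If the sum vanished, all bonds between corners of different height along [xi] would be zero.
    Cutting the corners at an intermediate height would then give two nonempty blocks without bonds,
    against the positivity of [cross_bonds]. *)
Lemma surf_gt0 xi : xi != 0 -> 0 < surf A beta xi.
Proof.
move=> xi0; rewrite (surf_pairs _ bondn).
have [s [t st]] := corner_separate xi0.
pose S := [set r | dot (z r) xi <= dot (z s) xi]%SET.
have sS : s \in S by rewrite inE.
have tS : t \notin S by rewrite inE -ltNge.
have [PS cS] := two_blocks_partition sS tS.
have := cross0 PS; rewrite cS => /(_ isT).
rewrite (cross_bonds_two_blocks sS tS); last by move=> ? ? /bond_sym[].
move=> cr; rewrite ltNge; apply/negP => le0; move: cr; apply/negP; rewrite -leNgt.
have z0 a b : 2^-1 * bond a b * `|dot (z a - z b) xi| = 0.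
  apply/eqP; rewrite eq_le pair_term_ge0 andbT; apply: le_trans le0.
  rewrite (bigD1 a)//= (bigD1 b)//= -addrA lerDl addr_ge0// !sumr_ge0// => c _.
    exact: pair_term_ge0.
  by apply: sumr_ge0 => d _; exact: pair_term_ge0.
rewrite big1// => a; rewrite inE => aS; rewrite big1// => b; rewrite !inE -ltNge => bS.
apply/eqP; have /eqP := z0 a b.
rewrite !mulf_eq0 invr_eq0 pnatr_eq0 normr_eq0 dotBl subr_eq0 /= => /orP[//|/eqP ab].
by move: (le_lt_trans aS bS); rewrite ab ltxx.
Qed.

Lemma surf_ge0 xi : 0 <= surf A beta xi.
Proof.
rewrite (surf_pairs _ bondn); apply: sumr_ge0 => s _; apply: sumr_ge0 => t _.
exact: pair_term_ge0.
Qed.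

(** Row vectors are used because the extreme value theorem is applied to them below. *)
Lemma continuous_dot_tr (v : 'cV[R]_n.+1) : continuous (fun u : 'rV[R]_n.+1 => dot v u^T).
Proof.
move=> u; apply: (@cvg_sum_ord _ _ (nbhs u)) => i.
apply: (@cvgM _ _ (nbhs u)); first exact: cvg_cst.
under eq_fun do rewrite mxE; rewrite mxE.
exact: coord_continuous.
Qed.

Lemma continuous_surf_tr : continuous (fun u : 'rV[R]_n.+1 => surf A beta u^T).
Proof.
rewrite (_ : (fun u => _) =
    fun u : 'rV[R]_n.+1 => \sum_s \sum_t 2^-1 * bond s t * `|dot (z s - z t) u^T|).
  move=> u; apply: (@cvg_sum_ord _ _ (nbhs u)) => s.
  apply: (@cvg_sum_ord _ _ (nbhs u)) => t.
  apply: (@cvgM _ _ (nbhs u)); first exact: cvg_cst.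
  by apply: (@cvg_norm _ _ _ (nbhs u)); exact: continuous_dot_tr.
by apply/funext => u; rewrite (surf_pairs _ bondn).
Qed.

Definition sphere_tr := [set u : 'rV[R]_n.+1 | usphere u^T].

Lemma sphere_trE : sphere_tr = (fun u : 'rV[R]_n.+1 => dot u^T u^T) @^-1` [set 1].
Proof. by apply/seteqP; split=> u; rewrite /sphere_tr /= usphereE. Qed.

Lemma usphere_e1 : usphere (e1 R n).
Proof. by rewrite usphereE dot_delta mxE !eqxx. Qed.

Lemma sphere_tr0 : sphere_tr !=set0.
Proof. by exists (e1 R n)^T; rewrite /sphere_tr /= trmxK; exact: usphere_e1. Qed.

Lemma compact_sphere_tr : compact sphere_tr.
Proof.
apply: bounded_closed_compact.
  exists 1; split; first exact: num_real.
  move=> M M1 u /= uS; rewrite /Num.norm /= mx_normrE.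
  apply: (@le_trans _ _ 1); last exact: ltW.
  apply: bigmax_le => // -[i j] _ /=; rewrite ord1.
  by have := usphere_coord j uS; rewrite mxE.
rewrite sphere_trE; apply: preimage_closed; last exact: closed_eq.
move=> u _; apply: (@cvg_sum_ord _ _ (nbhs u)) => i.
under eq_fun do rewrite mxE; rewrite mxE.
by apply: (@cvgM _ _ (nbhs u)); exact: coord_continuous.
Qed.

Lemma M1_spec : 0 < M1 A beta /\ forall xi, usphere xi -> M1 A beta <= surf A beta xi.
Proof.
have [|u uS umin] := @EVT_min_rV R n.+1 (fun u => surf A beta u^T) _ sphere_tr0 compact_sphere_tr.
  by apply: continuous_subspaceT; exact: continuous_surf_tr.
rewrite inE in uS.
have lb : lbound [set surf A beta xi | xi in @usphere R n.+1] (surf A beta u^T).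
  by move=> _ [xi xiS <-]; have := umin xi^T; rewrite inE /sphere_tr /= !trmxK; exact.
have u0 : u^T != 0.
  by apply/eqP => u0; move: uS; rewrite /sphere_tr /= usphereE u0 dot0l => /eqP; rewrite eq_sym oner_eq0.
split; last first.
  move=> xi xiS; apply: ge_inf; last by exists xi.
  by exists (surf A beta u^T).
apply: lt_le_trans (surf_gt0 u0) _; apply: lb_le_inf => //.
by exists (surf A beta u^T), u^T.
Qed.

Lemma M2_ge xi : usphere xi -> surf A beta xi <= M2 A beta.
Proof.
have [|u uS umax] := @EVT_max_rV R n.+1 (fun u => surf A beta u^T) _ sphere_tr0 compact_sphere_tr.
  by apply: continuous_subspaceT; exact: continuous_surf_tr.
move=> xiS; apply: sup_ubound; last by exists xi.
exists (surf A beta u^T) => _ [eta etaS <-].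
by have := umax eta^T; rewrite inE /sphere_tr /= !trmxK; exact.
Qed.

(** The quotient that defines [betaA] is infinite where the first coordinate vanishes. Its
    reciprocal is continuous on the whole sphere and is maximised instead; its positive value at
    [e1] shows that the maximiser has a nonzero first coordinate, which is then scaled to 1. *)
Lemma exists_surf_minimizer : exists xi : 'cV[R]_n.+1, xi ord0 0 = 1 /\
  forall eta : 'cV[R]_n.+1, surf A beta xi * `|eta ord0 0| <= surf A beta eta.
Proof.
have sphere_neq0 (u : 'rV[R]_n.+1) : sphere_tr u -> u^T != 0.
  move=> uS; apply/eqP => u0; move: uS; rewrite /sphere_tr /= usphereE u0 dot0l.
  by move=> /eqP; rewrite eq_sym oner_eq0.
have [|u uS umax] := @EVT_max_rV R n.+1 (fun u => `|u 0 ord0| / surf A beta u^T)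
  _ sphere_tr0 compact_sphere_tr.
  apply: continuous_in_subspaceT => u; rewrite inE => uS.
  apply: (@cvgM _ _ (nbhs u)).
    by apply: (@cvg_norm _ _ _ (nbhs u)); exact: coord_continuous.
  apply: (@cvgV _ _ (nbhs u)); last exact: continuous_surf_tr.
  by rewrite gt_eqF// surf_gt0// sphere_neq0.
rewrite inE in uS.
have su := surf_gt0 (sphere_neq0 _ uS).
have u0 : 0 < `|u 0 ord0|.
  have := umax (e1 R n)^T; rewrite inE /sphere_tr /= trmxK => /(_ usphere_e1).
  rewrite !mxE !eqxx normr1 => h.
  have e1n0 : e1 R n != 0 by have := sphere_neq0 (e1 R n)^T; rewrite /sphere_tr /= trmxK => /(_ usphere_e1).
  have : 0 < 1 / surf A beta (e1 R n) by rewrite divr_gt0// surf_gt0.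
  by move=> /lt_le_trans/(_ h); rewrite pmulr_lgt0// invr_gt0.
exists ((u 0 ord0)^-1 *: u^T); split.
  by rewrite !mxE mulVf// -normr_gt0.
move=> eta; have [->|eta0] := eqVneq eta 0; first by rewrite mxE normr0 mulr0 surf_ge0.
pose c : R := (Num.sqrt (dot eta eta))^-1.
have c0 : 0 < c by rewrite invr_gt0 sqrtr_gt0 lt_neqAle eq_sym dot_eq0 eta0 dot_ge0.
have := umax (c *: eta)^T; rewrite inE /sphere_tr /= trmxK => /(_ (usphere_normalize eta0)).
have se := surf_gt0 eta0.
rewrite !mxE normrM !surfZ (gtr0_norm c0) normfV -mulf_div divff ?gt_eqF// mul1r.
rewrite ler_pdivrMr// mulrAC ler_pdivlMr// => h.
by rewrite -mulrA ler_pdivrMl// mulrC.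
Qed.

Definition surf_minimal (xi : 'cV[R]_n.+1) := xi ord0 0 = 1 /\
  forall eta : 'cV[R]_n.+1, surf A beta xi * `|eta ord0 0| <= surf A beta eta.

Definition vanishing (xi : 'cV[R]_n.+1) : {set 'I_(2 ^ n.+1) * 'I_(2 ^ n.+1)} :=
  [set p | dot (z p.1 - z p.2) xi == 0]%SET.

(** Termwise |x + y| + |x - y| = 2 |x| when |y| <= |x|: no bond changes sign between the two
    perturbed vectors. *)
Lemma surf_affine xi eta :
  (forall s t, `|dot (z s - z t) eta| <= `|dot (z s - z t) xi|) ->
  surf A beta (xi + eta) + surf A beta (xi - eta) = surf A beta xi *+ 2.
Proof.
move=> h; rewrite !(surf_pairs _ bondn) -big_split -sumrMnl; apply: eq_bigr => s _ /=.
rewrite -big_split -sumrMnl; apply: eq_bigr => t _ /=.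
rewrite dotDr dotBr -mulrDr -mulrnAr; congr (_ * _).
move: (h s t); move: (dot _ xi) (dot _ eta) => x y.
by case: (ger0P x); case: (ger0P y); case: (ger0P (x + y)); case: (ger0P (x - y)); lra.
Qed.

(* For a minimiser annihilating the most bonds: otherwise surf is affine along
   the direction eta until a further bond is annihilated. *)
Lemma exists_vertex_minimizer : exists xi, surf_minimal xi /\
  forall eta : 'cV[R]_n.+1, eta ord0 0 = 0 ->
  (forall s t, dot (z s - z t) xi = 0 -> dot (z s - z t) eta = 0) -> eta = 0.
Proof.
pose P k := `[< exists xi, surf_minimal xi /\ #|vanishing xi| = k >].
have P0 : exists k, P k.
  have [xi xim] := exists_surf_minimizer.
  by exists #|vanishing xi|; apply/asboolP; exists xi.
have Pub k : P k -> (k <= #|{: 'I_(2 ^ n.+1) * 'I_(2 ^ n.+1)}|)%N.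
  by move=> /asboolP[xi [_ <-]]; exact: max_card.
case: (ex_maxnP P0 Pub) => k /asboolP[xi [xim xik]] kmax.
exists xi; split=> // eta eta0 xieta; apply/eqP; apply: contraT => etan0.
have [s0 [t0 st0]] := corner_separate etan0.
pose d (p : 'I_(2 ^ n.+1) * 'I_(2 ^ n.+1)) v := dot (z p.1 - z p.2) v.
have d0 : d (t0, s0) eta != 0 by rewrite /d /= dotBl gt_eqF// subr_gt0.
(* Among the bonds that [eta] does not annihilate, [p] needs the shortest step along [eta] to be
   annihilated, and [tau] is that step. By minimality no other bond has changed sign by then. *)
pose p := [arg min_(p < (t0, s0) | d p eta != 0) (`|d p xi| / `|d p eta|)]%O.
have [p0 pmin] : d p eta != 0 /\ forall q, d q eta != 0 ->
    `|d p xi| / `|d p eta| <= `|d q xi| / `|d q eta|.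
  by rewrite /p; case: arg_minP.
pose tau := - d p xi / d p eta.
have small s t : `|dot (z s - z t) (tau *: eta)| <= `|dot (z s - z t) xi|.
  rewrite -[dot _ xi]/(d (s, t) xi) dotZr -[dot _ eta]/(d (s, t) eta).
  have [->|q0] := eqVneq (d (s, t) eta) 0; first by rewrite mulr0 normr0.
  by rewrite normrM /tau normrM normrN normfV -ler_pdivlMr ?normr_gt0// pmin.
have := surf_affine small.
have m1 := xim.2 (xi + tau *: eta); have m2 := xim.2 (xi - tau *: eta).
rewrite !mxE eta0 mulr0 subr0 addr0 xim.1 normr1 mulr1 in m1 m2.
(* Both perturbed values are at least the minimum and their sum is twice the minimum, so each of
   them equals it. *)
move=> E; have Ep : surf A beta (xi + tau *: eta) = surf A beta xi by lra.
have xim' : surf_minimal (xi + tau *: eta).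
  by split; [rewrite !mxE eta0 mulr0 addr0 xim.1|rewrite Ep; exact: xim.2].
have := kmax #|vanishing (xi + tau *: eta)|.
have -> : P #|vanishing (xi + tau *: eta)| by apply/asboolP; exists (xi + tau *: eta).
move=> /(_ isT); rewrite -xik leqNgt => /negP; case.
apply: proper_card; apply/properP; split.
  apply/fintype.subsetP => -[s t]; rewrite !inE /= => /eqP h.
  by rewrite dotDr dotZr h (xieta _ _ h) mulr0 addr0.
exists p; rewrite inE -[dot _ _]/(d p _).
  by rewrite /d dotDr dotZr -!/(d p _) /tau divfK// subrr.
by apply: contra p0 => /eqP/xieta; rewrite /d => ->.
Qed.

Lemma exists_free_subseq (V : vectType R) (X : seq V) :
  exists Y, [/\ free Y, {subset Y <= X} & (<<Y>> = <<X>>)%VS].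
Proof.
elim: X => [|x X [Y [fY sY YX]]]; first by exists [::]; split=> //; exact: nil_free.
have [xY|xY] := boolP (x \in <<Y>>%VS).
  exists Y; split=> // [y /sY|]; first by rewrite inE orbC => ->.
  rewrite span_cons -YX; apply/esym/addv_idPr.
  by rewrite -memvE.
exists (x :: Y); split; first by rewrite free_cons xY.
  by move=> y; rewrite !inE => /orP[->//|/sY ->]; rewrite orbT.
by rewrite !span_cons YX.
Qed.

Lemma dot_span (Y : seq 'cV[R]_n.+1) v x :
  (forall y, y \in Y -> dot y v = 0) -> x \in <<Y>>%VS -> dot x v = 0.
Proof.
move=> Yv; rewrite -[Y]/(tval (in_tuple Y)) => /coord_span ->.
apply: (big_ind (fun x => dot x v = 0)) => [|a b ha hb|i _]; first exact: dot0l.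
  by rewrite dotDl ha hb addr0.
by rewrite dotZl Yv ?mulr0// mem_nth.
Qed.

Lemma free_orthogonal_size (Y : seq 'cV[R]_n.+1) v : v != 0 -> free Y ->
  (forall y, y \in Y -> dot y v = 0) -> (size Y <= n)%N.
Proof.
move=> v0 fY Yv; rewrite leqNgt; apply/negP => nY.
have : v \in <<Y>>%VS.
  suff -> : <<Y>>%VS = fullv by exact: memvf.
  apply/eqP; rewrite eqEdim subvf dimvf dim_matrix mulr1.
  by rewrite (eqP fY).
by move=> /(dot_span Yv)/eqP; rewrite dot_eq0 (negPf v0).
Qed.

(** The directions annihilated by [xi] must span its orthogonal complement. A free subfamily has at
    most n members because [xi] is orthogonal to it, and at least n because otherwise a nonzero
    vector orthogonal to it and to [e1] would violate the vertex condition. *)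
Lemma vertex_crystallographic xi c : xi != 0 -> c != 0 -> usphere (c *: xi) ->
  (forall eta : 'cV[R]_n.+1, eta ord0 0 = 0 ->
  (forall s t, dot (z s - z t) xi = 0 -> dot (z s - z t) eta = 0) -> eta = 0) ->
  crystallographic A (c *: xi).
Proof.
move=> xi0 c0 cxi vert; split=> //.
pose X := [seq z p.1 - z p.2 | p <- enum (vanishing xi) & p.1 != p.2].
have [Y [fY YX spYX]] := exists_free_subseq X.
have XP y : y \in X -> all_bond_dirs A y /\ dot y xi = 0.
  move=> /mapP[[s t]]; rewrite mem_filter mem_enum inE /= => /andP[st /eqP h] ->.
  by split=> //; exact: corner_diff_bond_dir.
have Yxi y : y \in Y -> dot y xi = 0 by move=> /YX/XP[].
have leY := free_orthogonal_size xi0 fY Yxi.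
have geY : (n <= size Y)%N.
  rewrite leqNgt; apply/negP => Yn.
  (* The columns are [e1] and the members of [Y], fewer than n + 1 in all, so some nonzero row
     vector annihilates them. *)
  pose M := \matrix_(i < n.+1, j < (size Y).+1) (nth 0 (e1 R n :: Y) j) i 0.
  have : kermx M != 0.
    rewrite -mxrank_eq0 mxrank_ker -lt0n subn_gt0.
    by rewrite (leq_ltn_trans (rank_leq_col _)).
  move=> /rowV0Pn[v /sub_kermxP vM v0].
  have orth j : (j < (size Y).+1)%N -> dot (nth 0 (e1 R n :: Y) j) v^T = 0.
    move=> jY; have /rowP/(_ (Ordinal jY)) := vM; rewrite !mxE => h.
    by rewrite -[RHS]h; apply: eq_bigr => i _; rewrite !mxE mulrC.
  move/negP: v0; apply; rewrite -trmx_eq0; apply/eqP/vert.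
    by have := orth 0%N isT; rewrite /= dot_delta.
  move=> s t h; have [->|st] := eqVneq s t; first by rewrite subrr dot0l.
  apply: (@dot_span Y).
    by move=> y yY; have := orth (index y Y).+1; rewrite /= ltnS index_mem nth_index//; exact.
  rewrite spYX memv_span//; apply/mapP; exists (s, t) => //.
  by rewrite mem_filter /= st mem_enum inE /=; apply/eqP.
have sY : size Y == n by rewrite eqn_leq leY.
exists (Tuple sY); split=> [v /= /YX/XP[]//|x /=]; rewrite dotZr.
split=> [/(dot_span Yxi) ->|/eqP]; first by rewrite mulr0.
(* A vector orthogonal to [xi] outside the span would enlarge [Y] to n + 1 free vectors orthogonal
   to [xi]. *)
rewrite mulf_eq0 (negPf c0) /= => /eqP xxi; apply: contraT => xY.
have : (size (x :: Y) <= n)%N.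
  apply: (free_orthogonal_size xi0); first by rewrite free_cons xY.
  by move=> y; rewrite inE => /orP[/eqP ->//|/Yxi].
by rewrite /= (eqP sY) ltnn.
Qed.

Lemma betaA_eq xi : surf_minimal xi -> betaA A beta = surf A beta xi.
Proof.
move=> [xi0 xim]; rewrite /betaA; set S := [set _ | _ in _].
have e1E (v : 'cV[R]_n.+1) : dot (e1 R n) v = v ord0 0 by rewrite dot_delta.
suff -> : ereal_inf S = (surf A beta xi)%:E by [].
apply/eqP; rewrite eq_le; apply/andP; split.
  apply: ereal_inf_lbound; exists xi.
    by apply/eqP => h; move: xi0; rewrite h mxE => /eqP; rewrite eq_sym oner_eq0.
  by rewrite e1E xi0 oner_eq0 normr1 divr1.
apply: le_ereal_inf_tmp => _ [eta etan0 <-]; rewrite e1E.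
case: eqP => [_|/eqP eta0]; first by rewrite leey.
by rewrite lee_fin ler_pdivlMr ?normr_gt0.
Qed.

Lemma betaA_gt0 xi : surf_minimal xi -> 0 < betaA A beta.
Proof.
move=> xim; rewrite (betaA_eq xim); apply: surf_gt0; apply/eqP => h.
by have := xim.1; rewrite h mxE => /eqP; rewrite eq_sym oner_eq0.
Qed.

End surface.
End corners.

(** * Optimal strain *)

Section second_derivative.
Variables (R : realType) (V : normedModType R) (f : V -> R) (Z : V).

Lemma is_derive_line (v : V) (t : R) : derivable f (t *: v + Z) v ->
  is_derive t 1 (fun s : R => f (s *: v + Z)) ('D_v f (t *: v + Z)).
Proof.
move=> df.
have E : (fun h : R => h^-1 *: (((fun s : R => f (s *: v + Z)) \o shift t) (h *: 1) -
     f (t *: v + Z))) =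
  (fun h : R => h^-1 *: ((f \o shift (t *: v + Z)) (h *: v) - f (t *: v + Z))).
  apply/funext => h /=; congr (_ *: (f _ - _)).
  by rewrite [_%:A]mulr1 scalerDl addrA.
by split; rewrite /derivable /derive E.
Qed.

Hypothesis df : \forall x \near Z, differentiable f x.

Lemma derive2_linear_dir (u v w : V) (a : R) :
  differentiable ('D_v f : V -> R) Z -> differentiable ('D_w f : V -> R) Z ->
  'D_u ('D_(a *: v + w) f : V -> R) Z =
  a * 'D_u ('D_v f : V -> R) Z + 'D_u ('D_w f : V -> R) Z.
Proof.
move=> dv dw.
transitivity ('D_u (a \*: ('D_v f : V -> R) + ('D_w f : V -> R)) Z).
  apply: near_eq_derive; near=> x.
  have dx : differentiable f x by near: x.
  have -> : (a \*: ('D_v f : V -> R) + ('D_w f : V -> R)) x =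
    a * 'D_v f x + 'D_w f x by [].
  by rewrite !deriveE// linearP.
rewrite deriveD; [|exact/derivableZ/diff_derivable|exact: diff_derivable].
by rewrite deriveZ//; exact: diff_derivable.
Unshelve. all: by end_near. Qed.

Lemma derive2_linear_arg (u v w : V) (a : R) : differentiable ('D_u f : V -> R) Z ->
  'D_(a *: v + w) ('D_u f : V -> R) Z =
  a * 'D_v ('D_u f : V -> R) Z + 'D_w ('D_u f : V -> R) Z.
Proof. by move=> du; rewrite !deriveE// linearP. Qed.

Hypothesis fmin : \forall x \near Z, f Z <= f x.

(** At the minimum ['D_v f] vanishes, so on the line it equals L s + o(s). The mean value theorem
    turns this into an expansion of [f] while using differentiability of ['D_v f] at [Z] only. *)
Lemma second_order_at_min (v : V) : differentiable ('D_v f : V -> R) Z ->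
  (f (t *: v + Z) - f Z) / t ^+ 2 @[t --> 0^'+] -->
    2^-1 * 'D_v ('D_v f : V -> R) Z.
Proof.
move=> d2; pose L : R := 'D_v ('D_v f : V -> R) Z; rewrite -/L.
pose g (t : R) := f (t *: v + Z).
have line : (t *: v + Z) @[t --> (0 : R)] --> Z.
  rewrite -[X in _ --> X](add0r Z) -[X in X + _](scale0r v).
  apply: cvgD; last exact: cvg_cst.
  by apply: cvgZr_tmp; exact: cvg_id.
have [d /= d0 dP] : exists2 d : R, 0 < d & forall t : R, `|t| < d ->
    differentiable f (t *: v + Z) /\ f Z <= g t.
  have : \forall t \near (0 : R), differentiable f (t *: v + Z) /\ f Z <= g t.
    by near=> t; split; near: t; [exact: (line _ df)|exact: (line _ fmin)].
  move=> /nbhs_normP[d d0 h]; exists d => // t td; apply: h.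
  by rewrite /= sub0r normrN.
have gd (t : R) : `|t| < d -> is_derive t 1 g ('D_v f (t *: v + Z)).
  by move=> /dP[h _]; apply: is_derive_line; exact: diff_derivable.
have g'0 : 'D_v f Z = 0.
  have := @derive1_at_min R g (- d) d 0.
  have /gd : `|0 : R| < d by rewrite normr0.
  rewrite scale0r add0r => h0 h.
  have {}h : is_derive (0 : R) 1 g 0.
    apply: h; rewrite ?in_itv /= ?oppr_lt0 ?d0//; first lra.
      move=> t; rewrite in_itv /= -ltr_norml => td.
      exact: (@ex_derive _ _ _ _ _ _ _ (gd _ td)).
    move=> t; rewrite in_itv /= -ltr_norml => /dP[_].
    by rewrite {2}/g scale0r add0r.
  by rewrite -(@derive_val _ _ _ _ _ _ _ h0) (@derive_val _ _ _ _ _ _ _ h).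
have L2 : h^-1 *: ('D_v f (h *: v + Z) - 'D_v f Z) @[h --> 0^'] --> L.
  exact: (diff_derivable d2).
apply/cvgrPdist_le => e e0.
have [d' d'0 d'P] : exists2 d' : R, 0 < d' & forall t : R, 0 < t < d' ->
    `|'D_v f (t *: v + Z) - L * t| <= e * t.
  move/cvgrPdist_le : L2 => /(_ _ e0) /nbhs_ballP[d' d'0 h]; exists d' => // t /andP[t0 td'].
  have := h t; rewrite /ball /= sub0r normrN gtr0_norm// => /(_ td').
  rewrite gt_eqF// => /(_ isT); rewrite g'0 subr0 -[_ *: _]/(_ * _) => ht.
  have -> : 'D_v f (t *: v + Z) - L * t = - (L - t^-1 * 'D_v f (t *: v + Z)) * t.
    by field; exact: lt0r_neq0.
  by rewrite normrM normrN (gtr0_norm t0) ler_wpM2r// ltW.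
near=> t.
have t0 : 0 < t by near: t; exact: nbhs_right_gt.
have td : t < d by near: t; exact: nbhs_right_lt.
have td' : t < d' by near: t; exact: nbhs_right_lt.
(* With the quadratic part removed, the derivative of [k] is at most e t in absolute value on ]0,
   t[, so [k] varies by at most e t^2. *)
pose k (s : R) := g s - 2^-1 * L * s ^+ 2.
have kd (s : R) : `|s| < d -> is_derive s 1 k ('D_v f (s *: v + Z) - L * s).
  move=> sd; have gs := gd s sd.
  apply: is_derive_eq.
  by rewrite /GRing.scale /=; field.
have cont : {within `[0, t], continuous k}.
  apply: derivable_within_continuous => s; rewrite in_itv /= => /andP[s0 st].
  by apply: (@ex_derive _ _ _ _ _ _ _ (kd s _)); rewrite ger0_norm// (le_lt_trans st).
have [s s0t|c] := @MVT R k (fun s => 'D_v f (s *: v + Z) - L * s) 0 t t0 _ cont.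
  by apply: kd; move: s0t; rewrite in_itv /= => /andP[s0 st]; rewrite gtr0_norm// (lt_trans st).
rewrite in_itv /= => /andP[c0 ct] kE.
have cd' : `|'D_v f (c *: v + Z) - L * c| <= e * t.
  apply: le_trans (d'P c _) _; first by rewrite c0 (lt_trans ct).
  by rewrite ler_pM2l// ltW.
have -> : 2^-1 * L - (f (t *: v + Z) - f Z) / t ^+ 2 = - (k t - k 0) / t ^+ 2.
  rewrite /k /g scale0r add0r; field; exact: lt0r_neq0.
rewrite kE subr0 normrM normrN normrM normfV (gtr0_norm t0) normrX (gtr0_norm t0).
rewrite ler_pdivrMr ?exprn_gt0// expr2 mulrA ler_wpM2r// ltW//.
Unshelve. all: by end_near. Qed.
End second_derivative.

(** Definiteness makes the Gram matrix invertible, and the representative solves the resulting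
    linear system. *)
Lemma bilinear_representation (R : realType) (m : nat) (b : 'rV[R]_m -> 'rV[R]_m -> R)
    (phi : 'rV[R]_m -> R) :
  (forall a x y w, b (a *: x + y) w = a * b x w + b y w) ->
  (forall a x y w, b w (a *: x + y) = a * b w x + b w y) ->
  (forall x, b x x = 0 -> x = 0) ->
  (forall a x y, phi (a *: x + y) = a * phi x + phi y) ->
  exists x, forall y, b x y = phi y.
Proof.
move=> bl br b0 phil.
have lin0 (h : 'rV[R]_m -> R) : (forall a x y, h (a *: x + y) = a * h x + h y) -> h 0 = 0.
  by move=> hl; have := hl 1 0 0; rewrite scale1r addr0; lra.
have lin_sum (h : 'rV[R]_m -> R) : (forall a x y, h (a *: x + y) = a * h x + h y) ->
    forall y, h y = \sum_j y 0 j * h (delta_mx 0 j).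
  move=> hl y; rewrite {1}(row_sum_delta y).
  elim: (index_enum _) => [|j s IH]; first by rewrite !big_nil (lin0 _ hl).
  by rewrite !big_cons hl IH.
pose G := \matrix_(i, j) b (delta_mx 0 i) (delta_mx 0 j).
have bE x y : b x y = \sum_j (x *m G) 0 j * y 0 j.
  rewrite (lin_sum (b x)) => [|*]; last exact: br.
  apply: eq_bigr => j _; rewrite mulrC; congr (_ * _).
  rewrite (lin_sum (fun x => b x _)) => [|*]; last exact: bl.
  by rewrite mxE; apply: eq_bigr => i _; rewrite mxE.
have Gu : G \in unitmx.
  rewrite -row_free_unit; apply: inj_row_free => x xG; apply: b0.
  by rewrite bE xG big1// => j _; rewrite mxE mul0r.
exists ((\row_j phi (delta_mx 0 j)) *m invmx G) => y.
rewrite bE mulmxKV// (lin_sum phi)//; apply: eq_bigr => j _.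
by rewrite mxE mulrC.
Qed.

Section quadratic.
Variables (R : realType) (n : nat) (B : 'M[R]_n.+1 -> 'M[R]_n.+1 -> R).
Hypothesis Bl : forall a x y w, B (a *: x + y) w = a * B x w + B y w.
Hypothesis Br : forall a x y w, B w (a *: x + y) = a * B w x + B w y.
Hypothesis Bpos : forall F, F^T = F -> F != 0 -> 0 < B F F.

(* F1 is a multiple of the Riesz representative of G |-> G 0 0. *)
Lemma constrained_minimum : exists alpha F1, [/\ 0 < alpha,
  F1^T = F1, F1 ord0 ord0 = 1, B F1 F1 = alpha &
  forall G, G^T = G -> B G G = alpha * G ord0 ord0 ^+ 2 +
    B (G - G ord0 ord0 *: F1) (G - G ord0 ord0 *: F1)].
Proof.
pose S (X : 'M[R]_n.+1) := 2^-1 *: (X + X^T).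
have ST X : (S X)^T = S X by rewrite /S linearZ linearD /= trmxK addrC.
have Sid X : X^T = X -> S X = X.
  by move=> XT; rewrite /S XT; apply/matrixP => i j; rewrite !mxE; lra.
have SlinR a X Y : S (a *: X + Y) = a *: S X + S Y.
  by apply/matrixP => i j; rewrite !mxE; field.
(* [B] is known to be positive on symmetric matrices only, and it need not be a symmetric form. [B2]
   symmetrises it, and [K], which sees only skew parts, makes [b] definite on all matrices without
   affecting products with symmetric ones. *)
pose K (X Y : 'M[R]_n.+1) := \sum_i \sum_j (X i j - X j i) * (Y i j - Y j i).
pose B2 X Y := 2^-1 * (B X Y + B Y X).
pose b (x y : 'rV[R]_(n.+1 * n.+1)) := B2 (S (vec_mx x)) (S (vec_mx y)) + K (vec_mx x) (vec_mx y).
have KC X Y : K X Y = K Y X.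
  by apply: eq_bigr => i _; apply: eq_bigr => j _; rewrite mulrC.
have Klin a X Y W : K (a *: X + Y) W = a * K X W + K Y W.
  rewrite /K mulr_sumr -big_split; apply: eq_bigr => i _.
  rewrite mulr_sumr -big_split; apply: eq_bigr => j _ /=.
  by rewrite !mxE; ring.
have B2C X Y : B2 X Y = B2 Y X by rewrite /B2 addrC.
have B2lin a X Y W : B2 (a *: X + Y) W = a * B2 X W + B2 Y W.
  by rewrite /B2 Bl Br; ring.
have bC x y : b x y = b y x by rewrite /b B2C KC.
have blin a x y w : b (a *: x + y) w = a * b x w + b y w.
  by rewrite /b !linearP /= SlinR B2lin Klin; ring.
have B20l Y : B2 0 Y = 0 by have := B2lin 1 0 0 Y; rewrite scale1r addr0; lra.
have B20 X : B2 X X = B X X by rewrite /B2; lra.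
have Bge0 X : X^T = X -> 0 <= B X X.
  move=> XT; have [->|X0] := eqVneq X 0; last exact/ltW/Bpos.
  by have := Bl 1 0 0 0; rewrite scale1r addr0; lra.
have K0 X : 0 <= K X X.
  by apply: sumr_ge0 => i _; apply: sumr_ge0 => j _; rewrite -expr2 sqr_ge0.
have b0 x : b x x = 0 -> x = 0.
  rewrite /b B20 => /eqP; rewrite paddr_eq0 ?Bge0// => /andP[S0 /eqP KX].
  have XT : (vec_mx x)^T = vec_mx x.
    apply/matrixP => j i; rewrite mxE; apply/eqP; rewrite -subr_eq0 -sqrf_eq0 expr2.
    move/eqP: KX; rewrite psumr_eq0 => [/allP/(_ i)|k _]; last first.
      by apply: sumr_ge0 => l _; rewrite -expr2 sqr_ge0.
    rewrite mem_index_enum psumr_eq0 => [/(_ isT)/allP/(_ j)|k _]; last first.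
      by rewrite -expr2 sqr_ge0.
    by rewrite mem_index_enum => /(_ isT).
  rewrite Sid// in S0; apply/eqP; rewrite -[x]vec_mxK.
  apply: contraTT S0 => x0; rewrite gt_eqF// Bpos//.
  by apply: contra x0 => /eqP ->; rewrite linear0.
have phil a (x y : 'rV[R]_(n.+1 * n.+1)) : (vec_mx (a *: x + y) : 'M[R]_n.+1) ord0 ord0 =
    a * (vec_mx x : 'M[R]_n.+1) ord0 ord0 + (vec_mx y : 'M[R]_n.+1) ord0 ord0.
  by rewrite linearP !mxE.
have brin a x y w : b w (a *: x + y) = a * b w x + b w y by rewrite !(bC w) blin.
have [x xP] := @bilinear_representation R _ b (fun y => (vec_mx y : 'M[R]_n.+1) ord0 ord0)
  blin brin b0 phil.
pose F := S (vec_mx x).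
have FP H : H^T = H -> B2 F H = H ord0 ord0.
  move=> HT; have := xP (mxvec H); rewrite /b mxvecK (Sid H HT) => <-.
  rewrite /K (eq_bigr (fun=> 0)) ?big1_eq ?addr0// => i _; apply: big1 => j _.
  by have /matrixP/(_ j i) := HT; rewrite mxE => ->; rewrite subrr mulr0.
have F0 : F != 0.
  apply/eqP => F0; have := FP (delta_mx ord0 ord0).
  rewrite trmx_delta mxE !eqxx => /(_ erefl) /eqP; rewrite F0 B20l.
  by rewrite eq_sym oner_eq0.
have Fpos := Bpos (ST _) F0.
have FF : B F F = F ord0 ord0 by rewrite -B20 FP// ST.
set f := F ord0 ord0 in FF; have f0 : 0 < f by rewrite -FF.
have B2Zl a X Y : B2 (a *: X) Y = a * B2 X Y.
  by have := B2lin a X 0 Y; rewrite addr0 B20l addr0.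
exists f^-1, (f^-1 *: F); split.
- by rewrite invr_gt0.
- by rewrite linearZ /= ST.
- by rewrite mxE mulVf// gt_eqF.
- by rewrite -B20 B2Zl B2C B2Zl B20 FF mulVf ?mulr1// gt_eqF.
move=> G GT; set r := G ord0 ord0; rewrite scalerA; set c := r / f.
have -> : G - c *: F = (- c) *: F + G by rewrite scaleNr addrC.
have GF : B2 G F = r by rewrite B2C FP.
have lin Y : B2 (- c *: F + G) Y = - c * B2 F Y + B2 G Y by exact: B2lin.
have E : B2 (- c *: F + G) (- c *: F + G) = c ^+ 2 * f - 2 * c * r + B2 G G.
  rewrite lin (B2C F (- c *: F + G)) (B2C G (- c *: F + G)) !lin (B2C F G) GF (B20 F) FF.
  by ring.
rewrite -!B20 E.
by rewrite /c; field; exact: lt0r_neq0.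
Qed.
End quadratic.

Section strain.
Variables (R : realType) (n : nat) (A : 'M[R]_n.+1).
Variables (z : 'I_(2 ^ n.+1) -> 'cV[R]_n.+1) (W : 'M[R]_(n.+1, 2 ^ n.+1) -> \bar R).
Hypotheses (Au : A \in unitmx) (zA : corner_enum A z).
Hypotheses (W0 : forall G, (0 <= W G)%E) (Wz : zero_set_rigid z W).
Hypotheses (Ws : smooth_near_rotations z W) (Wq : Qcell_positive z W).

(** Differences of corners eliminate the translation and contain the columns of the invertible
    matrix [A]. *)
Lemma mulmx_corner_inj (F H : 'M[R]_n.+1) (c : 'cV[R]_n.+1) :
  F *m corner_mx z = H *m corner_mx z + shift_mx c -> F = H.
Proof.
move=> FH; rewrite -(mulmxK Au F) -(mulmxK Au H); congr (_ *m _).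
have colz (X : 'M[R]_n.+1) s : col s (X *m corner_mx z) = X *m z s.
  rewrite colE -mulmxA -colE; congr (_ *m _).
  by apply/colP => i; rewrite !mxE.
have Fz s : F *m z s = H *m z s + c.
  rewrite -!colz FH; apply/colP => i; by rewrite !mxE.
apply/trmx_inj/row_matrixP => j; rewrite -!tr_col; congr _^T.
have [s [t st]] := corner_add_col Au zA j.
have cE (X : 'M[R]_n.+1) : col j (X *m A) = X *m (z s - z t).
  by rewrite st !colE mulmxA.
by rewrite !cE !mulmxBr !Fz opprD addrACA subrr addr0.
Qed.

Lemma W_corner : W (corner_mx z) = 0%E.
Proof.
apply/Wz; exists 1%:M, 0; split; first by split; rewrite ?trmx1 ?mulmx1 ?det1.
by rewrite mul1mx; apply/matrixP => i j; rewrite !mxE addr0.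
Qed.

Lemma SObar_corner : SObar z (corner_mx z).
Proof.
by exists 1%:M; rewrite ?mul1mx//; split; rewrite ?trmx1 ?mulmx1 ?det1.
Qed.

Lemma near_corner : \forall G \near corner_mx z,
  differentiable (fine \o W) G /\ W G \is a fin_num.
Proof.
have [U [oU UZ Wf C2]] := Ws; have UU := UZ _ SObar_corner.
near=> G; have UG : U G by near: G; exact: open_nbhs_nbhs.
by split; [have [] := C2 _ UG|exact: Wf].
Unshelve. all: by end_near. Qed.

(** W is nonnegative and vanishes at [corner_mx z], which is therefore a minimum, so the expansion
    has no linear term. *)
Lemma W_second_order (F : 'M[R]_n.+1) :
  fine (W (t *: (F *m corner_mx z) + corner_mx z)) / t ^+ 2 @[t --> 0^'+] -->
  2^-1 * Qcell z W (F *m corner_mx z).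
Proof.
have [U [oU UZ Wf C2]] := Ws; have UU := UZ _ SObar_corner.
have <- : (fun t : R => ((fine \o W) (t *: (F *m corner_mx z) + corner_mx z) -
    (fine \o W) (corner_mx z)) / t ^+ 2) =
    (fun t => fine (W (t *: (F *m corner_mx z) + corner_mx z)) / t ^+ 2).
  by apply/funext => t; rewrite /= W_corner subr0.
apply: second_order_at_min.
- by apply: filterS near_corner => G [].
- by apply: (@nearW _ (nbhs (corner_mx z))) => G; rewrite /= W_corner fine_ge0.
- by have [_ + _] := C2 _ UU; exact.
Qed.

(** [alphaA] and [Fbar] are chosen by [xget], so uniqueness is what identifies them. Two candidates
    for [alphaA] are minima of one set at r = 1; a candidate for [Fbar] leaves no remainder in the
    completed square, and the form is definite on symmetric matrices. The optimal strain is linear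
    in r. *)
Lemma exists_optimal_strain : exists alpha F1, [/\ 0 < alpha,
  Qcell z W (F1 *m corner_mx z) = alpha, alphaA z W = alpha & forall r, Fbar z W r = r *: F1].
Proof.
have [U [oU UZ Wf C2]] := Ws; have UU := UZ _ SObar_corner.
have ndiff : \forall G \near corner_mx z, differentiable (fine \o W) G.
  by apply: filterS near_corner => G [].
have d2 v : differentiable ('D_v (fine \o W) : _ -> R) (corner_mx z).
  by have [_ + _] := C2 _ UU; exact.
pose B (X Y : 'M[R]_n.+1) : R :=
  'D_(X *m corner_mx z) ('D_(Y *m corner_mx z) (fine \o W) : _ -> R) (corner_mx z).
have QB F : Qcell z W (F *m corner_mx z) = B F F by [].
have [|||alpha [F1 [a0 F1T F10 F1a Bmin]]] := @constrained_minimum R n B.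
- by move=> a x y w; rewrite /B mulmxDl -scalemxAl derive2_linear_arg.
- by move=> a x y w; rewrite /B mulmxDl -scalemxAl derive2_linear_dir.
(* If F Z is infinitesimally rigid, then F is skew; being symmetric as well, it is zero. *)
- move=> F FT F0; rewrite -QB; apply: Wq => -[H [c [HH]]] /mulmx_corner_inj FH.
  case/negP: F0; apply/eqP/matrixP => i j; rewrite mxE.
  move/matrixP/(_ i j): HH; rewrite -FH !mxE.
  by move/matrixP/(_ i j) : FT; rewrite mxE => ->; lra.
have Bpos G : G^T = G -> G != 0 -> 0 < B G G.
  move=> GT G0; rewrite -QB; apply: Wq => -[H [c [HH]]] /mulmx_corner_inj FH.
  case/negP: G0; apply/eqP/matrixP => i j; rewrite mxE.
  move/matrixP/(_ i j): HH; rewrite -FH !mxE.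
  by move/matrixP/(_ i j) : GT; rewrite mxE => ->; lra.
have B00 : B 0 0 = 0.
  by rewrite /B mul0mx derive0.
have Bge0 G : G^T = G -> 0 <= B G G.
  by move=> GT; have [->|G0] := eqVneq G 0; [rewrite B00|exact/ltW/Bpos].
have F1Z r : B (r *: F1) (r *: F1) = alpha * r ^+ 2.
  have := Bmin (r *: F1); rewrite linearZ /= F1T => /(_ erefl).
  by rewrite mxE F10 mulr1 subrr B00 addr0.
have alpha_min r : is_min [set Qcell z W ((2^-1 *: (G + G^T)) *m corner_mx z) |
    G in [set G : 'M[R]_n.+1 | G ord0 ord0 = r]] (alpha * r ^+ 2).
  split.
    exists (r *: F1); rewrite /= ?mxE ?F10 ?mulr1//.
    rewrite linearZ /= F1T QB (_ : 2^-1 *: _ = r *: F1) ?F1Z//.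
    by apply/matrixP => i j; rewrite !mxE; field.
  move=> _ [G /= G0 <-]; rewrite QB.
  have GT : (2^-1 *: (G + G^T))^T = 2^-1 *: (G + G^T).
    by rewrite linearZ linearD /= trmxK addrC.
  rewrite (Bmin _ GT) !mxE G0 (_ : 2^-1 * (r + r) = r); last by field.
  rewrite lerDl Bge0// linearB /= GT; congr (_ - _).
  by rewrite linearZ /= F1T.
have aE : alphaA z W = alpha.
  rewrite /alphaA; case: xgetP => [a' _ [a'0 a'm]|/(_ alpha) h]; last by case: h; split.
  have [a'S lb] := a'm 1; have [aS lb1] := alpha_min 1.
  apply/eqP; rewrite -[a']mulr1 -[alpha]mulr1 -(expr1n R 2) eq_le.
  by rewrite lb ?lb1.
exists alpha, F1; split=> // r.
rewrite /Fbar aE; case: xgetP => [F' _ [F'T F'0]|/(_ (r *: F1)) h]; last first.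
  case: h; split; [by rewrite linearZ /= F1T|by rewrite mxE F10 mulr1|].
  by rewrite QB F1Z.
rewrite QB (Bmin _ F'T) F'0 => /eqP; rewrite addrC -subr_eq0 addrK => /eqP h.
apply/eqP; rewrite -subr_eq0; apply: contraT => /Bpos.
rewrite linearB linearZ /= F'T F1T => /(_ erefl); by rewrite h ltxx.
Qed.
End strain.

(** * Homogeneous deformations *)

Lemma closure_coord_itv (R : realType) (m : nat) (S : set 'cV[R]_m) (i : 'I_m) (a b : R) :
  (forall x, S x -> a <= x i 0 <= b) -> forall x, closure S x -> a <= x i 0 <= b.
Proof.
move=> Sab x Sx.
pose f (y : 'cV[R]_m) := y i 0.
have clf : closed (f @^-1` [set t | t \in `[a, b]]).
  apply: preimage_closed; last exact: interval_closed.
  by move=> y _; exact: coord_continuous.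
have : (f @^-1` [set t | t \in `[a, b]]) x.
  rewrite [X in X x](closure_id _).1//.
  by apply: closureS Sx => y /Sab; rewrite /f /= in_itv.
by rewrite /f /= in_itv.
Qed.

Lemma closure_Omega (R : realType) (n : nat) (l : 'I_n.+1 -> R) x :
  closure (Omega l) x -> forall i, 0 <= x i 0 <= l i.
Proof.
move=> xO i; apply: closure_coord_itv xO => y /(_ i)/andP[h1 h2].
by rewrite !ltW.
Qed.

Section cells.
Variables (R : realType) (n : nat) (A : 'M[R]_n.+1) (l : 'I_n.+1 -> R).
Hypothesis (Au : A \in unitmx).

Definition entry_sum : R := \sum_i \sum_j `|A i j|.

Lemma entry_sum_ge0 : 0 <= entry_sum.
Proof. by do 2! (apply: sumr_ge0 => ? _). Qed.

Lemma mulmx_coord_bound (t : 'cV[R]_n.+1) i :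
  (forall j, `|t j 0| <= 1) -> `|(A *m t) i 0| <= entry_sum.
Proof.
move=> t1; rewrite mxE (le_trans (ler_norm_sum _ _ _))//.
rewrite /entry_sum [leRHS](bigD1 i)//= -[leLHS]addr0 lerD//; last first.
  by do 2! (apply: sumr_ge0 => ? _).
by apply: ler_sum => j _; rewrite normrM ler_piMr.
Qed.

Definition cell_center (eps : R) (k : 'cV[int]_n.+1) : 'cV[R]_n.+1 :=
  eps *: (A *m (const_mx 2^-1 + map_mx intr k)).

Definition inner_indices (eps : R) : set 'cV[int]_n.+1 :=
  [set k | inner_cells A l eps (cell_center eps k)].

Lemma cell_center_inj eps : 0 < eps -> injective (cell_center eps).
Proof.
move=> eps0 k k' /(scalerI (lt0r_neq0 eps0))/(can_inj (mulKmx Au))/addrI/matrixP kk'.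
by apply/matrixP => i j; have := kk' i j; rewrite !mxE => /intr_inj.
Qed.

Lemma inner_cells_bij eps : 0 < eps ->
  set_bij (inner_indices eps) (inner_cells A l eps) (cell_center eps).
Proof.
move=> eps0; split=> [k//|k k' _ _ /cell_center_inj|x]; first exact.
by move=> [[k _ <-] h]; exists k => //; split=> //; exists k.
Qed.

Lemma esum_inner_cells eps (a : 'cV[R]_n.+1 -> \bar R) : 0 < eps ->
  \esum_(x in inner_cells A l eps) a x =
  \esum_(k in inner_indices eps) a (cell_center eps k).
Proof. by move=> eps0; rewrite (reindex_esum _ _ _ _ (inner_cells_bij eps0)). Qed.

Lemma inner_indices_Omega eps k : inner_indices eps k -> Omega l (cell_center eps k).
Proof.
move=> [_]; apply; apply: subset_closure; exists 0; rewrite ?mulmx0 ?scaler0 ?addr0//.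
by move=> i; rewrite mxE; apply/andP; split; lra.
Qed.

(** Together with [inner_indices_Omega] this encloses the inner cells between two lattice boxes
    whose faces differ by O(eps). *)
Lemma inner_indices_sufficient eps k : 0 < eps ->
  (forall i, entry_sum * eps < cell_center eps k i 0 < l i - entry_sum * eps) ->
  inner_indices eps k.
Proof.
move=> eps0 h; split; first by exists k.
move=> x xcl i; have /andP[h1 h2] := h i.
suff /andP[] : cell_center eps k i 0 - entry_sum * eps <= x i 0 <=
    cell_center eps k i 0 + entry_sum * eps by move=> ? ?; apply/andP; split; lra.
apply: closure_coord_itv xcl => _ [t /= t1 <-].
have -> : (cell_center eps k + eps *: (A *m t)) i 0 =
  cell_center eps k i 0 + eps * (A *m t) i 0 by rewrite mxE [X in _ + X]mxE.
have : `|(A *m t) i 0| <= entry_sum.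
  by apply: mulmx_coord_bound => j; have := t1 j; rewrite ler_norml => ?; lra.
rewrite ler_norml => /andP[? ?]; apply/andP; split; nra.
Qed.

Lemma cell_centerE eps k i : cell_center eps k i 0 =
  eps * (A *m const_mx 2^-1 : 'cV[R]_n.+1) i 0 + eps * (A *m map_mx intr k) i 0.
Proof. by rewrite /cell_center mulmxDr !mxE mulrDr. Qed.

Lemma cvg_affine (a b : R) : a + b * eps @[eps --> 0^'+] --> a.
Proof.
rewrite -[X in _ --> X]addr0 -[X in _ --> _ + X](mulr0 b).
apply: cvgD; first exact: cvg_cst.
by apply: cvgM; [exact: cvg_cst|apply: cvg_at_right_filter; exact: cvg_id].
Qed.

Lemma cnt_inner_cvg : (forall i, 0 < l i) -> 0 < \det A ->
  ((eps ^+ n.+1)%:E * cnt R (inner_indices eps))%E @[eps --> 0^'+] -->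
  (\prod_i l i / \det A)%:E.
Proof.
move=> l0 dA; pose h i := (A *m const_mx 2^-1 : 'cV[R]_n.+1) i 0.
pose lo1 (eps : R) i := 0 + - h i * eps.
pose hi1 (eps : R) i := l i + - h i * eps.
pose lo2 (eps : R) i := 0 + (entry_sum - h i) * eps.
(* The additional [eps] turns the closed upper face of the lattice box into the strict inequality
   required of an inner cell. *)
pose hi2 (eps : R) i := l i + (- h i - (entry_sum + 1)) * eps.
have U : ((eps ^+ n.+1)%:E * cnt R (lattice_box A eps (lo1 eps) (hi1 eps)))%E @[eps --> 0^'+]
    --> (\prod_i (l i - 0) / `|\det A|)%:E.
  by apply: cnt_lattice_box_cvg => // i; exact: cvg_affine.
have L : ((eps ^+ n.+1)%:E * cnt R (lattice_box A eps (lo2 eps) (hi2 eps)))%E @[eps --> 0^'+]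
    --> (\prod_i (l i - 0) / `|\det A|)%:E.
  by apply: cnt_lattice_box_cvg => // i; exact: cvg_affine.
rewrite (gtr0_norm dA) in U L.
have E : \prod_i (l i - 0) = \prod_i l i by apply: eq_bigr => i _; rewrite subr0.
rewrite E in U L.
apply: (squeeze_cvge _ L U); near=> eps.
have eps0 : 0 < eps by near: eps; exact: nbhs_right_gt.
apply/andP; split; apply: lee_wpmul2l; rewrite ?lee_fin ?exprn_ge0 ?(ltW eps0)//;
  apply: le_cnt => k kP.
  apply: inner_indices_sufficient => // i; rewrite cell_centerE -/(h i).
  by have /andP[] := kP i; rewrite /lo2 /hi2 => *; apply/andP; split; nra.
move=> i; have /(_ i) := inner_indices_Omega kP; rewrite cell_centerE -/(h i).
by rewrite /lo1 /hi1 => /andP[*]; apply/andP; split; lra.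
Unshelve. all: by end_near. Qed.
End cells.

(** The mean and the constant [p] only add equal columns, so the mean never has to be computed: W
    does not see such a shift. *)
Lemma discrete_grad_shift (R : realType) (n : nat) (z : 'I_(2 ^ n.+1) -> 'cV[R]_n.+1)
    (eps : R) y xbar (G : 'M[R]_(n.+1, 2 ^ n.+1)) p : 0 < eps ->
  (forall j, y (xbar + eps *: z j) = eps *: col j G + p) ->
  exists c, discrete_grad z eps y xbar = G + shift_mx c.
Proof.
move=> eps0 yE; rewrite /discrete_grad; set ybar := _ *: _.
exists (eps^-1 *: (p - ybar)); apply/matrixP => i j; rewrite !mxE yE !mxE.
by move: (2 ^- n.+1 * _) => s; field; exact: lt0r_neq0.
Qed.

Lemma frame_shift (R : realType) (n : nat) (W : 'M[R]_(n.+1, 2 ^ n.+1) -> \bar R) G c :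
  frame_indifferent W -> W (G + shift_mx c) = W G.
Proof.
move=> Wf; have := Wf 1%:M c G; rewrite mul1mx; apply.
by split; rewrite ?trmx1 ?mulmx1 ?det1.
Qed.

Section elastic.
Variables (R : realType) (n : nat) (A : 'M[R]_n.+1) (l : 'I_n.+1 -> R).
Variables (z : 'I_(2 ^ n.+1) -> 'cV[R]_n.+1) (W : 'M[R]_(n.+1, 2 ^ n.+1) -> \bar R).
Hypotheses (l0 : forall i, 0 < l i) (dA : 0 < \det A) (zA : corner_enum A z).
Hypotheses (W0 : forall G, (0 <= W G)%E) (Wf : frame_indifferent W).
Hypotheses (Wz : zero_set_rigid z W).
Hypotheses (Ws : smooth_near_rotations z W) (Wq : Qcell_positive z W).

(** The energy is eps^(n+1) times the number of cells, times W / eps, and W / eps is W / a_eps^2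
    times (a_eps / sqrt eps)^2. Each factor has a finite limit. *)
Lemma energy_elastic_cvg (aeps : R -> R) (a : R) :
  (forall eps, 0 < eps -> 0 < aeps eps) ->
  aeps eps / Num.sqrt eps @[eps --> 0^'+] --> a ->
  energy A l z W eps (y_el z W (aeps eps)) @[eps --> 0^'+] -->
  (\prod_i l i / \det A * (2^-1 * alphaA z W * a ^+ 2))%:E.
Proof.
move=> aeps0 aepsa.
have Au : A \in unitmx by rewrite unitmxE unitfE gt_eqF.
have [alpha [F1 [alpha0 QF1 aE FE]]] := exists_optimal_strain Au zA Ws Wq.
rewrite aE.
pose w (eps : R) := W (aeps eps *: (F1 *m corner_mx z) + corner_mx z).
have sqrt0 : Num.sqrt eps @[eps --> 0^'+] --> (0 : R).
  by apply: cvg_at_right_filter; rewrite -[X in _ --> X](sqrtr0 R); exact: sqrt_continuous.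
have aeps_cvg0 : aeps eps @[eps --> 0^'+] --> (0 : R).
  rewrite -[X in _ --> X](mulr0 a).
  apply: cvg_trans (cvgM aepsa sqrt0); apply: near_eq_cvg; near=> eps.
  have eps0 : 0 < eps by near: eps; exact: nbhs_right_gt.
  by rewrite /= divfK// gt_eqF// sqrtr_gt0.
(* The expansion of W is one-sided and divides by a_eps^2, so a_eps has to tend to 0 through
   positive values. *)
have aeps_right : aeps eps @[eps --> 0^'+] --> (0 : R)^'+.
  move=> P [d d0 dP]; suff : \forall eps \near 0^'+, P (aeps eps) by [].
  near=> eps.
  have eps0 : 0 < eps by near: eps; exact: nbhs_right_gt.
  apply: dP; last exact: aeps0.
  by near: eps; move/cvgrPdist_lt : aeps_cvg0; exact.
have wfin : \forall eps \near 0^'+, w eps \is a fin_num.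
  have cvgZ : aeps eps *: (F1 *m corner_mx z) + corner_mx z @[eps --> 0^'+] --> corner_mx z.
    rewrite -[X in _ --> X]add0r -[X in X + _](scale0r (F1 *m corner_mx z)).
    by apply: cvgD; [exact: cvgZr_tmp|exact: cvg_cst].
  have nf : \forall G \near corner_mx z, W G \is a fin_num.
    by apply: filterS (near_corner Ws) => G [].
  exact: (cvgZ _ nf).
have wlim : fine (w eps) / eps @[eps --> 0^'+] --> 2^-1 * alpha * a ^+ 2.
  have h1 := cvg_comp _ _ aeps_right (W_second_order (F := F1) W0 Wz Ws).
  have h2 : fine (w eps) / aeps eps ^+ 2 * (aeps eps / Num.sqrt eps * (aeps eps / Num.sqrt eps))
      @[eps --> 0^'+] --> 2^-1 * Qcell z W (F1 *m corner_mx z) * (a * a).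
    by apply: cvgM; [exact: h1|exact: cvgM].
  rewrite QF1 -expr2 in h2; apply: cvg_trans h2; apply: near_eq_cvg; near=> eps.
  have eps0 : 0 < eps by near: eps; exact: nbhs_right_gt.
  have ae0 := aeps0 _ eps0.
  rewrite /= -/(w eps) mulf_div -!expr2 sqr_sqrtr ?(ltW eps0)//.
  by field; rewrite !gt_eqF.
have nlim := cnt_inner_cvg Au l0 dA.
have wlimE : (fine (w eps) / eps)%:E @[eps --> 0^'+] --> (2^-1 * alpha * a ^+ 2)%:E.
  by apply: cvg_EFin => //; exact: nearW.
have H : ((eps ^+ n.+1)%:E * cnt R (inner_indices A l eps) * (fine (w eps) / eps)%:E)%E
    @[eps --> 0^'+] --> ((\prod_i l i / \det A)%:E * (2^-1 * alpha * a ^+ 2)%:E)%E.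
  by apply: cvgeM.
rewrite -EFinM in H; apply: cvg_trans H; apply: near_eq_cvg; near=> eps.
have eps0 : 0 < eps by near: eps; exact: nbhs_right_gt.
have wf : w eps \is a fin_num by near: eps.
have wE x : W (discrete_grad z eps (y_el z W (aeps eps)) x) = w eps.
  have [|c ->] := @discrete_grad_shift R n z eps (y_el z W (aeps eps)) x
     (aeps eps *: (F1 *m corner_mx z) + corner_mx z) (x + Fbar z W (aeps eps) *m x) eps0.
    move=> j; rewrite /y_el FE.
    have -> : col j (aeps eps *: (F1 *m corner_mx z) + corner_mx z) =
        aeps eps *: (F1 *m z j) + z j.
      rewrite [LHS]linearP /= !colE -mulmxA -colE.
      suff -> : col j (corner_mx z) = z j by [].
      by apply/colP => i; rewrite !mxE.
    rewrite mulmxDr -!scalemxAl -!scalemxAr scalerDr scalerA.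
    by rewrite [eps * _]mulrC -scalerA addrACA addrC [eps *: z j + _]addrC.
  exact: frame_shift.
rewrite /energy esum_inner_cells//.
have we0 : (0 <= w eps)%E by exact: W0.
have EC : ((\esum_(k in inner_indices A l eps)
      W (discrete_grad z eps (y_el z W (aeps eps)) (cell_center A eps k))) =
    (fine (w eps))%:E * cnt R (inner_indices A l eps))%E.
  rewrite /cnt ge0_esumZl ?fine_ge0//.
  by apply: eq_esum => k _; rewrite wE mule1 fineK.
rewrite EC muleA -EFinM muleAC -EFinM; congr (_%:E * _)%E.
rewrite exprSr; field; exact: lt0r_neq0.
Unshelve. all: by end_near. Qed.
End elastic.

(** * Cells cut by a hyperplane *)

Section slab.
Variables (R : realType) (n : nat) (A : 'M[R]_n.+1) (l : 'I_n.+1 -> R).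
Variables (xi nu : 'cV[R]_n.+1) (tau : 'cV[int]_n.+1) (h : 'cV[R]_n.+1) (c : R).
Hypotheses (dA : 0 < \det A) (l0 : forall i, 0 < l i).
Hypotheses (xi0 : xi ord0 0 != 0) (nuE : nu = A *m map_mx intr tau).
Let w := dot nu xi.
Hypothesis w0 : 0 < w.

Definition site (eps : R) (k : 'cV[int]_n.+1) : 'cV[R]_n.+1 :=
  eps *: (A *m map_mx intr k + h).

Definition level eps k := dot (site eps k) xi.

(* The point of the hyperplane dot x xi = c on the line through the site in
   direction nu. *)
Definition foot eps k : 'cV[R]_n.+1 := site eps k - ((level eps k - c) / w) *: nu.

(** The lateral bounds concern the foot rather than the site because translation by [tau] fixes the
    foot. The first coordinate is left free: the hyperplane is transversal to it. *)
Definition slab (m : nat) (eps : R) (lo hi : 'I_n.+1 -> R) : set 'cV[int]_n.+1 :=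
  [set k | c - m%:R * (eps * w) < level eps k <= c /\
     forall i, i != ord0 -> lo i < foot eps k i 0 <= hi i].

Lemma site_shift eps k (j : nat) :
  site eps (k - j%:Z *: tau) = site eps k - (j%:R * eps) *: nu.
Proof.
rewrite /site.
have -> : map_mx intr (k - j%:Z *: tau) = map_mx intr k - j%:R *: map_mx intr tau :> 'cV[R]_n.+1.
  by apply/colP => i; rewrite !mxE intrD intrN intrM.
rewrite mulmxBr -scalemxAr -nuE; move: (A *m _) => X.
by apply/colP => i; rewrite !mxE; ring.
Qed.

Lemma level_shift eps k (j : nat) :
  level eps (k - j%:Z *: tau) = level eps k - j%:R * (eps * w).
Proof. by rewrite /level site_shift dotBl dotZl mulrA. Qed.

Lemma foot_shift eps k (j : nat) : foot eps (k - j%:Z *: tau) = foot eps k.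
Proof.
rewrite /foot site_shift level_shift; apply/colP => i; rewrite !mxE.
by field; exact: lt0r_neq0.
Qed.

(* The thick slab is a stack of m translates of the thin one by multiples of tau. *)
Lemma cnt_slab m eps lo hi : 0 < eps ->
  cnt R (slab m eps lo hi) = (m%:R%:E * cnt R (slab 1 eps lo hi))%E.
Proof.
move=> eps0; have ew : 0 < eps * w by rewrite mulr_gt0.
have -> : (m%:R%:E * cnt R (slab 1 eps lo hi) =
    \esum_(k in slab 1 eps lo hi) \esum_(j in [set: 'I_m]) 1)%E.
  rewrite /cnt ge0_esumZl//; apply: eq_esum => k _.
  by rewrite mule1 -/(cnt R _) cnt_finType card_ord.
rewrite esum_esum//.
apply: (@cnt_bij R _ _ _ _ (fun kj : 'cV[int]_n.+1 * 'I_m => kj.1 - (kj.2 : nat)%:Z *: tau)).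
split=> [[k j] [[/andP[k1 k2] kf] _] |[k j] [k' j'] |k [/andP[k1 k2] kf]] /=.
- split; last by move=> i i0; rewrite foot_shift; exact: kf.
  have jm : (j : nat).+1%:R <= m%:R :> R by rewrite ler_nat.
  rewrite level_shift; move: k1 k2 jm; rewrite mul1r -natr1; move: (j%:R : R) (ler0n R j) => x x0.
  by move=> *; apply/andP; split; nra.
- rewrite !inE /= => -[[/andP[k1 k2] _] _] [[/andP[k'1 k'2] _] _] E.
  have := congr1 (level eps) E; rewrite !level_shift => L.
  have jj : j = j' :> nat.
    rewrite mul1r in k1 k'1.
    have a1 : (j%:R : R) < (j' : nat).+1%:R.
      by rewrite -natr1 -(ltr_pM2r ew) mulrDl mul1r; lra.
    have a2 : (j'%:R : R) < (j : nat).+1%:R.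
      by rewrite -natr1 -(ltr_pM2r ew) mulrDl mul1r; lra.
    rewrite ltr_nat ltnS in a1; rewrite ltr_nat ltnS in a2.
    by apply/eqP; rewrite eqn_leq a1.
  by congr pair; [move: E; rewrite jj => /addIr|exact: val_inj].
have x0 : 0 <= (c - level eps k) / (eps * w) by rewrite divr_ge0 ?subr_ge0// ltW.
(* [j] is the layer of [k], counted downwards from level c; adding [j] times [tau] brings [k] into
   the top layer. *)
pose j := Num.truncn ((c - level eps k) / (eps * w)).
have /andP[j1 j2] := truncn_itv x0; rewrite -/j in j1 j2.
rewrite ler_pdivlMr// in j1; rewrite ltr_pdivrMr// in j2.
have jm : (j < m)%N.
  rewrite -(ltr_nat R) -(ltr_pM2r ew); apply: le_lt_trans j1 _; lra.
exists (k + j%:Z *: tau, Ordinal jm); rewrite /= ?addrK//.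
have kE : k = (k + j%:Z *: tau) - j%:Z *: tau by rewrite addrK.
split=> //; split; last by move=> i i0; rewrite -(foot_shift eps _ j) -kE; exact: kf.
have := level_shift eps (k + j%:Z *: tau) j; rewrite -kE => L.
rewrite mul1r; rewrite -natr1 mulrDl mul1r in j2.
by apply/andP; split; lra.
Qed.

(* Its rows give, for c = 0, the level and the lateral coordinates of the foot. *)
Definition slab_mx : 'M[R]_n.+1 :=
  \matrix_(i, j) (if i == ord0 then xi j 0 else (i == j)%:R - xi j 0 * (nu i 0 / w)).

Lemma det_slab_mx : \det slab_mx = xi ord0 0.
Proof.
(* The shear along [nu] is the unit lower triangular [L]; what remains is the identity with first
   row [xi], which is upper triangular. *)
pose L : 'M[R]_n.+1 := \matrix_(i, j)
  ((i == j)%:R - (if (i != ord0) && (j == ord0) then nu i 0 / w else 0)).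
pose M : 'M[R]_n.+1 := \matrix_(i, j) (if i == ord0 then xi j 0 else (i == j)%:R).
have -> : slab_mx = L *m M.
  apply/matrixP => i j; rewrite !mxE.
  under eq_bigr do rewrite !mxE.
  have [->|i0] := eqVneq i ord0.
    rewrite (bigD1 ord0)//= ?eqxx big1 ?addr0 ?subr0 ?mul1r// => k k0.
    by rewrite eq_sym (negPf k0) subr0 mul0r.
  rewrite (bigD1 ord0)//= (negPf i0) sub0r (bigD1 i)//= ?eqxx (negPf i0) subr0 mul1r.
  rewrite big1 ?addr0 => [|k /andP[k0 ki]]; first by ring.
  by rewrite eq_sym (negPf ki) (negPf k0) subr0 mul0r.
rewrite det_mulmx det_trig; last first.
  apply/is_trig_mxP => i j ij; rewrite mxE -val_eqE ltn_eqF//=.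
  have -> : (j == ord0) = false by apply/eqP => j0; rewrite j0 in ij.
  by rewrite andbF subr0.
rewrite big1 ?mul1r => [|i _]; last first.
  rewrite mxE eqxx; case: (eqVneq i ord0) => //= _; by rewrite subr0.
rewrite -det_tr det_trig; last first.
  apply/is_trig_mxP => i j ij; rewrite !mxE.
  have -> : (j == ord0) = false by apply/eqP => j0; rewrite j0 in ij.
  by rewrite -val_eqE gtn_eqF.
rewrite (bigD1 ord0)//= !mxE ?eqxx big1 ?mulr1// => i i0.
by rewrite !mxE (negPf i0) eqxx.
Qed.

Lemma slab_mx0 x : (slab_mx *m x) ord0 0 = dot x xi.
Proof. by rewrite mxE; apply: eq_bigr => j _; rewrite mxE eqxx mulrC. Qed.

Lemma slab_mxS x i : i != ord0 -> (slab_mx *m x) i 0 = x i 0 - dot x xi * (nu i 0 / w).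
Proof.
move=> i0; rewrite mxE.
rewrite (eq_bigr (fun j => (i == j)%:R * x j 0 - x j 0 * xi j 0 * (nu i 0 / w))); last first.
  by move=> j _; rewrite mxE (negPf i0); ring.
rewrite sumrB -mulr_suml; congr (_ - _).
by rewrite (bigD1 i)//= eqxx mul1r big1 ?addr0// => j; rewrite eq_sym => /negPf ->; rewrite mul0r.
Qed.

(** About 1 / eps layers of thickness eps w give total thickness close to w. The successor keeps the
    number nonzero, as it is divided by later. *)
Definition slab_layers (eps : R) := (Num.truncn eps^-1).+1.

Lemma slab_layers_cvg : (slab_layers eps)%:R * eps @[eps --> 0^'+] --> (1 : R).
Proof.
have h1 : 1 + 1 * eps @[eps --> 0^'+] --> (1 : R) by exact: cvg_affine.
apply: (squeeze_cvgr _ (cvg_cst (1 : R)) h1); near=> eps.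
have eps0 : 0 < eps by near: eps; exact: nbhs_right_gt.
have ei0 : 0 <= eps^-1 by rewrite invr_ge0 ltW.
have /andP[j1 j2] := truncn_itv ei0.
rewrite /slab_layers; apply/andP; split.
  by rewrite -ler_pdivrMr// mul1r ltW.
by rewrite -natr1 mulrDl mul1r lerD2r -ler_pdivlMr// mul1r.
Unshelve. all: by end_near. Qed.

(** In the coordinates of [slab_mx] the thick slab is a lattice box, so its density is known.
    Dividing by the number of layers trades eps^(n+1) for eps^n. The parameters [b] and [b'] move
    the lateral faces by O(eps) without changing the limit. *)
Lemma cnt_slab_cvg (b b' : R) :
  ((eps ^+ n)%:E * cnt R (slab 1 eps (fun=> (b * eps)%R) (fun i => (l i + b' * eps)%R)))%E
    @[eps --> 0^'+] -->
  (w * (\prod_(i | i != ord0) l i) / (`|xi ord0 0| * \det A))%:E.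
Proof.
pose lo (eps : R) (i : 'I_n.+1) : R := if i == ord0
  then (c - w * ((slab_layers eps)%:R * eps)) - dot h xi * eps
  else - (c * (nu i 0 / w)) + (b - (slab_mx *m h) i 0) * eps.
pose hi (eps : R) (i : 'I_n.+1) : R := if i == ord0 then c + - dot h xi * eps
  else (l i - c * (nu i 0 / w)) + (b' - (slab_mx *m h) i 0) * eps.
pose lo0 (i : 'I_n.+1) : R := if i == ord0 then c - w else - (c * (nu i 0 / w)).
pose hi0 (i : 'I_n.+1) : R := if i == ord0 then c else l i - c * (nu i 0 / w).
have Bu : slab_mx *m A \in unitmx.
  by rewrite unitmxE det_mulmx det_slab_mx unitfE mulf_eq0 negb_or xi0 gt_eqF.
have boxE eps : 0 < eps -> slab (slab_layers eps) eps (fun=> b * eps) (fun i => l i + b' * eps) =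
    lattice_box (slab_mx *m A) eps (lo eps) (hi eps).
  move=> eps0.
  have E0 k : level eps k = eps * (slab_mx *m A *m map_mx intr k) ord0 0 + dot h xi * eps.
    by rewrite /level /site -mulmxA slab_mx0 dotZl dotDl; ring.
  have ES k i : i != ord0 -> foot eps k i 0 =
      eps * (slab_mx *m A *m map_mx intr k) i 0 + eps * (slab_mx *m h) i 0 + c * (nu i 0 / w).
    move=> i0; rewrite -mulmxA !slab_mxS// /foot /level /site.
    by move: (A *m _) => X; rewrite dotZl dotDl !mxE; ring.
  apply/seteqP; split=> k.
    move=> [/andP[k1 k2] kf] i; rewrite /lo /hi; have [->|i0] := eqVneq i ord0.
      by rewrite E0 in k1 k2; apply/andP; split; lra.
    have /andP[] := kf i i0; rewrite ES// => ? ?; by apply/andP; split; lra.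
  move=> kb; split.
    have /andP[] := kb ord0; rewrite /lo /hi eqxx E0 => ? ?; by apply/andP; split; lra.
  move=> i i0; have /andP[] := kb i; rewrite /lo /hi (negPf i0) ES// => ? ?.
  by apply/andP; split; lra.
have L : ((eps ^+ n.+1)%:E * cnt R (lattice_box (slab_mx *m A) eps (lo eps) (hi eps)))%E
    @[eps --> 0^'+] --> (\prod_i (hi0 i - lo0 i) / `|\det (slab_mx *m A)|)%:E.
  apply: cnt_lattice_box_cvg => // i; rewrite /lo0 /hi0 /lo /hi; case: eqP => _.
  - by rewrite ltrBlDr ltrDl.
  - by have := l0 i; lra.
  - rewrite -[X in _ --> X]subr0; apply: cvgB.
      rewrite -[X in _ --> _ - X]mulr1; apply: cvgB; first exact: cvg_cst.
      by apply: cvgM; [exact: cvg_cst|exact: slab_layers_cvg].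
    rewrite -[X in _ --> X](mulr0 (dot h xi)); apply: cvgM; first exact: cvg_cst.
    by apply: cvg_at_right_filter; exact: cvg_id.
  - exact: cvg_affine.
  - exact: cvg_affine.
  - exact: cvg_affine.
have PE : \prod_i (hi0 i - lo0 i) / `|\det (slab_mx *m A)| =
    w * (\prod_(i | i != ord0) l i) / (`|xi ord0 0| * \det A).
  rewrite det_mulmx det_slab_mx normrM (gtr0_norm dA) (bigD1 ord0)//=.
  rewrite /hi0 /lo0 eqxx (_ : c - (c - w) = w); last by ring.
  by congr (_ * _ / _); apply: eq_bigr => i /negPf ->; ring.
rewrite PE in L.
have Minv : ((slab_layers eps)%:R * eps)^-1%:E @[eps --> 0^'+] --> (1 : R)%:E.
  apply: cvg_EFin; first exact: nearW.
  by rewrite -[X in _ --> X]invr1; apply: cvgV; [exact: oner_neq0|exact: slab_layers_cvg].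
have H : ((((slab_layers eps)%:R * eps)^-1)%:E *
    ((eps ^+ n.+1)%:E * cnt R (lattice_box (slab_mx *m A) eps (lo eps) (hi eps))))%E
    @[eps --> 0^'+] --> (1%:E * (w * (\prod_(i | i != ord0) l i) / (`|xi ord0 0| * \det A))%:E)%E.
  by apply: cvgeM.
rewrite mul1e in H; apply: cvg_trans H; apply: near_eq_cvg; near=> eps.
have eps0 : 0 < eps by near: eps; exact: nbhs_right_gt.
rewrite /= -boxE// cnt_slab// !muleA -!EFinM; congr (_%:E * _)%E.
rewrite exprSr; field.
by rewrite gt_eqF//= pnatr_eq0.
Unshelve. all: by end_near. Qed.
End slab.

Section crossing.
Variables (R : realType) (n : nat) (A : 'M[R]_n.+1) (l : 'I_n.+1 -> R).
Variables (z : 'I_(2 ^ n.+1) -> 'cV[R]_n.+1) (xi : 'cV[R]_n.+1) (c d : R).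
Hypotheses (dA : 0 < \det A) (l0 : forall i, 0 < l i) (zA : corner_enum A z).
Hypotheses (xi0 : xi ord0 0 != 0) (d0 : 0 < d).
Hypothesis (avoid : forall x, dot x xi = c ->
  (forall i, i != ord0 -> 0 <= x i 0 <= l i) -> d <= x ord0 0 <= l ord0 - d).

Let Au : A \in unitmx. Proof. by rewrite unitmxE unitfE gt_eqF. Qed.

Lemma corner_bound s i : `|z s i 0| <= entry_sum A.
Proof.
rewrite (corner_signsK Au zA s); apply: mulmx_coord_bound => j; rewrite mxE.
by case: ifP => _; rewrite ?normrN gtr0_norm; lra.
Qed.

Lemma corner_diff_bound s t i : `|(z s - z t) i 0| <= 2 * entry_sum A.
Proof.
rewrite mxE [X in _ + X]mxE (le_trans (ler_normB _ _))//.
by have := corner_bound s i; have := corner_bound t i; lra.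
Qed.

Lemma corner_diff_int s t : exists tau, z s - z t = A *m map_mx intr tau.
Proof.
exists (\col_i (((pair_dir A z s t) i : nat)%:Z - 1)); rewrite (pair_dirE Au zA).
by congr (_ *m _); apply/colP => i; rewrite !mxE intrD intrN.
Qed.

Definition corner_level eps k s := dot (cell_center A eps k + eps *: z s) xi.

Definition crossing (eps : R) s t : set 'cV[int]_n.+1 :=
  [set k | corner_level eps k s <= c < corner_level eps k t].

(** The bond from s to t is cut exactly when corner s lies at most at level c and less than eps w
    below it, that is, in the thin slab. The foot is within O(eps) of the cell center, so the
    lateral bounds of the slab and of the box agree up to O(eps), and [avoid] takes care of the
    first coordinate. *)
Lemma crossing_inner_cvg s t :
  ((eps ^+ n)%:E * cnt R (inner_indices A l eps `&` crossing eps s t))%E @[eps --> 0^'+] -->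
  (Num.max 0 (dot (z t - z s) xi) * (\prod_(i | i != ord0) l i) / (`|xi ord0 0| * \det A))%:E.
Proof.
set nu := z t - z s; set w := dot nu xi; set K := entry_sum A.
have K0 : 0 <= K by exact: entry_sum_ge0.
have lvl eps k : corner_level eps k t = corner_level eps k s + eps * w.
  by rewrite /corner_level !dotDl !dotZl /w /nu dotBl; ring.
have [w0|w0] := leP w 0.
  rewrite mul0r mul0r; apply: cvg_near_cst; near=> eps.
  have eps0 : 0 < eps by near: eps; exact: nbhs_right_gt.
  rewrite (_ : _ `&` _ = set0) ?cnt_set0 ?mule0//; apply/seteqP; split=> k // [_].
  rewrite /crossing /= lvl => /andP[h1 h2]; have : eps * w <= 0 by rewrite pmulr_rle0.
  lra.
have [tau nuE] := corner_diff_int t s; rewrite -/nu in nuE.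
pose h := A *m const_mx 2^-1 + z s.
have siteE eps k : site A h eps k = cell_center A eps k + eps *: z s.
  rewrite /site /cell_center /h mulmxDr; move: (A *m _) (A *m _) => X Y.
  by apply/colP => i; rewrite !mxE; ring.
have lvlE eps k : level A xi h eps k = corner_level eps k s by rewrite /level siteE.
have footB eps k i : 0 < eps -> c - eps * w < corner_level eps k s <= c ->
    `|foot A xi nu h c eps k i 0 - cell_center A eps k i 0| <= 3 * K * eps.
  move=> eps0 /andP[k1 k2]; rewrite /foot siteE lvlE -/w.
  set q := (corner_level eps k s - c) / w.
  have q1 : `|q| <= eps.
    rewrite normrM normfV (gtr0_norm w0) ler_pdivrMr// ler_norml; apply/andP; split; lra.
  have gen (X Y N : 'cV[R]_n.+1) (a b : R) :
      (X + a *: Y - b *: N) i 0 - X i 0 = a * Y i 0 - b * N i 0 by rewrite !mxE; ring.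
  rewrite gen.
  rewrite (le_trans (ler_normB _ _))// (normrM eps) (normrM q) (gtr0_norm eps0).
  have b1 := corner_bound s i; have b2 := corner_diff_bound t s i; rewrite -/nu -/K in b1 b2.
  have : `|q| * `|nu i 0| <= eps * (2 * K) by rewrite ler_pM.
  have : eps * `|z s i 0| <= eps * K by rewrite ler_pM2l.
  by lra.
have lim b b' := @cnt_slab_cvg R n A l xi nu tau h c dA l0 xi0 nuE w0 b b'.
(* The foot is within 3 K eps of the center, and a margin of K eps makes a cell inner. Hence 3 K
   suffices for the outer slab and 4 K for the inner one; the rest is slack for the strict
   inequalities. *)
have U := lim (- (4 * K + 1)) (4 * K + 1); have L := lim (5 * K + 1) (- (5 * K + 1)).
apply: (squeeze_cvge _ L U); near=> eps.
have eps0 : 0 < eps by near: eps; exact: nbhs_right_gt.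
have epsd : (5 * K + 1) * eps < d.
  by rewrite mulrC -ltr_pdivlMr; [near: eps; apply: nbhs_right_lt; rewrite divr_gt0//|]; lra.
have Ke : 0 <= K * eps by rewrite mulr_ge0// ltW.
have en : (0 <= (eps ^+ n)%:E)%E by rewrite lee_fin exprn_ge0// ltW.
apply/andP; split; apply: lee_wpmul2l => //; apply: le_cnt => k.
  move=> [/andP[k1 k2] kf]; rewrite mul1r lvlE -/w in k1; rewrite lvlE in k2.
  have fB i := footB eps k i eps0; rewrite k1 k2 in fB.
  split; last by rewrite /crossing /= lvl; apply/andP; split; lra.
  have dfoot : dot (foot A xi nu h c eps k) xi = c.
    rewrite /foot dotBl dotZl -/w -[dot (site _ _ _ _) _]/(level A xi h eps k) lvlE.
    by field; exact: lt0r_neq0.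
  have lat i : i != ord0 -> 0 <= foot A xi nu h c eps k i 0 <= l i.
    by move=> i0; have /andP[h1 h2] := kf i i0; apply/andP; split; lra.
  have /andP[f1 f2] := avoid dfoot lat.
  apply: inner_indices_sufficient => // i; rewrite -/K.
  have := fB i isT; rewrite ler_norml => /andP[g1 g2].
  have [i0|i0] := eqVneq i ord0; first by rewrite i0 in g1 g2 *; apply/andP; split; lra.
  by have /andP[h1 h2] := kf i i0; apply/andP; split; lra.
move=> [kin]; rewrite /crossing /= lvl => /andP[k1 k2].
split; first by rewrite mul1r lvlE -/w k1 andbT; lra.
move=> i i0; have := footB eps k i eps0; rewrite k1 andbT => /(_ _)/ler_normlP[|g1 g2].
  by lra.
by have /andP[h1 h2] := inner_indices_Omega kin i; apply/andP; split; lra.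
Unshelve. all: by end_near. Qed.
End crossing.

(** * Energy of broken cells *)

Lemma enorm_coord (R : realType) (m : nat) (v : 'cV[R]_m) i : `|v i 0| <= enorm v.
Proof.
rewrite -sqrtr_sqr /enorm; apply: ler_wsqrtr.
rewrite /dot (bigD1 i)//= expr2 lerDl; apply: sumr_ge0 => j _.
by rewrite -expr2 sqr_ge0.
Qed.

Section broken.
Variables (R : realType) (n : nat) (A : 'M[R]_n.+1).
Variables (z : 'I_(2 ^ n.+1) -> 'cV[R]_n.+1) (W : 'M[R]_(n.+1, 2 ^ n.+1) -> \bar R).
Variables (Wsub : forall B : {set 'I_(2 ^ n.+1)}, 'M[R]_(n.+1, #|B|) -> R).
Variables (bond : 'I_(2 ^ n.+1) -> 'I_(2 ^ n.+1) -> R).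
Hypotheses (dA : 0 < \det A) (zA : corner_enum A z).
Hypotheses (Wf : frame_indifferent W) (Wz : zero_set_rigid z W).
Hypotheses (Wsub0 : forall (B : {set 'I_(2 ^ n.+1)}) (X : 'M[R]_(n.+1, #|B|)), 0 <= Wsub X).
Hypothesis bond_sym : forall s t, s != t -> bond s t = bond t s /\ 0 <= bond s t.
Hypotheses (Wsplit : splits_at_infinity W Wsub bond).
Hypotheses (Wdom : subcell_dominated z W Wsub).

Definition broken (S : {set 'I_(2 ^ n.+1)}) (p q : 'cV[R]_n.+1) : 'M[R]_(n.+1, 2 ^ n.+1) :=
  \matrix_(i, j) (z j i 0 + (if j \in S then p i 0 else q i 0)).

Lemma broken_shift (S : {set 'I_(2 ^ n.+1)}) (p q v : 'cV[R]_n.+1) :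
  broken S p q + shift_mx v = broken S (p + v) (q + v).
Proof. by apply/matrixP => i j; rewrite !mxE; case: ifP => _; rewrite addrA. Qed.

Lemma broken_separated (S : {set 'I_(2 ^ n.+1)}) (p q : 'cV[R]_n.+1) M :
  M + 2 * entry_sum A <= `|(p - q) ord0 0| -> Defs.separated (two_blocks S) (broken S p q) M.
Proof.
move=> Mpq.
have key s t : s \in S -> t \notin S ->
    M <= `|(col s (broken S p q) - col t (broken S p q)) ord0 0|.
  move=> sS tS; rewrite !mxE sS (negPf tS).
  have := corner_diff_bound dA zA s t ord0; move: Mpq; rewrite !mxE => h1 h2.
  have -> : z s ord0 0 + p ord0 0 - (z t ord0 0 + q ord0 0) =
    (p ord0 0 - q ord0 0) - - (z s ord0 0 - z t ord0 0) by ring.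
  rewrite (le_trans _ (lerB_dist _ _))// normrN; lra.
move=> B B'; rewrite !inE => /orP[] /eqP -> /orP[] /eqP ->; rewrite ?eqxx// => _ s t.
  by rewrite inE => sS tS; apply: le_trans (enorm_coord _ ord0); exact: key.
rewrite inE => sS tS; apply: le_trans (enorm_coord _ ord0).
by rewrite -normrN; have := key _ _ tS sS; rewrite !mxE opprB.
Qed.

Lemma subcell_broken (S B : {set 'I_(2 ^ n.+1)}) (p q v : 'cV[R]_n.+1) :
  (forall j, j \in B -> (if j \in S then p else q) = v) ->
  subcell (broken S p q) B = subcell (corner_mx z + shift_mx v) B.
Proof.
move=> h; apply/matrixP => i j; rewrite !mxE; congr (_ + _).
have := h (enum_val j) (enum_valP j).
by case: ifP => _ ->.
Qed.

Definition fragment (B : {set 'I_(2 ^ n.+1)}) (v : 'cV[R]_n.+1) : R :=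
  Wsub (subcell (corner_mx z + shift_mx v) B).

Lemma sum_fragments (S : {set 'I_(2 ^ n.+1)}) s0 (p q : 'cV[R]_n.+1) : s0 \in S ->
  \sum_(B in two_blocks S) Wsub (subcell (broken S p q) B) =
  fragment S p + fragment (~: S)%SET q.
Proof.
move=> s0S; have SS : (S != ~: S)%SET.
  by apply/eqP => /setP/(_ s0); rewrite inE s0S.
rewrite /two_blocks big_setU1 ?inE//= finset.big_set1; congr (_ + _);
  rewrite /fragment; congr (Wsub _); apply: subcell_broken => j; first by move=> ->.
by rewrite inE => /negPf ->.
Qed.

(** At [corner_mx z] the fragment energy is dominated by a multiple of W, which vanishes there. *)
Lemma fragment0 (S : {set 'I_(2 ^ n.+1)}) s0 t0 : s0 \in S -> t0 \notin S -> fragment S 0 = 0.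
Proof.
move=> s0S t0S; have [C [U [C0 oU UZ dom]]] := Wdom.
have [pS _] := two_blocks_partition s0S t0S.
apply/eqP; rewrite eq_le Wsub0 andbT -lee_fin.
have -> : 0%:E = (C%:E * W (corner_mx z))%E by rewrite (W_corner Wz) mule0.
rewrite /fragment (_ : corner_mx z + shift_mx 0 = corner_mx z); last first.
  by apply/matrixP => i j; rewrite !mxE addr0.
apply: dom pS _ (UZ _ (SObar_corner z)).
by rewrite !inE eqxx.
Qed.

Lemma dist_trans (w : \bar R) (x y eta : R) :
  (`|w - x%:E| <= eta%:E)%E -> (`|w - y%:E| <= eta%:E)%E -> x <= y + 2 * eta.
Proof.
case: w => [w| |] //=; rewrite !lee_fin !ler_norml => /andP[? ?] /andP[? ?]; lra.
Qed.

(* The fragment energies inherit translation invariance from W: translating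
   both blocks leaves W unchanged, so a gain on one block would be a loss on the
   other, which positivity excludes. *)
Lemma fragment_eq0 (S : {set 'I_(2 ^ n.+1)}) s0 t0 v :
  s0 \in S -> t0 \notin S -> fragment S v = 0.
Proof.
move=> s0S t0S; have f0 := fragment0 s0S t0S.
have [pS cS] := two_blocks_partition s0S t0S.
have c1 : (1 < #|two_blocks S|)%N by rewrite cS.
have [_ split] := Wsplit pS c1.
apply/eqP; rewrite eq_le Wsub0 andbT; apply/ler_addgt0Pr => e e0; rewrite add0r.
have [M MP] := split (e / 4) (divr_gt0 e0 (ltr0n _ 4)).
pose K := entry_sum A; have K0 : 0 <= K by exact: entry_sum_ge0.
(* So long that the two blocks remain separated when the second one stands at [b] or at [b + v]. *)
pose b : 'cV[R]_n.+1 := (`|M| + 2 * K + `|v ord0 0|) *: e1 R n.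
have b0 : b ord0 0 = `|M| + 2 * K + `|v ord0 0| by rewrite !mxE !eqxx mulr1.
have MM := ler_norm M; have v0 := normr_ge0 (v ord0 0); have M0 := normr_ge0 M.
have tr (p q u : 'cV[R]_n.+1) : M + 2 * K <= `|(p - q) ord0 0| ->
    fragment S (p + u) + fragment (~: S)%SET (q + u) <=
    fragment S p + fragment (~: S)%SET q + e / 2.
  move=> sep.
  have sep' : M + 2 * K <= `|((p + u) - (q + u)) ord0 0|.
    by rewrite opprD addrACA subrr addr0.
  have h1 := MP _ (broken_separated sep); have h2 := MP _ (broken_separated sep').
  rewrite -broken_shift (frame_shift _ _ Wf) broken_shift in h2.
  rewrite (sum_fragments _ _ s0S) in h1; rewrite (sum_fragments _ _ s0S) in h2.
  by have := dist_trans h2 h1; lra.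
(* The translations by [v] and by [- v] lead back to the start. Added up, the energies of the
   complement cancel, and fragment S v + fragment S (- v) <= e remains. *)
have h1 : fragment S v + fragment (~: S)%SET (b + v) <= fragment (~: S)%SET b + e / 2.
  have sep : M + 2 * K <= `|(0 - b) ord0 0| by rewrite sub0r mxE b0 normrN ger0_norm; lra.
  by have := tr 0 b v sep; rewrite (add0r v) f0 (add0r (fragment _ b)).
have h2 : fragment S (- v) + fragment (~: S)%SET b <= fragment (~: S)%SET (b + v) + e / 2.
  have sep : M + 2 * K <= `|(0 - (b + v)) ord0 0|.
    rewrite sub0r mxE normrN mxE b0; have := ler_norm (- v ord0 0); rewrite normrN => ?.
    by rewrite ger0_norm; lra.
  have := tr 0 (b + v) (- v) sep.
  by rewrite (add0r (- v)) f0 (add0r (fragment _ (b + v))) addrK.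
have h3 : 0 <= fragment S (- v) by exact: Wsub0.
by lra.
Qed.

(** The tolerance in the splitting of W may be [eta] times [cross_bonds], which is positive; this
    makes the error relative. A single [M] serves all [S] because there are finitely many. *)
Lemma broken_energy_close (eta : R) : 0 < eta -> exists M : R,
  forall (S : {set 'I_(2 ^ n.+1)}) s0 t0 (p q : 'cV[R]_n.+1), s0 \in S -> t0 \notin S ->
  M <= `|(p - q) ord0 0| ->
  (((1 - eta) * cross_bonds bond (two_blocks S))%:E <= W (broken S p q) <=
   ((1 + eta) * cross_bonds bond (two_blocks S))%:E)%E.
Proof.
move=> eta0.
have each (S : {set 'I_(2 ^ n.+1)}) : exists M : R,
    forall s0 t0 (p q : 'cV[R]_n.+1), s0 \in S -> t0 \notin S -> M <= `|(p - q) ord0 0| ->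
  (((1 - eta) * cross_bonds bond (two_blocks S))%:E <= W (broken S p q) <=
   ((1 + eta) * cross_bonds bond (two_blocks S))%:E)%E.
  have [[s1 [t1 [s1S t1S]]]|triv] := pselect (exists s t, s \in S /\ t \notin S); last first.
    by exists 0 => s0 t0 p q s0S t0S; case: triv; exists s0, t0.
  have [pS cS] := two_blocks_partition s1S t1S.
  have c1 : (1 < #|two_blocks S|)%N by rewrite cS.
  have [cr0 split] := Wsplit pS c1.
  have [M MP] := split _ (mulr_gt0 eta0 cr0).
  exists (M + 2 * entry_sum A) => s0 t0 p q s0S t0S sep.
  have := MP _ (broken_separated sep).
  rewrite (sum_fragments _ _ s0S) (fragment_eq0 _ s0S t0S).
  rewrite (@fragment_eq0 (~: S)%SET t0 s0) ?inE ?negbK// !add0r.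
  case: (W _) => [w| |] //=; rewrite !lee_fin ler_norml => /andP[h1 h2].
  by apply/andP; split; lra.
have [f fP] := choice each.
exists (\sum_S `|f S|) => S s0 t0 p q s0S t0S h; apply: (fP S s0 t0) => //.
apply: le_trans h; rewrite (bigD1 S)//= (le_trans (ler_norm _))// lerDl.
by apply: sumr_ge0.
Qed.
End broken.

Lemma cvge_sum_fin (R : realType) (T : Type) (F : set_system T) {FF : Filter F}
    (I : finType) (f : I -> T -> \bar R) (a : I -> R) :
  (forall i, f i x @[x --> F] --> (a i)%:E) ->
  (\sum_i f i x)%E @[x --> F] --> (\sum_i a i)%:E.
Proof.
move=> fa; have [s sE] : exists s, s = index_enum I by eexists.
rewrite -!sE; elim: s {sE} => [|i s IH].
  by under eq_fun do rewrite big_nil; rewrite big_nil; exact: cvg_cst.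
under eq_fun do rewrite big_cons; rewrite big_cons EFinD.
by apply: cvgeD.
Qed.

(** Bounds with factors 1 - eta and 1 + eta survive summation over arbitrarily many cells; only here
    do they become a limit. *)
Lemma cvg_relative (R : realType) (T : Type) (F : set_system T) {FF : ProperFilter F}
    (e t : T -> \bar R) (L : R) : 0 <= L ->
  t x @[x --> F] --> L%:E ->
  (forall eta : R, 0 < eta < 1 -> \forall x \near F,
    ((1 - eta)%:E * t x <= e x <= (1 + eta)%:E * t x)%E) ->
  e x @[x --> F] --> L%:E.
Proof.
move=> L0 /fine_cvgP[tfin tL] et.
have eE (eta : R) : 0 < eta < 1 -> \forall x \near F, exists a b : R,
    [/\ t x = a%:E, e x = b%:E & (1 - eta) * a <= b <= (1 + eta) * a].
  move=> eta01; apply: filterS2 tfin (et _ eta01) => x; case: (t x) => [a| |]//= _.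
  case: (e x) => [b| |] /andP[]; rewrite -!EFinM ?lee_fin// => h1 h2.
  by exists a, b; split=> //; apply/andP.
apply/fine_cvgP; split.
  have h : 0 < (2^-1 : R) < 1 by apply/andP; split; lra.
  by apply: filterS (eE _ h) => x [a [b [_ -> _]]].
apply/cvgrPdist_le => d d0.
(* Eventually [t] is at most [L + 1], so this choice keeps the relative error below d / 2. *)
pose eta : R := Num.min 2^-1 (d / (2 * (L + 1))).
have L10 : 0 < 2 * (L + 1) by lra.
have eta0 : 0 < eta by rewrite lt_min divr_gt0// andbT; lra.
have eta1 : eta < 1 by rewrite gt_min; apply/orP; left; lra.
have etaL : eta * (L + 1) <= d / 2.
  have : eta <= d / (2 * (L + 1)) by rewrite ge_min lexx orbT.
  by rewrite ler_pdivlMr//; lra.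
move/cvgrPdist_le: tL => tL; have tL1 := tL 1 ltr01.
have tL2 := tL (d / 2) (divr_gt0 d0 (ltr0n _ 2)).
have eta01 : 0 < eta < 1 by rewrite eta0.
have het := eE _ eta01.
near=> x.
have [a [b [ta eb /andP[h1 h2]]]] : exists a b : R,
    [/\ t x = a%:E, e x = b%:E & (1 - eta) * a <= b <= (1 + eta) * a] by near: x.
have : `|L - (fine \o t) x| <= 1 by near: x.
have : `|L - (fine \o t) x| <= d / 2 by near: x.
rewrite /= ta eb /= !ler_norml => /andP[a1 a2] /andP[a3 a4].
have aL : a <= L + 1 by lra.
have : eta * a <= d / 2 by apply: le_trans etaL; rewrite ler_pM2l.
have : - (d / 2) <= eta * a -> True by [].
have a0 : - (d/2) <= a by lra.
have : - (d / 2) <= eta * a by nra.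
by move=> *; apply/andP; split; lra.
Unshelve. all: by end_near. Qed.

Section fracture.
Variables (R : realType) (n : nat) (A : 'M[R]_n.+1) (l : 'I_n.+1 -> R).
Variables (z : 'I_(2 ^ n.+1) -> 'cV[R]_n.+1) (W : 'M[R]_(n.+1, 2 ^ n.+1) -> \bar R).
Variables (Wsub : forall B : {set 'I_(2 ^ n.+1)}, 'M[R]_(n.+1, #|B|) -> R).
Variables (bond : 'I_(2 ^ n.+1) -> 'I_(2 ^ n.+1) -> R) (beta : 'cV[R]_n.+1 -> R).
Hypotheses (dA : 0 < \det A) (l0 : forall i, 0 < l i) (zA : corner_enum A z).
Hypothesis adm : admissible A z W Wsub bond beta.
Variables (xi : 'cV[R]_n.+1) (c d : R).
Hypotheses (xi0 : xi ord0 0 != 0) (d0 : 0 < d).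
Hypothesis (avoid : forall x, dot x xi = c ->
  (forall i, i != ord0 -> 0 <= x i 0 <= l i) -> d <= x ord0 0 <= l ord0 - d).

Let Au : A \in unitmx. Proof. by rewrite unitmxE unitfE gt_eqF. Qed.

(* The hypotheses say nothing about bond s s. *)
Definition offdiag_bond s t : R := if s == t then 0 else bond s t.

Lemma offdiag_bond_ge0 s t : 0 <= offdiag_bond s t.
Proof. by rewrite /offdiag_bond; case: eqP => // /eqP /(adm_bond adm)[]. Qed.

Lemma offdiag_bond_sym s t : offdiag_bond s t = offdiag_bond t s.
Proof.
by rewrite /offdiag_bond eq_sym; case: eqP => // /eqP /(adm_bond adm)[].
Qed.

Definition cut_energy (eps : R) : \bar R :=
  (\sum_s \sum_t (offdiag_bond s t)%:E *
    ((eps ^+ n)%:E * cnt R (inner_indices A l eps `&` crossing A z xi c eps s t)))%E.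

(** A bond is cut in one orientation only, and crossings are counted through positive parts. Since
    |x| is the sum of the positive parts of x and - x, the symmetry of the bonds absorbs the factor
    1/2. *)
Lemma surf_offdiag : surf A beta xi =
  \sum_s \sum_t offdiag_bond s t * Num.max 0 (dot (z t - z s) xi).
Proof.
rewrite (surf_pairs Au zA _ (adm_normalized adm)).
set Y := RHS.
have Y' : Y = \sum_s \sum_t offdiag_bond s t * Num.max 0 (- dot (z t - z s) xi).
  rewrite /Y exchange_big; apply: eq_bigr => s _; apply: eq_bigr => t _.
  by rewrite offdiag_bond_sym -opprB dotNl.
suff : \sum_s \sum_t 2^-1 * bond s t * `|dot (z s - z t) xi| *+ 2 = Y + Y.
  under eq_bigr do rewrite sumrMnl.
  by rewrite sumrMnl; move: (\sum_s _) => x; lra.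
rewrite {2}Y' /Y -big_split; apply: eq_bigr => s _.
rewrite -big_split; apply: eq_bigr => t _ /=.
rewrite /offdiag_bond; case: eqP => [->|_]; first by rewrite subrr dot0l normr0 !mul0r mulr0 mul0rn addr0.
rewrite -opprB dotNl normrN; move: (dot _ _) => x; move: (bond s t) => b.
rewrite -mulrDr; have -> : Num.max 0 x + Num.max 0 (- x) = `|x|.
  have [x0|x0] := lerP 0 x.
    by rewrite (@max_l _ _ 0 (- x)) ?oppr_le0// addr0 ger0_norm.
  by rewrite (@max_r _ _ 0 (- x)) ?oppr_ge0 ?ltW// add0r ltr0_norm.
by rewrite mulr2n; lra.
Qed.

Lemma cut_energy_cvg : cut_energy eps @[eps --> 0^'+] -->
  (surf A beta xi * ((\prod_(i | i != ord0) l i) / (`|xi ord0 0| * \det A)))%:E.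
Proof.
rewrite surf_offdiag mulr_suml.
apply: cvge_sum_fin => s; rewrite mulr_suml; apply: cvge_sum_fin => t.
rewrite -mulrA EFinM; apply: cvgeZl; first by [].
by rewrite mulrA; exact: (crossing_inner_cvg dA l0 zA xi0 d0 avoid).
Qed.

Definition low_side (eps : R) k : {set 'I_(2 ^ n.+1)} :=
  [set s | corner_level A z xi eps k s <= c]%SET.

(** The discrete gradient divides by [eps], so a cell sees the jump magnified to l_1 r / eps. *)
Lemma cell_energy_y_cr eps r k : 0 < eps ->
  W (discrete_grad z eps (y_cr l xi c r) (cell_center A eps k)) =
  W (broken z (low_side eps k) 0 ((l ord0 * r / eps) *: e1 R n)).
Proof.
move=> eps0.
have [|v ->] := @discrete_grad_shift R n z eps (y_cr l xi c r) (cell_center A eps k)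
    (broken z (low_side eps k) 0 ((l ord0 * r / eps) *: e1 R n)) (cell_center A eps k) eps0.
  move=> j; apply/colP => i; rewrite /y_cr -/(corner_level A z xi eps k j).
  rewrite [RHS]mxE [X in _ = X + _]mxE [X in _ = _ * X + _]mxE mxE /low_side inE.
  case: ifP => _; first by rewrite !mxE addr0 addrC.
  rewrite [LHS]mxE [X in X + _]mxE [X in _ + X + _]mxE.
  rewrite [X in _ + X = _]mxE [X in _ = _ * (_ + X) + _]mxE.
  by field; exact: lt0r_neq0.
exact: frame_shift (adm_frame adm).
Qed.

Lemma broken_trivial_energy (S : {set 'I_(2 ^ n.+1)}) p q :
  (forall s t, s \in S -> t \notin S -> False) -> W (broken z S p q) = 0%E.
Proof.
move=> triv.
have [v ->] : exists v, broken z S p q = corner_mx z + shift_mx v.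
  have [[s sS]|noS] := pselect (exists s, s \in S).
    exists p; apply/matrixP => i j; rewrite !mxE; case: ifPn => // jS.
    by case: (triv s j).
  exists q; apply/matrixP => i j; rewrite !mxE; case: ifPn => // jS.
  by case: noS; exists j.
by rewrite (frame_shift _ _ (adm_frame adm)) (W_corner (adm_zero adm)).
Qed.

Lemma cross_bonds_low_side eps k s0 t0 :
  s0 \in low_side eps k -> t0 \notin low_side eps k ->
  cross_bonds bond (two_blocks (low_side eps k)) =
  \sum_s \sum_t (if k \in crossing A z xi c eps s t then offdiag_bond s t else 0).
Proof.
move=> s0S t0S.
rewrite (cross_bonds_two_blocks s0S t0S); last by move=> s t /(adm_bond adm)[].
rewrite big_mkcond /=; apply: eq_bigr => s _.
case: ifPn => sS; last first.
  rewrite big1// => t _; case: ifPn => //; rewrite inE /crossing /= => /andP[h _].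
  by move: sS; rewrite inE h.
rewrite big_mkcond /=; apply: eq_bigr => t _; rewrite !inE.
have sl : corner_level A z xi eps k s <= c by move: sS; rewrite inE.
case: ifPn => tS; last first.
  rewrite ifF//; apply/negbTE/negP => /set_mem /andP[_ h].
  by move: tS; rewrite -ltNge h.
rewrite ifT; last by apply/mem_set; rewrite /crossing /= sl /= ltNge.
rewrite /offdiag_bond; case: eqP => // st; by move: tS; rewrite -st sl.
Qed.

Lemma crossing_trivial eps k :
  (forall s t, s \in low_side eps k -> t \notin low_side eps k -> False) ->
  \sum_s \sum_t (if k \in crossing A z xi c eps s t then offdiag_bond s t else 0) = 0.
Proof.
move=> triv; rewrite big1// => s _; rewrite big1// => t _.
case: ifPn => // /set_mem /andP[h1 h2].
by case: (triv s t); rewrite inE// -ltNge.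
Qed.

(** Exchanges the sums: the limit is taken bond by bond, the comparison with W is made cell by
    cell. *)
Lemma cut_energyE eps : 0 < eps -> cut_energy eps =
  ((eps ^+ n)%:E * \esum_(k in inner_indices A l eps)
   (\sum_s \sum_t (if k \in crossing A z xi c eps s t then offdiag_bond s t else 0))%:E)%E.
Proof.
move=> eps0; have en : 0 <= eps ^+ n by rewrite exprn_ge0// ltW.
have t0 s t k : 0 <= (if k \in crossing A z xi c eps s t then offdiag_bond s t else 0).
  by case: ifP => _; rewrite ?offdiag_bond_ge0.
have -> : (\esum_(k in inner_indices A l eps)
   (\sum_s \sum_t (if k \in crossing A z xi c eps s t then offdiag_bond s t else 0))%:E)%E =
   (\sum_s \sum_t ((offdiag_bond s t)%:E *
     cnt R (inner_indices A l eps `&` crossing A z xi c eps s t)))%E.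
  under eq_esum do rewrite -sumEFin.
  rewrite esum_sum; last by move=> k s _ _; rewrite lee_fin sumr_ge0.
  apply: eq_bigr => s _.
  under eq_esum do rewrite -sumEFin.
  rewrite esum_sum; last by move=> k t _ _; rewrite lee_fin.
  apply: eq_bigr => t _.
  rewrite /cnt ge0_esumZl ?offdiag_bond_ge0// [RHS]esum_mkcondr.
  by apply: eq_esum => k _; case: ifP; rewrite ?mule1.
rewrite ge0_sume_distrr; last first.
  by move=> s _; apply: sume_ge0 => t _; rewrite mule_ge0 ?lee_fin ?offdiag_bond_ge0 ?cnt_ge0.
apply: eq_bigr => s _; rewrite ge0_sume_distrr; last first.
  by move=> t _; rewrite mule_ge0 ?lee_fin ?offdiag_bond_ge0 ?cnt_ge0.
by apply: eq_bigr => t _; rewrite muleCA.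
Qed.

(** Holds cell by cell: cut cells obey [broken_energy_close], and for uncut cells both sides are
    zero. The threshold [M] depends on [eta] only. *)
Lemma energy_y_cr_close (eta : R) : 0 < eta < 1 -> exists M : R, forall eps r,
  0 < eps -> M <= l ord0 * r / eps ->
  ((1 - eta)%:E * cut_energy eps <= energy A l z W eps (y_cr l xi c r) <=
   (1 + eta)%:E * cut_energy eps)%E.
Proof.
move=> /andP[eta0 eta1].
have [M MP] := broken_energy_close dA zA (adm_frame adm) (adm_zero adm) (adm_sub_ge0 adm)
  (adm_split adm) (adm_dominated adm) eta0.
exists M => eps r eps0 Mr.
have en : 0 <= eps ^+ n by rewrite exprn_ge0// ltW.
rewrite /energy esum_inner_cells// cut_energyE//.
have X0 k : 0 <= \sum_s \sum_t (if k \in crossing A z xi c eps s t then offdiag_bond s t else 0).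
  by do 2! (apply: sumr_ge0 => ? _); case: ifP => _; rewrite ?offdiag_bond_ge0.
have cell k : (((1 - eta) * \sum_s \sum_t (if k \in crossing A z xi c eps s t
       then offdiag_bond s t else 0))%:E <=
    W (discrete_grad z eps (y_cr l xi c r) (cell_center A eps k)) <=
    ((1 + eta) * \sum_s \sum_t (if k \in crossing A z xi c eps s t
       then offdiag_bond s t else 0))%:E)%E.
  rewrite cell_energy_y_cr//.
  have [[s [t [sS tS]]]|triv] := pselect (exists s t, s \in low_side eps k /\ t \notin low_side eps k).
    rewrite -(cross_bonds_low_side sS tS); apply: (MP _ s t) => //.
    rewrite sub0r !mxE !eqxx mulr1 normrN; apply: le_trans Mr _; exact: ler_norm.
  have {}triv s t : s \in low_side eps k -> t \notin low_side eps k -> False.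
    by move=> sS tS; apply: triv; exists s, t.
  by rewrite broken_trivial_energy// crossing_trivial// !mulr0 lexx.
rewrite !(muleCA _ (eps ^+ n)%:E).
have lo0 : 0 <= 1 - eta by lra.
have hi0 : 0 <= 1 + eta by lra.
rewrite (ge0_esumZl _ lo0) ?(ge0_esumZl _ hi0); do ?[by move=> k; rewrite lee_fin X0].
apply/andP; split; apply: lee_wpmul2l; rewrite ?lee_fin//; apply: le_esum => k _;
  by have /andP[] := cell k; rewrite -EFinM.
Qed.

Theorem energy_y_cr_cvg (aeps : R -> R) :
  (forall M : R, \forall eps \near 0^'+, M <= l ord0 * aeps eps / eps) ->
  energy A l z W eps (y_cr l xi c (aeps eps)) @[eps --> 0^'+] -->
  (surf A beta xi * ((\prod_(i | i != ord0) l i) / (`|xi ord0 0| * \det A)))%:E.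
Proof.
move=> big; apply: cvg_relative cut_energy_cvg _.
  rewrite mulr_ge0//.
    by apply: (surf_ge0 Au zA _ (adm_normalized adm)); exact: (adm_bond adm).
  rewrite divr_ge0//; first by apply: prodr_ge0 => i _; exact: ltW.
  by rewrite mulr_ge0// ltW.
move=> eta eta01; have [M MP] := energy_y_cr_close eta01; near=> eps.
apply: MP; first by near: eps; exact: nbhs_right_gt.
by near: eps; exact: big.
Unshelve. all: by end_near. Qed.
End fracture.

(** * The limiting energies *)

Lemma near_ereal_limit_ge (R : realType) (T : Type) (F : set_system T) {FF : ProperFilter F}
    (f : T -> R) (a : \bar R) (r : R) :
  (r%:E < a)%E -> (f x)%:E @[x --> F] --> a -> \forall x \near F, r <= f x.
Proof.
case: a => [a| |]//; last by move=> _ /cvgeyPge/(_ r); apply: filterS => x; rewrite lee_fin.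
rewrite lte_fin => ra /fine_cvgP[_ /cvgrPdist_le h].
have ar : 0 < a - r by rewrite subr_gt0.
by apply: filterS (h _ ar) => x; rewrite /= ler_norml => /andP[? ?]; lra.
Qed.

(** a_eps >= r sqrt eps gives a_eps / eps >= r / sqrt eps. *)
Lemma jump_diverges (R : realType) (aeps : R -> R) (r l : R) : 0 < r -> 0 < l ->
  (\forall eps \near 0^'+, r <= aeps eps / Num.sqrt eps) ->
  forall M : R, \forall eps \near 0^'+, M <= l * aeps eps / eps.
Proof.
move=> r0 l0 big M.
have K0 : 0 < l * r / (`|M| + 1) by rewrite divr_gt0 ?mulr_gt0// ltr_wpDl.
near=> eps.
have eps0 : 0 < eps by near: eps; exact: nbhs_right_gt.
have epsK : eps < (l * r / (`|M| + 1)) ^+ 2.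
  by near: eps; apply: nbhs_right_lt; rewrite exprn_gt0.
have h : r <= aeps eps / Num.sqrt eps by near: eps.
have s0 : 0 < Num.sqrt eps by rewrite sqrtr_gt0.
have sE : Num.sqrt eps * Num.sqrt eps = eps by rewrite -expr2 sqr_sqrtr// ltW.
have sK : Num.sqrt eps * (`|M| + 1) <= l * r.
  rewrite -ler_pdivlMr ?ltr_wpDl//.
  by have := ler_wsqrtr (ltW epsK); rewrite sqrtr_sqr ger0_norm// ltW.
rewrite ler_pdivlMr// -{1}sE; move: h; rewrite ler_pdivlMr// => h.
have MM : M <= `|M| + 1 by rewrite (le_trans (ler_norm M))// lerDl.
have h1 : M * Num.sqrt eps <= l * r.
  by apply: le_trans sK; rewrite mulrC ler_pM2l.
rewrite mulrA; apply: (@le_trans _ _ (l * r * Num.sqrt eps)).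
  by rewrite ler_pM2r.
by rewrite -mulrA ler_pM2l.
Unshelve. all: by end_near. Qed.

(* K stands for M2 / M1, which bounds 1 / |xi_0| for the optimal normal. *)
Lemma central_hyperplane_offset (R : realType) (n : nat) (l : 'I_n.+1 -> R)
    (xi x : 'cV[R]_n.+1) (K : R) :
  (forall i, `|xi i 0| <= 1) -> 1 <= K * `|xi ord0 0| -> 0 <= K ->
  dot x xi = dot (\col_i (l i / 2)) xi ->
  (forall i, i != ord0 -> 0 <= x i 0 <= l i) ->
  `|x ord0 0 - l ord0 / 2| <= n%:R * (\big[Num.max/0]_(j | j != ord0) l j) * K / 2.
Proof.
move=> xi1 K1 K0 xc xl; set mx := \big[_/_]_(_ | _) _.
have mx0 : 0 <= mx by rewrite /mx; elim/big_rec: _ => // i y _ y0; rewrite le_max y0 orbT.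
have lat : `|x ord0 0 - l ord0 / 2| * `|xi ord0 0| <= n%:R * mx / 2.
  (* Measured from the center, the first term of the scalar product is balanced by n lateral terms,
     each of size at most max l_j / 2. *)
  have : dot (x - \col_i (l i / 2)) xi = 0 by rewrite dotBl xc subrr.
  rewrite /dot (bigD1 ord0)//= !mxE => /eqP; rewrite addr_eq0 => /eqP xE.
  rewrite -normrM xE normrN (le_trans (ler_norm_sum _ _ _))//.
  apply: (@le_trans _ _ (\sum_(i < n.+1 | i != ord0) mx / 2)).
    apply: ler_sum => i i0; rewrite !mxE normrM.
    have li : l i <= mx by exact: le_bigmax_cond.
    rewrite -[leRHS]mulr1; apply: ler_pM => //.
    have /andP[h1 h2] := xl i i0.
    by rewrite ler_norml; apply/andP; split; lra.
  by rewrite sumr_const cardC1 card_ord -[_ / 2 *+ _]mulr_natl mulrA.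
have h := ler_wpM2r K0 lat.
apply: (@le_trans _ _ (`|x ord0 0 - l ord0 / 2| * (K * `|xi ord0 0|))).
  by rewrite ler_peMr.
by rewrite mulrCA mulrC; lra.
Qed.

Theorem mainTheorem2 (R : realType) (n : nat) (hd : (2 <= n.+1)%N) :
  exists C0 : R, 0 < C0 /\ forall Cstar : R, C0 <= Cstar ->
  forall (l : 'I_n.+1 -> R) (A : 'M[R]_n.+1)
    (z : 'I_(2 ^ n.+1) -> 'cV[R]_n.+1)
    (W : 'M[R]_(n.+1, 2 ^ n.+1) -> \bar R)
    (Wsub : forall B : {set 'I_(2 ^ n.+1)}, 'M[R]_(n.+1, #|B|) -> R)
    (bond : 'I_(2 ^ n.+1) -> 'I_(2 ^ n.+1) -> R)
    (beta : 'cV[R]_n.+1 -> R)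
    (aeps : R -> R) (a : \bar R),
  (forall j, 0 < l j) ->
  0 < \det A ->
  corner_enum A z ->
  admissible A z W Wsub bond beta ->
  Lmin A l beta Cstar <= l ord0 ->
  (forall eps, 0 < eps -> 0 < aeps eps) ->
  (0 <= a)%E ->
  (aeps eps / Num.sqrt eps)%:E @[eps --> 0^'+] --> a ->
  ((a <= (acrit A l z W beta)%:E)%E ->
    energy A l z W eps (y_el z W (aeps eps)) @[eps --> 0^'+]
      --> Elim A l z W beta a) /\
  (((acrit A l z W beta)%:E <= a)%E ->
    exists (xi : 'cV[R]_n.+1) (c : R),
      [/\ crystallographic A xi,
          \forall eps \near 0^'+,
            hyperplane xi c `&` closure (Omega l) `<=`
            closure (Omega l) `\` (strip1 A l eps `|` strip2 A l eps) &
          energy A l z W eps (y_cr l xi c (aeps eps)) @[eps --> 0^'+]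
            --> Elim A l z W beta a]).
Proof.
(* The offset from the center is at most n max l_j K / 2. The constant n + 1 instead of n makes the
   resulting clearance strict, and [l0] covers the case in which the product of max l_j and K
   vanishes. *)
exists n.+1%:R; split=> [|Cstar hC l A z W Wsub bond beta aeps a l0 dA zA adm lmin ap a0 ha];
  first by rewrite ltr0n.
have Au : A \in unitmx by rewrite unitmxE unitfE gt_eqF.
have bs := adm_bond adm; have bn := adm_normalized adm.
have cr P (pP : corner_partition P) (cP : (1 < #|P|)%N) := (adm_split adm pP cP).1.
have [xm [xmin vertex]] := exists_vertex_minimizer Au zA bs bn cr.
have b0 : 0 < betaA A beta by exact: (betaA_gt0 Au zA bs bn cr xmin).
have [alpha [F1 [al0 _ alE _]]] :=
  exists_optimal_strain Au zA (adm_C2 adm) (adm_Qcell adm).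
have la0 : 0 < l ord0 * alphaA z W by rewrite alE mulr_gt0.
have ac0 : 0 < acrit A l z W beta by rewrite sqrtr_gt0 divr_gt0// mulr_gt0.
have acE : 2^-1 * l ord0 * alphaA z W * acrit A l z W beta ^+ 2 = betaA A beta.
  rewrite /acrit sqr_sqrtr; last by rewrite ltW// divr_gt0// mulr_gt0.
  by rewrite alE; field; rewrite !lt0r_neq0.
have hla0 : 0 < 2^-1 * l ord0 * alphaA z W by rewrite -mulrA mulr_gt0// invr_gt0.
split.
  case: a a0 ha => [a| |]// a0 ha ac; rewrite !lee_fin in a0 ac.
  have /fine_cvgP[_ ha'] := ha.
  have := energy_elastic_cvg l0 dA zA (adm_ge0 adm) (adm_frame adm) (adm_zero adm)
    (adm_C2 adm) (adm_Qcell adm) ap ha'.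
  congr (_ --> _); rewrite /Elim -!EFinM -EFin_min -EFinM; congr (_%:E).
  (* By [acE] the two energies agree at [acrit], and the elastic one is increasing in a. *)
  rewrite min_l; last first.
    by rewrite -acE ler_pM2l// -expr2 ler_sqr ?nnegrE// ltW.
  by rewrite (bigD1 ord0)//=; field; exact: lt0r_neq0.
move=> aca.
have xm0 : xm != 0.
  by apply/eqP => xm0; have := xmin.1; rewrite xm0 mxE => /esym/eqP; rewrite oner_eq0.
set cn := (Num.sqrt (dot xm xm))^-1.
have cn0 : 0 < cn.
  by rewrite invr_gt0 sqrtr_gt0 lt0r dot_eq0 xm0 dot_ge0.
have xiS : usphere (cn *: xm) by exact: usphere_normalize.
have xiE : (cn *: xm) ord0 0 = cn by rewrite mxE xmin.1 mulr1.
set xi := cn *: xm in xiS xiE *.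
have surfxi : surf A beta xi = cn * betaA A beta.
  by rewrite /xi (surfZ Au zA bn) gtr0_norm// (betaA_eq xmin).
have [M1_0 M1_le] := M1_spec Au zA bs bn cr.
have e1S := @usphere_e1 R n.
have bM2 : betaA A beta <= M2 A beta.
  rewrite (betaA_eq xmin); apply: le_trans (M2_ge Au zA bn e1S).
  by have := xmin.2 (e1 R n); rewrite mxE !eqxx normr1 mulr1.
set K := M2 A beta / M1 A beta.
have K0 : 0 <= K by rewrite divr_ge0 ?ltW// (lt_le_trans b0).
(* The first coordinate of [xi] is [cn], and M1 <= surf xi = cn betaA <= cn M2. *)
have K1 : 1 <= K * `|xi ord0 0|.
  rewrite xiE gtr0_norm// mulrAC ler_pdivlMr// mul1r.
  by apply: le_trans (M1_le _ xiS) _; rewrite surfxi mulrC ler_pM2r.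
set mx := \big[Num.max/0]_(j | j != ord0) l j.
have mx0 : 0 <= mx by rewrite /mx; elim/big_rec: _ => // i y _ y0; rewrite le_max y0 orbT.
(* The clearance that [central_hyperplane_offset] leaves between the hyperplane and either end of
   the box. *)
pose d := l ord0 / 2 - n%:R * mx * K / 2.
have d0 : 0 < d.
  have mK : 0 <= mx * K by rewrite mulr_ge0.
  have h : n.+1%:R * (mx * K) <= l ord0.
    apply: le_trans lmin; rewrite /Lmin -!mulrA; exact: ler_wpM2r.
  have l00 := l0 ord0.
  rewrite -natr1 mulrDl mul1r in h.
  have -> : d = (l ord0 - n%:R * (mx * K)) / 2 by rewrite /d mulrBl !mulrA.
  rewrite divr_gt0// subr_gt0.
  by move: h mK; rewrite le0r => h /orP[/eqP mK|mK]; [rewrite mK mulr0 | lra].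
pose c := dot (\col_i (l i / 2)) xi.
have off x : dot x xi = c -> (forall i, i != ord0 -> 0 <= x i 0 <= l i) ->
    d <= x ord0 0 <= l ord0 - d.
  move=> xc xl; have xi1 i : `|xi i 0| <= 1 by exact: usphere_coord.
  have := central_hyperplane_offset xi1 K1 K0 xc xl.
  by rewrite -/mx ler_norml /d => /andP[? ?]; apply/andP; split; lra.
exists xi, c; split.
- by apply: (vertex_crystallographic Au zA) => //; exact: lt0r_neq0.
- have lA0 : 0 <= lA A by apply: sumr_ge0.
  have lA1 : 0 < 2 * lA A + 1 by rewrite ltr_wpDl// mulr_ge0.
  have B0 : 0 < d / (2 * lA A + 1) by rewrite divr_gt0.
  near=> eps => x [xc xO].
  have eps0 : 0 < eps by near: eps; exact: nbhs_right_gt.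
  have : eps < d / (2 * lA A + 1) by near: eps; exact: nbhs_right_lt.
  rewrite ltr_pdivlMr// => h.
  have /andP[lo hi] := off x xc (fun i _ => closure_Omega xO i).
  by split=> // -[[_ h']|[_ h']]; lra.
have -> : Elim A l z W beta a =
    (surf A beta xi * ((\prod_(i | i != ord0) l i) / (`|xi ord0 0| * \det A)))%:E.
  rewrite /Elim; have -> : mine ((2^-1 * l ord0 * alphaA z W)%:E * (a * a))%E
      (betaA A beta)%:E = (betaA A beta)%:E.
    case: a aca a0 {ha} => [a| |]// ac a0; last by rewrite mulyy gt0_muley ?lte_fin// minye.
    rewrite !lee_fin in ac a0.
    by rewrite -!EFinM -EFin_min min_r// -acE ler_pM2l// -expr2 ler_sqr ?nnegrE// ltW.
  rewrite -EFinM surfxi xiE gtr0_norm//; congr (_%:E).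
  by field; rewrite !lt0r_neq0.
have xi0 : xi ord0 0 != 0 by rewrite xiE lt0r_neq0.
apply: (energy_y_cr_cvg dA l0 zA adm xi0 d0 off).
(* Half of [acrit], because a may equal [acrit] and a bound valid near the limit has to lie strictly
   below it. *)
have r0 : 0 < acrit A l z W beta / 2 by rewrite divr_gt0.
apply: (jump_diverges r0 (l0 ord0)); apply: near_ereal_limit_ge ha.
by apply: lt_le_trans aca; rewrite lte_fin; lra.
Unshelve. all: by end_near. Qed.
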